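(* Let $\alpha\in(1-H,1/2)$. For any (probability) distribution function $F$ on $\mathbb R$ there exists an $\mathbb F$-adapted process $\zeta=\{\zeta_t,t\in[0,1]\}$ such that $\|\zeta\|_{\alpha,1}<\infty$ almost surely and the distribution function of the random variable $\int_0^1\zeta_s\,dB^H_s$ is $F$.
   Context: Let $(\Omega,\mathcal F,\mathsf P)$ be a complete probability space with a $\mathsf P$-complete left-continuous filtration $\mathbb F=\{\mathcal F_t,t\in[0,1]\}$. Let $B^H=\{B^H_t,t\in[0,1]\}$ be a fractional Brownian motion with Hurst parameter $H\in(1/2,1)$, i.e. an $\mathbb F$-adapted centered Gaussian process with $\mathsf E[B^H_tB^H_s]=\frac12(s^{2H}+t^{2H}-|s-t|^{2H})$, with continuous paths. For $\alpha>0$ and $t\in(0,1]$ define $$\|f\|_{\alpha,t}=\int_0^t\left(\frac{|f(s)|}{s^\alpha}+\int_0^s\frac{|f(s)-f(z)|}{(s-z)^{1+\alpha}}\,dz\right)ds.$$ Integrals with respect to $B^H$ are pathwise generalized Lebesgue--Stieltjes integrals: if $\|f\|_{\alpha,t}<\infty$ for some $\alpha\in(1-H,1)$, then $$\int_0^t f_s\,dB^H_s=\frac{1}{\Gamma(1-\alpha)\Gamma(\alpha)}\int_0^t\left(\frac{f(x)}{x^\alpha}+\alpha\int_0^x\frac{f(x)-f(u)}{(x-u)^{1+\alpha}}du\right)\left(\frac{B^H_t-B^H_x}{(t-x)^{1-\alpha}}+(1-\alpha)\int_x^t\frac{B^H_u-B^H_x}{(u-x)^{2-\alpha}}du\right)dx.$$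 Almost surely, the second factor is bounded in $x$, and the value does not depend on the choice of such $\alpha$. *)

(* Defs.v *)
From HB Require Import structures.
From mathcomp Require Import all_boot all_order all_algebra.
From mathcomp Require Import all_classical all_reals all_analysis.

Set Implicit Arguments.
Unset Strict Implicit.
Unset Printing Implicit Defensive.

Import Order.TTheory GRing.Theory Num.Theory.
Import numFieldNormedType.Exports.

Local Open Scope classical_set_scope.
Local Open Scope ring_scope.

(* Objects indexed by the time interval [0, 1] are total functions on [R];
   nothing is assumed or claimed about their values outside [0, 1]. *)

Section stochastic_basis.
Context d (T : measurableType d) (R : realType) (P : probability T R).

Record complete_left_continuous_filtration (F : R -> set (set T)) : Prop := {
  filtration_sigma_algebra :
    forall t : R, 0 <= t <= 1 -> sigma_algebra [set: T] (F t);
  filtration_measurable : forall t : R, 0 <= t <= 1 -> F t `<=` measurable;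
  filtration_nondecreasing :
    forall s t : R, 0 <= s -> s <= t -> t <= 1 -> F s `<=` F t;
  filtration_complete : forall t : R, 0 <= t <= 1 -> P.-negligible `<=` F t;
  filtration_left_continuous :
    forall t : R, 0 < t <= 1 -> F t = <<s \bigcup_(s in `[0, t[) F s >> }.

Definition adapted (F : R -> set (set T)) (X : R -> T -> R) : Prop :=
  forall t : R, 0 <= t <= 1 ->
  forall A : set R, measurable A -> F t (X t @^-1` A).

(* Constants count as Gaussian. The case [s = 0] is separated because the
   library's [normal_prob m 0] is not the Dirac mass at [m]. *)
Definition gaussian_variable (X : T -> R) : Prop :=
  measurable_fun [set: T] X /\
  exists m s : R, 0 <= s /\
    forall A : set R, measurable A ->
      P (X @^-1` A) = if s == 0 then \d_m A else normal_prob m s A.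

Definition gaussian_process (X : R -> T -> R) : Prop :=
  forall (n : nat) (t a : 'I_n -> R), (forall i, 0 <= t i <= 1) ->
    gaussian_variable (fun w => \sum_(i < n) a i * X (t i) w).

Record fractional_brownian_motion
    (F : R -> set (set T)) (H : R) (B : R -> T -> R) : Prop := {
  fbm_adapted : adapted F B;
  fbm_gaussian : gaussian_process B;
  fbm_centered : forall t : R, 0 <= t <= 1 -> ('E_P[B t] = 0)%E;
  fbm_covariance : forall s t : R, 0 <= s <= 1 -> 0 <= t <= 1 ->
    ('E_P[fun w => (B t w * B s w)%R])%E =
      (2^-1 * (s `^ (2 * H) + t `^ (2 * H) - `|s - t| `^ (2 * H)))%:E;
  fbm_continuous : forall w, {within `[0, 1], continuous (B ^~ w)} }.

End stochastic_basis.

Section pathwise_integral.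
Context (R : realType).
Local Notation mu := (@lebesgue_measure R).
Implicit Types (alpha t : R) (f g : R -> R).

Definition Gamma (a : R) : R :=
  \int[mu]_(x in `]0, +oo[) (x `^ (a - 1) * expR (- x)).

Definition frac_norm alpha t f : \bar R :=
  (\int[mu]_(s in `[0%R, t])
     ((`|f s| / s `^ alpha)%:E +
      \int[mu]_(z in `[0%R, s]) (`|f s - f z| / (s - z) `^ (1 + alpha))%:E))%E.

(* The library integral is total, so finiteness of the norm carries
   information only together with measurability of [f]. *)
Definition frac_norm_finite alpha t f : Prop :=
  measurable_fun `[0, t] f /\ (frac_norm alpha t f < +oo)%E.

Definition gls_integral alpha t f g : R :=
  (Gamma (1 - alpha) * Gamma alpha)^-1 *
  \int[mu]_(x in `[0, t])
    ((f x / x `^ alpha +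
      alpha * \int[mu]_(u in `[0, x]) ((f x - f u) / (x - u) `^ (1 + alpha))) *
     ((g t - g x) / (t - x) `^ (1 - alpha) +
      (1 - alpha) *
        \int[mu]_(u in `[x, t]) ((g u - g x) / (u - x) `^ (2 - alpha)))).

End pathwise_integral.

(* Main.v *)
(** On a step function the pathwise integral against [g] is a positive multiple of
    the sum of [c_i (g 1 - g a_i)], provided the increments of [g] satisfy a
    quadratic integrability condition, which holds almost surely for [B] by Fubini
    because [E (B_u - B_x)^2 = |u - x|^(2H)]. It thus suffices to find an adapted
    process which is almost surely a step function with integral 1. Let
    [t_n = 1 - 2^-(n+1)]. In round [n], starting at [t_n], hold the position
    [p_n / e_n] until [B] first rises by [e_n] or the time [t_(n+1)] is reached,
    where [p_n] is 1 minus the gain so far; the first round in which the rise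
    occurs brings the total gain to 1 and ends the game. Since [B] immediately
    exceeds its value at [t_n], the levels [e_n] can be taken so small that round
    [n] fails with probability at most [1 / (n+1)], so the game ends almost surely
    after finitely many rounds. All rounds take place after time 1/2, so the
    process may be multiplied by any function of [B_(1/2) - B_0]; the quantile
    transform of this Gaussian variable gives the required law. *)

Require Import Defs.
From HB Require Import structures.
From mathcomp Require Import all_boot all_order all_algebra.
From mathcomp Require Import all_classical all_reals all_analysis.
From mathcomp Require Import measurable_realfun ring lra.

Set Implicit Arguments.
Unset Strict Implicit.
Unset Printing Implicit Defensive.

Import Order.TTheory GRing.Theory Num.Theory.
Import numFieldNormedType.Exports.

Local Open Scope classical_set_scope.
Local Open Scope ring_scope.

(** * Affine substitutions and integrals of powers *)

(** For the indicator of []a, 1]] the left factor of the pathwise integral collapses to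
    [(x - a)^(-al)], so everything rests on the double integral of [(x - a)^(-al) (u - x)^(al - 2)
    (G u - G x)]. Paths are only known to be continuous, so absolute convergence comes from the
    inequality of arithmetic and geometric means and not from a Hölder exponent: one majorant
    carries the power [-2 al] of [x - a], which is where [al < 1/2] enters, the other is the
    quadratic integral, almost surely finite for [al > 1 - H]. Setting [u = x + (x - a) r] and
    integrating in [x] first leads to Frullani's formula, and of the resulting constant only
    positivity matters.

    That the path rises at once follows from second moments: increments over geometrically shrinking
    lengths decorrelate, and an average of nonpositive variables that are rarely close to 0 cannot
    have a small second moment.

    The process has two descriptions: a pointwise formula that looks only at the past gives
    adaptedness, and a finite list of jumps involving the exit times gives the integral. *)

Section affine_substitution.
Context (R : realType).
Local Notation mu := (@lebesgue_measure R).
Local Notation MR := (measurableTypeR R).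
Implicit Types (c e : R) (D : set R).

Lemma measurable_affine c e D : measurable_fun D (fun x : R => c * x + e).
Proof. by apply: measurable_funD => //; apply: measurable_funM. Qed.

(** Uniqueness of Lebesgue measure reduces this to half-open intervals; for negative [c] the
    preimage of []a, b]] is closed at the other end, hence the two cases. *)
Lemma lebesgue_measure_affine c e (A : set MR) : c != 0 -> measurable A ->
  mu A = (`|c|%:E * pushforward mu (fun x : MR => (c * x + e)%R : MR) A)%E.
Proof.
move=> c0 mA; have c_ge0 : 0 <= `|c| by [].
pose phi : MR -> MR := fun x => c * x + e.
have mphi : measurable_fun setT phi by exact: measurable_affine.
pose nu : {measure set MR -> \bar R} := pushforward mu phi.
suff /(_ A mA) : forall A, measurable A -> mu A = mscale (NngNum c_ge0) (nu mphi) A.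
  by [].
apply: lebesgue_measure_unique => _ [[a b] _ <-].
change (mu `]a, b] = `|c|%:E * mu (phi @^-1` `]a, b]))%E.
case: (ltgtP c 0) c0 => // c0 _.
- rewrite [X in (_ * mu X)%E](_ : _ = `[(b - e) / c, (a - e) / c[%classic); last first.
    apply/seteqP; split=> x /=; rewrite /phi !in_itv/= ler_ndivrMr// ltr_ndivlMr//;
      rewrite [x * c]mulrC => /andP[h1 h2]; apply/andP; split; lra.
  rewrite !lebesgue_measure_itv/= !lte_fin ltr0_norm//.
  rewrite ltr_nM2r ?invr_lt0// ltrD2r; case: ltP => ab; last by rewrite mule0.
  by rewrite -EFinB -EFinM; congr EFin; field; rewrite lt_eqF.
- rewrite [X in (_ * mu X)%E](_ : _ = `](a - e) / c, (b - e) / c]%classic); last first.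
    apply/seteqP; split=> x /=; rewrite /phi !in_itv/= ler_pdivlMr// ltr_pdivrMr//;
      rewrite [x * c]mulrC => /andP[h1 h2]; apply/andP; split; lra.
  rewrite !lebesgue_measure_itv/= !lte_fin gtr0_norm//.
  rewrite ltr_pM2r ?invr_gt0// ltrD2r; case: ltP => ab; last by rewrite mule0.
  by rewrite -EFinB -EFinM; congr EFin; field; rewrite gt_eqF.
Qed.

Lemma ge0_integral_affine c e D (f : R -> \bar R) : c != 0 -> measurable D ->
  measurable_fun D f -> {in D, forall y, (0 <= f y)%E} ->
  (\int[mu]_(y in D) f y =
   `|c|%:E * \int[mu]_(x in (fun x => c * x + e)%R @^-1` D) f (c * x + e)%R)%E.
Proof.
move=> c0 mD mf f0; have c_ge0 : 0 <= `|c| by [].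
pose phi : MR -> MR := fun x => c * x + e.
have mphi : measurable_fun setT phi by exact: measurable_affine.
pose nu : {measure set MR -> \bar R} := pushforward mu phi.
rewrite -[X in (_ * X)%E](ge0_integral_pushforward mphi)//.
rewrite -(ge0_integral_mscale (nu mphi) mD (NngNum c_ge0))//; last first.
  by move=> x Dx; apply: f0; rewrite inE.
apply: eq_measure_integral => A mA _.
exact: lebesgue_measure_affine.
Qed.

Lemma integrable_affine c e D (f : R -> R) : c != 0 -> measurable D ->
  mu.-integrable D (EFin \o f) ->
  mu.-integrable ((fun x => c * x + e) @^-1` D)
    (EFin \o (fun x => f (c * x + e))).
Proof.
move=> c0 mD /integrableP[mf fi].
have mf' : measurable_fun D f by apply/measurable_EFinP.
have mD' : measurable ((fun x => c * x + e) @^-1` D).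
  by rewrite -[X in measurable X]setTI; apply: measurable_affine.
apply/integrableP; split.
  apply/measurable_EFinP; apply: (@measurable_comp _ _ _ _ _ _ D f) => //.
    by move=> _ [x ? <-].
  exact: measurable_affine.
rewrite (ge0_integral_affine (c := c) e) in fi => //; last first.
  by apply: measurableT_comp => //; apply/measurable_EFinP.
rewrite ltey; apply/eqP => h; move: fi; rewrite h.
by rewrite gt0_muley ?lte_fin ?normr_gt0.
Qed.

Lemma Rintegral_affine c e D (f : R -> R) : c != 0 -> measurable D ->
  mu.-integrable D (EFin \o f) ->
  \int[mu]_(y in D) f y =
  `|c| * \int[mu]_(x in (fun x => c * x + e) @^-1` D) f (c * x + e).
Proof.
move=> c0 mD fi; have fi' := integrable_affine e c0 mD fi.
have mD' : measurable ((fun x => c * x + e) @^-1` D).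
  by rewrite -[X in measurable X]setTI; apply: measurable_affine.
have mf : measurable_fun D f by apply/measurable_EFinP; case/integrableP : fi.
have e1 : (\int[mu]_(y in D) (EFin \o f) y =
   `|c|%:E * \int[mu]_(x in (fun x => c * x + e)%R @^-1` D)
      (EFin \o (fun x => f (c * x + e)%R)) x)%E.
  rewrite integralE [in RHS]integralE.
  rewrite (ge0_integral_affine (c := c) e)//; last first.
    by apply: measurable_funepos; apply/measurable_EFinP.
  rewrite (ge0_integral_affine (c := c) e (f := ((EFin \o f)^\-)%E))//; last first.
    by apply: measurable_funeneg; apply/measurable_EFinP.
  rewrite [RHS]muleBr//; first by congr (_ * _ - _ * _)%E; apply: eq_integral => x _;
    rewrite ?funeposE ?funenegE.
  apply: fin_num_adde_defl; rewrite fin_numN.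
  exact: integrable_neg_fin_num fi'.
rewrite /Rintegral -/(EFin \o f) e1 fineM//.
exact: integrable_fin_num.
Qed.

End affine_substitution.

Section power_integrals.
Context (R : realType).
Local Notation mu := (@lebesgue_measure R).
Implicit Types (a b p s x : R).

Lemma continuous_powR p x : 0 < x -> {for x, continuous (fun y : R => y `^ p)}.
Proof.
move=> x0; apply: differentiable_continuous; apply/derivable1_diffP.
by apply: derivable_powR; rewrite in_itv/= andbT.
Qed.

Lemma is_derive_powR_primitive p x : 0 < x -> p + 1 != 0 ->
  is_derive x 1 (fun y : R => y `^ (p + 1) / (p + 1)) (x `^ p).
Proof.
move=> x0 p0.
have h : is_derive x 1 (fun y : R => y `^ (p + 1)) ((p + 1) * x `^ (p + 1 - 1)).
  exact: is_derive1_powR.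
have -> : (fun y : R => y `^ (p + 1) / (p + 1)) =
    (p + 1)^-1 *: (fun y : R => y `^ (p + 1)).
  by apply/funext => y /=; rewrite mulrC.
apply: is_derive_eq.
by rewrite addrK scalerA mulVf// scale1r.
Qed.

Lemma integral_powR p a b : 0 < a -> a <= b -> p + 1 != 0 ->
  (\int[mu]_(x in `[a, b]) (x `^ p)%:E =
   ((b `^ (p + 1) - a `^ (p + 1)) / (p + 1))%:E)%E.
Proof.
move=> a0; rewrite le_eqVlt => /predU1P[<- _|ab p0].
  by rewrite set_itv1 integral_set1 subrr mul0r.
have dF x : 0 < x -> is_derive x 1 (fun y : R => y `^ (p + 1) / (p + 1)) (x `^ p).
  by move=> x0; exact: is_derive_powR_primitive.
have cF x : 0 < x -> {for x, continuous (fun y : R => y `^ (p + 1) / (p + 1))}.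
  move=> x0; apply: differentiable_continuous; apply/derivable1_diffP.
  by have [] := dF x x0.
rewrite (@continuous_FTC2 _ _ (fun y : R => y `^ (p + 1) / (p + 1)))//.
- by rewrite -EFinB mulrBl.
- apply: continuous_in_subspaceT => x /set_mem /=; rewrite in_itv/= => /andP[ax _].
  by apply: continuous_powR; exact: lt_le_trans ax.
- split => [x|/=|/=].
  + rewrite in_itv/= => /andP[ax _].
    by have [] := dF x (lt_trans a0 ax).
  + by apply: cvg_at_right_filter; exact: cF.
  + by apply: cvg_at_left_filter; apply: cF; exact: lt_trans ab.
- move=> x; rewrite in_itv/= => /andP[ax _].
  by rewrite derive1E; have [] := dF x (lt_trans a0 ax).
Qed.

(** The power may be singular at 0, so the closed form on [[b / (n+1), b]] is passed to the limit by
    monotone convergence; [p + 1 > 0] makes the lower boundary term vanish. *)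
Lemma integral_powR0 p b : 0 < b -> -1 < p ->
  (\int[mu]_(x in `]0%R, b]) (x `^ p)%:E = (b `^ (p + 1) / (p + 1))%:E)%E.
Proof.
move=> b0 p1; have p10 : 0 < p + 1 by lra.
pose F (n : nat) : set R := `[b / n.+1%:R, b]%classic.
have FE : \bigcup_n F n = `]0, b]%classic.
  apply/seteqP; split=> [x [n _]|x]; rewrite /F/= !in_itv/= => /andP[h1 h2].
    by rewrite h2 andbT (lt_le_trans _ h1)// divr_gt0.
  exists (Num.truncn (b / x)) => //=; rewrite in_itv/= h2 andbT.
  rewrite ler_pdivrMr// mulrC -ler_pdivrMr//.
  by apply: ltW; rewrite truncnS_gt.
have ndF : nondecreasing_seq F.
  move=> m n mn; rewrite subsetEset => x; rewrite /F/= !in_itv/= => /andP[h1 ->].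
  rewrite andbT; apply: le_trans h1; rewrite ler_pM2l// lef_pV2 ?posrE//.
  by rewrite ler_nat.
have mF i : measurable (F i) by exact: measurable_itv.
have c1 : (\int[mu]_(x in F i) (x `^ p)%:E @[i --> \oo] -->
    \int[mu]_(x in \bigcup_i F i) (x `^ p)%:E)%E.
  apply: ge0_nondecreasing_set_cvg_integral => //.
  - by move=> i; apply/measurable_EFinP; apply: measurable_funTS.
  - by move=> i x _; rewrite lee_fin powR_ge0.
rewrite -FE -(cvg_lim _ c1)//; apply/cvg_lim => //.
rewrite (_ : (fun i => _) =
    fun i => ((b `^ (p + 1) - (b / i.+1%:R) `^ (p + 1)) / (p + 1))%:E); last first.
  apply/funext => i; rewrite integral_powR ?gt_eqF ?divr_gt0// ?ler_pdivrMr ?ler_peMr ?ler1n ?ltW//.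
apply: cvg_EFin; first exact: nearW.
rewrite [X in _ --> X](_ : _ = (b `^ (p + 1) - 0) / (p + 1)); last by rewrite subr0.
apply: cvgM; last exact: cvg_cst.
apply: cvgB; first exact: cvg_cst.
move: (powR_cvg0 p10) => /cvg_at_rightP; apply; split => [n|].
  by rewrite divr_gt0.
rewrite -[X in _ --> X](mulr0 b); apply: cvgM; first exact: cvg_cst.
exact: cvg_harmonic.
Qed.

Lemma powR_cvgy0 p : p < 0 -> x `^ p @[x --> +oo%R] --> (0 : R).
Proof.
move=> p0; apply/cvgrPdist_le => /= e e0; near=> y.
have y0 : 0 < y by near: y; exact: nbhs_pinfty_gt.
have ye : e `^ p^-1 <= y by near: y; exact: nbhs_pinfty_ge.
rewrite sub0r normrN ger0_norm ?powR_ge0// -[p]opprK powRN.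
rewrite -[leRHS]invrK lef_pV2 ?posrE ?powR_gt0 ?invr_gt0//.
have -> : e^-1 = (e `^ p^-1) `^ (- p).
  by rewrite -powRrM mulrN mulVf ?lt_eqF// powR_inv1// ltW.
by apply: ge0_ler_powR; rewrite ?nnegrE ?powR_ge0// ?oppr_ge0 ltW.
Unshelve. all: by end_near. Qed.

Lemma integral_powRy p b : 0 < b -> p < -1 ->
  (\int[mu]_(x in `[b, +oo[) (x `^ p)%:E = (b `^ (p + 1) / - (p + 1))%:E)%E.
Proof.
move=> b0 p1; have p10 : p + 1 != 0 by lra.
have dF x : 0 < x -> is_derive x 1 (fun y : R => y `^ (p + 1) / (p + 1)) (x `^ p).
  by move=> x0; exact: is_derive_powR_primitive.
have cF x : 0 < x -> {for x, continuous (fun y : R => y `^ (p + 1) / (p + 1))}.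
  move=> x0; apply: differentiable_continuous; apply/derivable1_diffP.
  by have [] := dF x x0.
rewrite (@ge0_continuous_FTC2y _ _ (fun y : R => y `^ (p + 1) / (p + 1)) _ 0)//.
- by rewrite sub0e; congr EFin; rewrite invrN mulrN.
- by move=> x _; rewrite powR_ge0.
- apply: continuous_in_subspaceT => x /set_mem /=; rewrite in_itv/= andbT => bx.
  by apply: continuous_powR; exact: lt_le_trans bx.
- rewrite -[X in _ --> X](mul0r ((p + 1)^-1)); apply: cvgM; last exact: cvg_cst.
  by apply: powR_cvgy0; lra.
- by move=> x bx; have [] := dF x (lt_trans b0 bx).
- by apply: cvg_at_right_filter; exact: cF.
- move=> x; rewrite in_itv/= andbT => bx.
  by rewrite derive1E; have [] := dF x (lt_trans b0 bx).
Qed.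

End power_integrals.

Section shifted_power_integrals.
Context (R : realType).
Local Notation mu := (@lebesgue_measure R).
Implicit Types (a b p x : R).

Lemma measurable_powR_subl a p (D : set R) :
  measurable_fun D (fun x => (x - a) `^ p).
Proof.
by apply: (@measurableT_comp _ _ _ _ _ _ (@powR R ^~ p)) => //; exact: measurable_funB.
Qed.

Lemma measurable_powR_subr a p (D : set R) :
  measurable_fun D (fun x => (a - x) `^ p).
Proof.
by apply: (@measurableT_comp _ _ _ _ _ _ (@powR R ^~ p)) => //; exact: measurable_funB.
Qed.

Lemma integral_powR_subl a b p : a < b -> -1 < p ->
  (\int[mu]_(x in `]a, b]) ((x - a) `^ p)%:E =
   ((b - a) `^ (p + 1) / (p + 1))%:E)%E.
Proof.
move=> ab p1; rewrite -(@integral_powR0 _ p (b - a)); [|by rewrite subr_gt0|by []].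
rewrite (ge0_integral_affine (c := 1) a)//; last 2 first.
- by apply/measurable_EFinP; exact: measurable_powR_subl.
- by move=> x _; rewrite lee_fin powR_ge0.
rewrite normr1 mul1e; set D := _ @^-1` _.
have -> : D = `]0, b - a]%classic.
  by apply/seteqP; split=> x; rewrite /D/= !in_itv/= => /andP[? ?]; apply/andP; split; lra.
by apply: eq_integral => x _; rewrite mul1r addrK.
Qed.

Lemma integral_powR_subr a b p : a < b -> -1 < p ->
  (\int[mu]_(x in `[a, b[) ((b - x) `^ p)%:E =
   ((b - a) `^ (p + 1) / (p + 1))%:E)%E.
Proof.
move=> ab p1; rewrite -(@integral_powR0 _ p (b - a)); [|by rewrite subr_gt0|by []].
rewrite (ge0_integral_affine (c := -1) b)//; last 2 first.
- by apply/measurable_EFinP; exact: measurable_powR_subr.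
- by move=> x _; rewrite lee_fin powR_ge0.
rewrite normrN1 mul1e; set D := _ @^-1` _.
have -> : D = `]0, b - a]%classic.
  by apply/seteqP; split=> x; rewrite /D/= !in_itv/= => /andP[? ?]; apply/andP; split; lra.
by apply: eq_integral => x _; rewrite mulN1r opprD opprK addrCA subrr addr0.
Qed.

Lemma integral_powR_suby x b p : x < b -> p < -1 ->
  (\int[mu]_(u in `[b, +oo[) ((u - x) `^ p)%:E =
   ((b - x) `^ (p + 1) / - (p + 1))%:E)%E.
Proof.
move=> xb p1; rewrite -(@integral_powRy _ p (b - x)); [|by rewrite subr_gt0|by []].
rewrite (ge0_integral_affine (c := 1) x)//; last 2 first.
- by apply/measurable_EFinP; exact: measurable_powR_subl.
- by move=> u _; rewrite lee_fin powR_ge0.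
rewrite normr1 mul1e; set D := _ @^-1` _.
have -> : D = `[b - x, +oo[%classic.
  by apply/seteqP; split=> u; rewrite /D/= !in_itv/= !andbT => ?; lra.
by apply: eq_integral => u _; rewrite mul1r addrK.
Qed.

Lemma integral_powR_sub0 x a p : a < x -> 0 <= a -> p + 1 != 0 ->
  (\int[mu]_(u in `[0%R, a]) ((x - u) `^ p)%:E =
   ((x `^ (p + 1) - (x - a) `^ (p + 1)) / (p + 1))%:E)%E.
Proof.
move=> ax a0 p1; rewrite -(@integral_powR _ p (x - a) x); [|by rewrite subr_gt0|by rewrite gerBl|by []].
rewrite (ge0_integral_affine (c := -1) x)//; last 2 first.
- by apply/measurable_EFinP; exact: measurable_powR_subr.
- by move=> u _; rewrite lee_fin powR_ge0.
rewrite normrN1 mul1e; set D := _ @^-1` _.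
have -> : D = `[x - a, x]%classic.
  by apply/seteqP; split=> u; rewrite /D/= !in_itv/= => /andP[? ?]; apply/andP; split; lra.
by apply: eq_integral => u _; rewrite mulN1r opprD opprK addrCA subrr addr0.
Qed.

End shifted_power_integrals.

Lemma integral_if d (T : measurableType d) (R : realType)
    (m : {measure set T -> \bar R}) (D : set T) (b : T -> bool) (f : T -> R) :
  (forall x, b x <-> D x) ->
  (\int[m]_x (if b x then f x else 0)%:E = \int[m]_(x in D) (f x)%:E)%E.
Proof.
move=> bD; rewrite [RHS]integral_mkcond; apply: eq_integral => x _.
rewrite patchE; case: ifPn => bx; first by rewrite mem_set//; exact/bD.
by rewrite memNset// => /bD; rewrite (negbTE bx).
Qed.

Arguments integral_if {d T R m} D {b f}.

Section beta_integral.
Context (R : realType).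
Local Notation mu := (@lebesgue_measure R).
Implicit Types (a x u r p : R).

Lemma integral_powR_sub_lty a p : -1 < p -> a < 1 ->
  (\int[mu]_(x in `]a, 1%R[) ((x - a) `^ p)%:E < +oo)%E.
Proof.
move=> p1 a1; apply: (@le_lt_trans _ _ (\int[mu]_(x in `]a, 1%R]) ((x - a) `^ p)%:E)%E).
  apply: ge0_subset_integral => //.
  - by apply/measurable_EFinP; exact: measurable_powR_subl.
  - by move=> x _; rewrite lee_fin powR_ge0.
  - by move=> x /=; rewrite !in_itv/= => /andP[-> /ltW ->].
by rewrite integral_powR_subl// ltry.
Qed.

Lemma integral_powR_subr_lty a p : -1 < p -> a < 1 ->
  (\int[mu]_(x in `]a, 1%R[) ((1 - x) `^ p)%:E < +oo)%E.
Proof.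
move=> p1 a1; apply: (@le_lt_trans _ _ (\int[mu]_(x in `[a, 1%R[) ((1 - x) `^ p)%:E)%E).
  apply: ge0_subset_integral => //.
  - by apply/measurable_EFinP; exact: measurable_powR_subr.
  - by move=> x _; rewrite lee_fin powR_ge0.
  - by move=> x /=; rewrite !in_itv/= => /andP[/ltW -> ->].
by rewrite integral_powR_subr// ltry.
Qed.

(** Only one factor is singular at each endpoint. With [l] half the length of the interval, every
    point is at distance at least [l] from one endpoint, and the factor attached to that endpoint is
    at most its value at distance [l]. *)
Lemma beta_integral_lty a p : a < 1 -> 0 < p < 1 ->
  (\int[mu]_(x in `]a, 1%R[) ((x - a) `^ (- p) * (1 - x) `^ (p - 1))%:E < +oo)%E.
Proof.
move=> a1 /andP[p0 p1].
pose l := (1 - a) / 2; have l0 : 0 < l by rewrite /l; lra.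
have mD : measurable (`]a, 1[ : set R) by exact: measurable_itv.
have m1 : measurable_fun (`]a, 1[ : set R) (fun x => (x - a) `^ (- p)).
  exact: measurable_powR_subl.
have m2 : measurable_fun (`]a, 1[ : set R) (fun x => (1 - x) `^ (p - 1)).
  exact: measurable_powR_subr.
have b1 := @integral_powR_sub_lty a (- p) ltac:(lra) a1.
have b2 := @integral_powR_subr_lty a (p - 1) ltac:(lra) a1.
apply: (@le_lt_trans _ _ (\int[mu]_(x in `]a, 1%R[)
   ((l `^ (p - 1))%:E * ((x - a) `^ (- p))%:E +
    (l `^ (- p))%:E * ((1 - x) `^ (p - 1))%:E))%E).
  apply: ge0_le_integral => //.
  - by move=> x _; rewrite lee_fin mulr_ge0 ?powR_ge0.
  - by apply/measurable_EFinP; exact: measurable_funM.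
  - apply: emeasurable_funD; apply: emeasurable_funM => //;
      exact/measurable_EFinP.
  - move=> x /=; rewrite in_itv/= => /andP[ax x1].
    rewrite -!EFinM -EFinD lee_fin.
    have pw q y : 0 < y -> q < 0 -> l <= y -> y `^ q <= l `^ q.
      move=> y0 q0 ly; rewrite -[q]opprK powRN [leRHS]powRN.
      rewrite lef_pV2 ?posrE ?powR_gt0//.
      by apply: ge0_ler_powR; rewrite ?nnegrE; lra.
    have [xl|xl] := leP l (x - a).
      apply: le_trans (_ : l `^ (- p) * (1 - x) `^ (p - 1) <= _).
        by apply: ler_wpM2r; rewrite ?powR_ge0//; apply: pw; lra.
      by rewrite lerDr mulr_ge0 ?powR_ge0.
    apply: le_trans (_ : l `^ (p - 1) * (x - a) `^ (- p) <= _).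
      rewrite mulrC; apply: ler_wpM2r; rewrite ?powR_ge0//.
      by apply: pw; rewrite /l in xl *; lra.
    by rewrite lerDl mulr_ge0 ?powR_ge0.
rewrite ge0_integralD//; last 4 first.
- by move=> x _; rewrite -EFinM lee_fin mulr_ge0 ?powR_ge0.
- by apply: emeasurable_funM => //; exact/measurable_EFinP.
- by move=> x _; rewrite -EFinM lee_fin mulr_ge0 ?powR_ge0.
- by apply: emeasurable_funM => //; exact/measurable_EFinP.
rewrite !ge0_integralZl_EFin ?powR_ge0//; last 4 first.
- by move=> x _; rewrite lee_fin powR_ge0.
- exact/measurable_EFinP.
- by move=> x _; rewrite lee_fin powR_ge0.
- exact/measurable_EFinP.
by apply: lte_add_pinfty; apply: lte_mul_pinfty => //; rewrite ?lee_fin ?powR_ge0.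
Qed.

End beta_integral.

Ltac solve_measurable := repeat first
  [ assumption | exact: measurable_fst | exact: measurable_snd | exact: measurable_cst
  | apply: (@measurableT_comp _ _ _ _ _ _ (@powR _ ^~ _)); first exact: measurable_powR
  | apply: measurable_and
  | apply: measurable_fun_ltr | apply: measurable_fun_ler
  | apply: measurable_fun_ifT
  | apply: measurable_funX
  | apply: measurable_funM | apply: measurable_funB | apply: measurable_funD ].

(** * The double integral behind the fractional derivatives *)

Section marchaud_kernel_domination.
Context (R : realType) (al ga a M : R) (G : R -> R).
Local Notation mu := (@lebesgue_measure R).
Local Notation MR := (measurableTypeR R).
Hypotheses (al0 : 0 < al) (al1 : al < 2^-1) (ga1 : ga < 1).
Hypotheses (a0 : 0 <= a) (a1 : a < 1).
Hypotheses (cG : continuous G) (GM : forall x, `|G x| <= M).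

(** Integrand of a squared Sobolev-Slobodeckij (Gagliardo) seminorm over the triangle
    [0 < z.1 < z.2 < 1], with a free exponent. *)
Definition slobodeckij (q : R) (g : R -> R) (z : R * R) : R :=
  if [&& 0 < z.1, z.1 < z.2 & z.2 < 1] then
    (g z.2 - g z.1) ^+ 2 * (z.2 - z.1) `^ q else 0.

Hypothesis GS : (\int[mu \x mu]_z (slobodeckij (2 * al - 4 + ga) G z)%:E < +oo)%E.

(* Since [G] will be constant after 1, letting [z.2] run to infinity absorbs the
   boundary term of the right fractional derivative on [0, 1]. *)
Definition marchaud_kernel (z : R * R) : R :=
  if [&& a < z.1, z.1 < 1 & z.1 < z.2] then
    (z.1 - a) `^ (- al) * (z.2 - z.1) `^ (al - 2) * (G z.2 - G z.1) else 0.

Lemma measurable_marchaud_kernel : measurable_fun [set: MR * MR] marchaud_kernel.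
Proof.
have mG : measurable_fun [set: R] G by exact: continuous_measurable_fun.
have mG1 : measurable_fun [set: MR * MR] (fun z => G z.1).
  exact: measurableT_comp.
have mG2 : measurable_fun [set: MR * MR] (fun z => G z.2).
  exact: measurableT_comp.
by rewrite /marchaud_kernel; solve_measurable.
Qed.

Lemma measurable_slobodeckij q : measurable_fun [set: MR * MR] (slobodeckij q G).
Proof.
have mG : measurable_fun [set: R] G by exact: continuous_measurable_fun.
have mG1 : measurable_fun [set: MR * MR] (fun z => G z.1).
  exact: measurableT_comp.
have mG2 : measurable_fun [set: MR * MR] (fun z => G z.2).
  exact: measurableT_comp.
by rewrite /slobodeckij; solve_measurable.
Qed.

(** Together with [slobodeckij], the functions [f1] and [f3] majorize the kernel: [f1] is the
    partner of the quadratic term for [z.2 < 1], and [f3] covers [1 <= z.2], where [2 * M] bounds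
    the increment of [G]. *)
Let f1 (z : R * R) : R := if [&& a < z.1, z.1 < 1, z.1 < z.2 & z.2 < 1] then
    (z.1 - a) `^ (- (2 * al)) * (z.2 - z.1) `^ (- ga) else 0.

Let f3 (z : R * R) : R := if [&& a < z.1, z.1 < 1 & 1 <= z.2] then
    2 * M * (z.1 - a) `^ (- al) * (z.2 - z.1) `^ (al - 2) else 0.

Let mf1 : measurable_fun [set: MR * MR] f1. Proof. by rewrite /f1; solve_measurable. Qed.
Let mf3 : measurable_fun [set: MR * MR] f3. Proof. by rewrite /f3; solve_measurable. Qed.

Let M0 : 0 <= M. Proof. exact: le_trans (GM 0). Qed.

Let f1_ge0 z : 0 <= f1 z.
Proof. by rewrite /f1; case: ifP => // _; rewrite mulr_ge0 ?powR_ge0. Qed.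

Let f3_ge0 z : 0 <= f3 z.
Proof. by rewrite /f3; case: ifP => // _; rewrite !mulr_ge0 ?powR_ge0. Qed.

Let f2_ge0 q z : 0 <= slobodeckij q G z.
Proof. by rewrite /slobodeckij; case: ifP => // _; rewrite mulr_ge0 ?powR_ge0// sqr_ge0. Qed.

Lemma ge0_integrable_prod12 (f : MR * MR -> R) : measurable_fun setT f ->
  (forall z, 0 <= f z) -> (\int[mu]_x \int[mu]_u (f (x, u))%:E < +oo)%E ->
  (mu \x mu)%E.-integrable setT (EFin \o f).
Proof.
move=> mf f0 fi; apply/integrable12ltyP; first exact/measurable_EFinP.
by under eq_integral do under eq_integral do rewrite /= ger0_norm//.
Qed.

(** [al < 1/2] and [ga < 1] place both exponents above -1. *)
Let if1 : (mu \x mu)%E.-integrable setT (EFin \o f1).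
Proof.
move: al0 al1 ga1 a0 a1 M0 => al0' al1' ga1' a0' a1' M0'.
apply: ge0_integrable_prod12 => //.
pose h x := (x - a) `^ (- (2 * al)) * (1 - ga)^-1.
apply: (@le_lt_trans _ _ (\int[mu]_x (if (a < x) && (x < 1) then h x else 0)%:E)%E).
  apply: ge0_le_integral => //.
  - by move=> x _; apply: integral_ge0 => u _; rewrite lee_fin.
  - apply: (@measurable_fun_fubini_tonelli_F _ _ MR MR R mu (EFin \o f1)) => //.
    exact/measurable_EFinP.
  - apply/measurable_EFinP; rewrite /h; apply: measurable_fun_ifT => //.
      by apply: measurable_and; apply: measurable_fun_ltr.
    by apply: measurable_funM => //; exact: measurable_powR_subl.
  - move=> x _; rewrite /f1 /=.
    have [/andP[ax x1]|] := boolP ((a < x) && (x < 1)); last first.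
      move=> /negbTE xa; rewrite integral0_eq// => u _.
      by rewrite andbA xa.
    under eq_integral do rewrite ax x1 /=.
    rewrite (integral_if (`]x, 1[%classic : set MR)); last first.
      by move=> u /=; rewrite in_itv/=.
    under eq_integral do rewrite EFinM.
    rewrite ge0_integralZl_EFin ?powR_ge0//; last 2 first.
    + by move=> u _; rewrite lee_fin powR_ge0.
    + by apply/measurable_EFinP; exact: measurable_powR_subl.
    rewrite /h EFinM; apply: lee_wpmul2l; first by rewrite lee_fin powR_ge0.
    apply: (@le_trans _ _ (\int[mu]_(u in `]x, 1%R]) ((u - x) `^ (- ga))%:E)%E).
      apply: ge0_subset_integral => //.
      * by apply/measurable_EFinP; exact: measurable_powR_subl.
      * by move=> u _; rewrite lee_fin powR_ge0.
      * by move=> u /=; rewrite !in_itv/= => /andP[-> /ltW ->].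
    rewrite integral_powR_subl//; last by lra.
    rewrite lee_fin (addrC (- ga)) -[leRHS]mul1r ler_pM2r ?invr_gt0; last by lra.
    apply: (@le_trans _ _ (1 `^ (1 - ga))); last by rewrite powR1.
    by apply: ge0_ler_powR; rewrite ?nnegrE; lra.
rewrite (integral_if (`]a, 1[%classic : set MR)); last by move=> x /=; rewrite in_itv.
under eq_integral do rewrite /h mulrC EFinM.
rewrite ge0_integralZl_EFin ?invr_ge0//; last 3 first.
- by move=> u _; rewrite lee_fin powR_ge0.
- by apply/measurable_EFinP; exact: measurable_powR_subl.
- by lra.
apply: lte_mul_pinfty => //; first by rewrite lee_fin invr_ge0; lra.
by apply: integral_powR_sub_lty => //; lra.
Qed.

(** Integrating in [u] over [[1, +oo[] leaves the power [(1 - x)^(al - 1)], and a Beta integral in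
    [x] remains. *)
Let if3 : (mu \x mu)%E.-integrable setT (EFin \o f3).
Proof.
move: al0 al1 ga1 a0 a1 M0 => al0' al1' ga1' a0' a1' M0'.
apply: ge0_integrable_prod12 => //.
pose h x := (x - a) `^ (- al) * (1 - x) `^ (al - 1).
have c0 : 0 <= 2 * M / (1 - al) by rewrite divr_ge0 ?mulr_ge0; lra.
rewrite [ltLHS](_ : _ =
    \int[mu]_x (if (a < x) && (x < 1) then 2 * M / (1 - al) * h x else 0)%:E)%E.
  rewrite (integral_if (`]a, 1[%classic : set MR)); last by move=> x /=; rewrite in_itv.
  under eq_integral do rewrite EFinM.
  rewrite ge0_integralZl_EFin//; last 2 first.
  - by move=> u _; rewrite lee_fin mulr_ge0 ?powR_ge0.
  - apply/measurable_EFinP; apply: measurable_funM.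
      exact: measurable_powR_subl.
    exact: measurable_powR_subr.
  apply: lte_mul_pinfty => //.
  by apply: beta_integral_lty; lra.
apply: eq_integral => x _; rewrite /f3 /=.
have [/andP[ax x1]|] := boolP ((a < x) && (x < 1)); last first.
  by move=> /negbTE xa; rewrite integral0_eq// => u _; rewrite andbA xa.
under eq_integral do rewrite ax x1 /=.
rewrite (integral_if (`[1, +oo[%classic : set MR)); last first.
  by move=> u /=; rewrite in_itv/= andbT.
under eq_integral do rewrite EFinM.
rewrite ge0_integralZl_EFin; [|by []| | |]; last 3 first.
- by move=> u _; rewrite lee_fin powR_ge0.
- by apply/measurable_EFinP; exact: measurable_powR_subl.
- by rewrite !mulr_ge0// powR_ge0.
rewrite integral_powR_suby//; last by lra.
rewrite -EFinM /h (_ : al - 2 + 1 = al - 1); last by ring.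
by congr EFin; field; lra.
Qed.

(** For [u < 1] write [(u - x)^(al - 2) = v * w] with [v^2 = (u - x)^(-ga)] and
    [w^2 = (u - x)^(2 al - 4 + ga)]. The absolute value of the kernel is then a product
    [(p v)(q w)], at most [(p v)^2 + (q w)^2]. *)
Lemma integrable_marchaud_kernel : (mu \x mu)%E.-integrable setT (EFin \o marchaud_kernel).
Proof.
move: al0 al1 ga1 a0 a1 M0 => al0' al1' ga1' a0' a1' M0'.
have i2 : (mu \x mu)%E.-integrable setT (EFin \o slobodeckij (2 * al - 4 + ga) G).
  apply/integrableP; split; first by apply/measurable_EFinP; exact: measurable_slobodeckij.
  by under eq_integral do rewrite /= ger0_norm//.
apply: (@le_integrable _ (MR * MR)%type R (mu \x mu)%E setT measurableT _
   (EFin \o (f1 \+ slobodeckij (2 * al - 4 + ga) G \+ f3))).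
- by apply/measurable_EFinP; exact: measurable_marchaud_kernel.
- move=> [x u] _; rewrite /= lee_fin [leRHS]ger0_norm ?addr_ge0//.
  rewrite /marchaud_kernel; case: ifPn => [/and3P[/= ax x1 xu]|_]; last by rewrite normr0 !addr_ge0.
  rewrite /f1 /slobodeckij /f3 /= ax x1 xu (le_lt_trans a0 ax)/=.
  have xa : 0 < x - a by rewrite subr_gt0.
  have ux : 0 < u - x by rewrite subr_gt0.
  rewrite !normrM !(ger0_norm (powR_ge0 _ _)).
  have [u1|u1] := ltP u 1.
    rewrite /= addr0.
    set p := (x - a) `^ (- al); set q := `|G u - G x|.
    have -> : (x - a) `^ (- (2 * al)) = p ^+ 2.
      by rewrite -powR_mulrn ?powR_ge0// -powRrM; congr powR; ring.
    have -> : (G u - G x) ^+ 2 = q ^+ 2 by rewrite real_normK ?num_real.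
    pose v := (u - x) `^ (- ga / 2).
    pose w := (u - x) `^ ((2 * al - 4 + ga) / 2).
    have -> : (u - x) `^ (al - 2) = v * w.
      rewrite /v /w -powRD; last by rewrite (gt_eqF ux) implybT.
      by congr powR; field.
    have -> : (u - x) `^ (- ga) = v ^+ 2.
      by rewrite -powR_mulrn ?powR_ge0// -powRrM; congr powR; field.
    have -> : (u - x) `^ (2 * al - 4 + ga) = w ^+ 2.
      by rewrite -powR_mulrn ?powR_ge0// -powRrM; congr powR; field.
    have p0 : 0 <= p by exact: powR_ge0.
    have v0 : 0 <= v by exact: powR_ge0.
    have w0 : 0 <= w by exact: powR_ge0.
    have q0 : 0 <= q by exact: normr_ge0.
    have h1 : 0 <= (p * v - q * w) ^+ 2 by exact: sqr_ge0.
    have h2 : 0 <= (p * v) * (q * w) by rewrite !mulr_ge0.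
    nra.
  rewrite /= addr0 add0r mulrAC; apply: ler_wpM2r; first exact: powR_ge0.
  rewrite mulrC; apply: ler_wpM2r; first exact: powR_ge0.
  apply: le_trans (ler_normB _ _) _.
  by have := GM u; have := GM x; lra.
- rewrite (_ : EFin \o _ = (EFin \o f1) \+ (EFin \o slobodeckij (2 * al - 4 + ga) G)
     \+ (EFin \o f3))%E; last by [].
  by apply: integrableD => //; apply: integrableD.
Qed.

End marchaud_kernel_domination.

Lemma integrableRZl d (T : measurableType d) (R : realType)
    (m : {measure set T -> \bar R}) (D : set T) (k : R) (f : T -> R) :
  measurable D -> m.-integrable D (EFin \o f) ->
  m.-integrable D (EFin \o (fun x => k * f x)).
Proof. by move=> mD /(integrableZl mD k). Qed.

(** * Frullani's integral *)

Section frullani.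
Context (R : realType).
Local Notation mu := (@lebesgue_measure R).
Implicit Types (a b c L : R) (g : R -> R).

Lemma integrable_div_id g a b : 0 < a -> continuous g ->
  mu.-integrable `]a, b] (EFin \o (fun s => g s / s)).
Proof.
move=> a0 cg.
have : mu.-integrable `[a, b] (EFin \o (fun s => g s / s)).
  apply: continuous_compact_integrable; first exact: segment_compact.
  apply: continuous_in_subspaceT => x /set_mem /=; rewrite in_itv/= => /andP[ax _].
  apply: cvgM; first exact: cg.
  by apply: cvgV; [rewrite gt_eqF// (lt_le_trans a0)|exact: cvg_id].
by apply: integrableS => // x /=; rewrite !in_itv/= => /andP[/ltW -> ->].
Qed.

Lemma integrable_inv a b : 0 < a ->
  mu.-integrable `]a, b] (EFin \o (fun s => 1 / s)).
Proof.
by move=> a0; apply: (integrable_div_id (g := fun=> 1)) => // x; exact: cvg_cst.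
Qed.

Lemma Rintegral_inv a b : 0 < a -> a <= b ->
  \int[mu]_(s in `]a, b]) (1 / s) = ln (b / a).
Proof.
move=> a0; rewrite le_eqVlt => /predU1P[<-|ab].
  by rewrite set_itvoc0 Rintegral_set0 divff ?gt_eqF// ln1.
have b0 : 0 < b by exact: lt_trans ab.
have cl x : 0 < x -> {for x, continuous (@ln R)}.
  by move=> x0; apply: continuous_ln.
rewrite Rintegral_itv_obnd_cbnd; last exact: integrable_inv.
rewrite /Rintegral (@continuous_FTC2 _ _ (@ln R))//.
- by rewrite -EFinB/= ln_div.
- apply: continuous_in_subspaceT => x /set_mem /=; rewrite in_itv/= => /andP[ax _].
  apply: cvgM; first exact: cvg_cst.
  by apply: cvgV; [rewrite gt_eqF// (lt_le_trans a0)|exact: cvg_id].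
- split => [x|/=|/=].
  + rewrite in_itv/= => /andP[ax _].
    by have [] := @is_derive1_ln _ x (lt_trans a0 ax).
  + by apply: cvg_at_right_filter; exact: cl.
  + by apply: cvg_at_left_filter; exact: cl.
- move=> x; rewrite in_itv/= => /andP[ax _].
  by rewrite derive1E div1r; have [] := @is_derive1_ln _ x (lt_trans a0 ax).
Qed.

(** Since [dy / y] is invariant under dilations, the first half becomes an integral over []c a, c
    b]]; the part shared with []a, b]] cancels. *)
Lemma Rintegral_div_dilation g a b c : 0 < a -> a <= b -> 1 < c -> continuous g ->
  \int[mu]_(y in `]a, b]) ((g (c * y) - g y) / y) =
  \int[mu]_(y in `]b, c * b]) (g y / y) - \int[mu]_(y in `]a, c * a]) (g y / y).
Proof.
move=> a0 ab c1 cg.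
have c0 : 0 < c by exact: lt_trans c1.
have cgc : continuous (fun y => g (c * y)).
  move=> y; apply: continuous_comp; last exact: cg.
  by apply: cvgM; [exact: cvg_cst|exact: cvg_id].
under eq_Rintegral do rewrite mulrBl.
rewrite RintegralB//; last 2 first.
- exact: (integrable_div_id (g := fun y => g (c * y))).
- exact: integrable_div_id.
have -> : \int[mu]_(y in `]a, b]) (g (c * y) / y) =
    \int[mu]_(y in `]c * a, c * b]) (g y / y).
  rewrite (@Rintegral_affine _ c 0 `]c * a, c * b] (fun y => g y / y))//; last 2 first.
  - by rewrite gt_eqF.
  - by apply: integrable_div_id => //; rewrite mulr_gt0.
  set D := _ @^-1` _; have -> : D = `]a, b]%classic.
    by apply/seteqP; split=> x; rewrite /D /= !in_itv/= addr0 ltr_pM2l// ler_pM2l.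
  rewrite -RintegralZl//; last first.
    have := @integrable_affine _ c 0 `]c * a, c * b] (fun y => g y / y) _ (measurable_itv `]c * a, c * b])
      (integrable_div_id (c * b) (mulr_gt0 c0 a0) cg).
    set D' := _ @^-1` _; have -> : D' = `]a, b]%classic.
      by apply/seteqP; split=> x; rewrite /D' /= !in_itv/= addr0 ltr_pM2l// ler_pM2l.
    by apply; rewrite gt_eqF.
  apply: eq_Rintegral => y; rewrite inE/= in_itv/= => /andP[ay _].
  by rewrite addr0 gtr0_norm//; field; rewrite !gt_eqF// (lt_trans a0).
have iab := integrable_div_id (c * b) a0 cg.
rewrite -(@Rintegral_itvB _ _ (BRight a) (BRight (c * b)) (c * a) iab); last 2 first.
- by rewrite bnd_simp ler_peMl ?ltW.
- by rewrite bnd_simp ler_pM2l.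
rewrite -(@Rintegral_itvB _ _ (BRight a) (BRight (c * b)) b iab); last 2 first.
- by rewrite bnd_simp.
- by rewrite bnd_simp ler_peMl ?ltW// (lt_le_trans a0).
by ring.
Qed.

Lemma frullani g L c : 0 < L -> 1 < c -> continuous g ->
  (forall y, L <= y -> g y = g L) ->
  mu.-integrable `[0, L] (EFin \o (fun y => (g (c * y) - g y) / y)) ->
  \int[mu]_(y in `[0, L]) ((g (c * y) - g y) / y) = (g L - g 0) * ln c.
Proof.
move=> L0 c1 cg gL; set H : R -> R := fun y => (g (c * y) - g y) / y => iH.
have c0 : 0 < c by exact: lt_trans c1.
have lnc : 0 < ln c by exact: ln_gt0.
apply/eqP; rewrite -subr_eq0 -normr_le0; apply/ler_addgt0Pr => e e0; rewrite add0r.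
have /cvgrPdist_le/(_ (e / 2)) := parameterized_integral_cvg_left L0 iH.
rewrite divr_gt0// => /(_ isT)/= nearH.
(* The mass [ln c] of []x, c x]] turns this tolerance on [g] into an error [e / 2]. *)
have /cvgrPdist_le/(_ (e / 2 / ln c)) := cg 0.
rewrite !divr_gt0// => /(_ isT)/= [t /= t0 gt].
near (0 : R)^'+ => x.
have x0 : 0 < x by near: x; exact: nbhs_right_gt.
have xL : x < L by near: x; exact: nbhs_right_lt.
have cxt : c * x < t.
  by rewrite mulrC -ltr_pdivlMr//; near: x; apply: nbhs_right_lt; rewrite divr_gt0.
have Hx : `|parameterized_integral mu 0 x H| <= e / 2.
  rewrite -normrN -sub0r; near: x.
  exact: cvg_within nearH.
rewrite /parameterized_integral in Hx.
have -> : \int[mu]_(y in `[0, L]) H y =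
    \int[mu]_(y in `[0, x]) H y + \int[mu]_(y in `]x, L]) H y.
  have := @Rintegral_itvB _ _ (BLeft 0) (BRight L) x iH.
  by rewrite !bnd_simp ltW// ltW// => /(_ isT isT) <-; rewrite addrC subrK.
rewrite (@Rintegral_div_dilation g x L c x0 (ltW xL) c1 cg).
have -> : \int[mu]_(y in `]L, c * L]) (g y / y) = g L * ln c.
  transitivity (\int[mu]_(y in `]L, c * L]) (g L * (1 / y))).
    apply: eq_Rintegral => y; rewrite inE/= in_itv/= => /andP[Ly _].
    by rewrite gL ?ltW// div1r.
  rewrite RintegralZl//; last exact: integrable_inv.
  by rewrite Rintegral_inv ?ler_peMl// ?ltW// mulfK// gt_eqF.
have il : mu.-integrable `]x, c * x] (EFin \o (fun y => 1 / y)).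
  exact: integrable_inv.
have lnE : ln c = \int[mu]_(y in `]x, c * x]) (1 / y).
  by rewrite Rintegral_inv ?ler_peMl// ?ltW// mulfK// gt_eqF.
have h : `|\int[mu]_(y in `]x, c * x]) (g y / y) - g 0 * ln c| <= e / 2.
  rewrite [in X in `|_ - _ * X|]lnE -RintegralZl// -RintegralB//; last 2 first.
  - exact: integrable_div_id.
  - exact: integrableRZl.
  have ig : mu.-integrable `]x, c * x] (EFin \o (fun y => (g y - g 0) / y)).
    apply: (integrable_div_id (g := fun y => g y - g 0)) => //.
    by move=> y; apply: cvgB; [exact: cg|exact: cvg_cst].
  rewrite (_ : Rintegral _ _ _ = \int[mu]_(y in `]x, c * x]) ((g y - g 0) / y)); last first.
    by apply: eq_Rintegral => y _; rewrite mulrBl div1r.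
  apply: le_trans (le_normr_Rintegral _ ig) _ => //.
  apply: (@le_trans _ _ (\int[mu]_(y in `]x, c * x]) (e / 2 / ln c * (1 / y)))).
    apply: le_Rintegral => //.
    - exact: integrable_abse ig.
    - exact: integrableRZl.
    - move=> y /=; rewrite in_itv/= => /andP[xy yx].
      have y0 : 0 < y by exact: lt_trans xy.
      rewrite normrM normfV (gtr0_norm y0) div1r; apply: ler_wpM2r; first by rewrite invr_ge0 ltW.
      rewrite distrC; apply: (gt y); rewrite /ball_/= sub0r normrN gtr0_norm//.
      exact: le_lt_trans cxt.
  by rewrite RintegralZl// -lnE mulfVK ?gt_eqF.
rewrite (_ : _ - _ = \int[mu]_(y in `[0, x]) H y -
  (\int[mu]_(y in `]x, c * x]) (g y / y) - g 0 * ln c)); last by ring.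
apply: le_trans (ler_normB _ _) _.
by rewrite [leRHS](splitr e) lerD.
Unshelve. all: by end_near. Qed.

End frullani.

(** Tonelli gives measurability for nonnegative integrands; the two signs are treated separately,
    without integrability. *)
Lemma measurable_integral_snd d1 d2 (T1 : measurableType d1)
    (T2 : measurableType d2) (R : realType)
    (m2 : {sigma_finite_measure set T2 -> \bar R}) (f : T1 * T2 -> \bar R) :
  measurable_fun setT f ->
  measurable_fun setT (fun x => \int[m2]_y f (x, y))%E.
Proof.
move=> mf.
rewrite (_ : (fun x => _) = (fun x => (\int[m2]_y (f^\+ (x, y)))%E
    - (\int[m2]_y (f^\- (x, y))))%E); last first.
  by apply/funext => x; rewrite integralE; congr (_ - _)%E;
    apply: eq_integral => y _; rewrite ?funeposE ?funenegE.
apply: emeasurable_funB.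
- apply: (measurable_fun_fubini_tonelli_F f^\+)%E => //.
  exact: measurable_funepos.
- apply: (measurable_fun_fubini_tonelli_F f^\-)%E => //.
  exact: measurable_funeneg.
Qed.

Lemma ae_eq_integrable d (T : measurableType d) (R : realType)
    (m : {measure set T -> \bar R}) (D : set T) (f g : T -> \bar R) :
  measurable D -> measurable_fun D g -> ae_eq m D f g ->
  m.-integrable D f -> m.-integrable D g.
Proof.
move=> mD mg fg /integrableP[mf fi]; apply/integrableP; split => //.
rewrite (ae_eq_integral (abse \o f)) //; last exact: ae_eq_sym (ae_eq_abse fg).
- exact: measurableT_comp.
- exact: measurableT_comp.
Qed.

(** * Inversion of the right fractional derivative *)

Section kernel_integral.
Context (R : realType).
Local Notation mu := (@lebesgue_measure R).
Local Notation MR := (measurableTypeR R).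
Implicit Types (al a x r : R) (G : R -> R).

(* The substitution [u = x + (x - a) * r] in [marchaud_kernel]: for fixed [r] the
   integral over [x] becomes a Frullani integral in [x - a]. *)
Definition frullani_kernel al a G (z : R * R) : R :=
  if [&& a < z.1, z.1 < 1 & 0 < z.2] then
    z.2 `^ (al - 2) * ((G (z.1 + (z.1 - a) * z.2) - G z.1) / (z.1 - a)) else 0.

(** The factor [x - a] is the Jacobian of the substitution at fixed [x], so both kernels have the
    same integral along each vertical section. *)
Lemma frullani_kernelE al a G x r : a < x ->
  frullani_kernel al a G (x, r) = (x - a) * marchaud_kernel al a G (x, (x - a) * r + x).
Proof.
move=> ax; rewrite /frullani_kernel /marchaud_kernel /= ax/= ltrDr pmulr_rgt0 ?subr_gt0//.
case: ifPn => [/andP[x1 r0]|_]; last by rewrite mulr0.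
have xa : 0 < x - a by rewrite subr_gt0.
rewrite addrK powRM ?ltW// [x + _]addrC.
have -> : (x - a) `^ (al - 2) = (x - a) `^ al * (x - a) ^- 2.
  by rewrite powRD ?(gt_eqF xa) ?implybT// powR_invn ?ltW.
rewrite powRN; field.
by rewrite !gt_eqF ?powR_gt0.
Qed.

Lemma measurable_frullani_kernel al a G : continuous G ->
  measurable_fun [set: MR * MR] (frullani_kernel al a G).
Proof.
move=> cG.
have mG : measurable_fun [set: R] G by exact: continuous_measurable_fun.
have mG1 : measurable_fun [set: MR * MR] (fun z => G z.1).
  exact: measurableT_comp.
have mG2 : measurable_fun [set: MR * MR] (fun z => G (z.1 + (z.1 - a) * z.2)).
  by apply: measurableT_comp => //; solve_measurable.
(* The power -1 agrees with the inverse on the positive number [z.1 - a], and it is a form that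
   [solve_measurable] handles. *)
have -> : frullani_kernel al a G = fun z => if [&& a < z.1, z.1 < 1 & 0 < z.2] then
    z.2 `^ (al - 2) * ((G (z.1 + (z.1 - a) * z.2) - G z.1) * (z.1 - a) `^ (-1)) else 0.
  apply/funext => z; rewrite /frullani_kernel; case: ifP => // /andP[az _].
  by rewrite powR_inv1// subr_ge0 ltW.
by solve_measurable.
Qed.

(** The substitution at fixed [x] preserves the integral of the absolute value, so the iterated
    integrals coincide already before integrating in [x]. *)
Lemma integrable_frullani_kernel al a G : continuous G ->
  (mu \x mu)%E.-integrable setT (EFin \o marchaud_kernel al a G) ->
  (mu \x mu)%E.-integrable setT (EFin \o frullani_kernel al a G).
Proof.
move=> cG ik.
have mk : measurable_fun [set: MR * MR] (EFin \o marchaud_kernel al a G).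
  by apply/measurable_EFinP; exact: measurable_marchaud_kernel.
apply/integrable12ltyP.
  by apply/measurable_EFinP; exact: measurable_frullani_kernel.
suff -> : (\int[mu]_x \int[mu]_y `|(EFin \o frullani_kernel al a G) (x, y)| =
    \int[mu]_x \int[mu]_y `|(EFin \o marchaud_kernel al a G) (x, y)|)%E.
  exact: ((integrable12ltyP _ _ mk).1 ik).
apply: eq_integral => x _.
have [ax|xa] := ltP a x; last first.
  rewrite !integral0_eq// => r _ /=.
    by rewrite /marchaud_kernel /frullani_kernel /= ltNge xa normr0.
  by rewrite /marchaud_kernel /frullani_kernel /= ltNge xa normr0.
have mkx : measurable_fun [set: MR] (fun u => marchaud_kernel al a G (x, u)).
  exact: (measurable_fun_pair2 x (measurable_marchaud_kernel al a cG)).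
have mnkx : measurable_fun [set: MR] (fun u => `|(marchaud_kernel al a G (x, u))%:E|%E).
  by apply: measurableT_comp => //; apply/measurable_EFinP.
rewrite [RHS](@ge0_integral_affine _ (x - a) x) //; last first.
  by rewrite gt_eqF// subr_gt0.
rewrite preimage_setT -[RHS]ge0_integralZl//; last first.
  exact: (measurableT_comp mnkx (measurable_affine (x - a) x (D := setT))).
apply: eq_integral => r _; rewrite /= frullani_kernelE// normrM EFinM.
by [].
Qed.

End kernel_integral.

Section kernel_sections.
Context (R : realType).
Local Notation mu := (@lebesgue_measure R).
Local Notation MR := (measurableTypeR R).
Implicit Types (al a x r : R) (G : R -> R).

Lemma Rintegral_if (D : set MR) (b : R -> bool) (f : R -> R) :
  (forall x, b x <-> D x) ->
  \int[mu]_x (if b x then f x else 0) = \int[mu]_(x in D) f x.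
Proof. by move=> bD; rewrite /Rintegral (integral_if D). Qed.

Lemma integrable_if (D : set MR) (b : R -> bool) (f : R -> R) : measurable D ->
  (forall x, b x <-> D x) ->
  mu.-integrable setT (EFin \o (fun x => if b x then f x else 0)) ->
  mu.-integrable D (EFin \o f).
Proof.
move=> mD bD h; have : mu.-integrable D (EFin \o (fun x => if b x then f x else 0)).
  by apply: integrableS h.
apply: eq_integrable => // x /set_mem /bD bx /=.
by rewrite bx.
Qed.

(** The second factor in the integrand of [gls_integral]: up to a constant, the right-sided
    Weyl-Marchaud derivative of order [1 - al] of [G - G t]. *)
Definition right_marchaud al t G x : R :=
  (G t - G x) / (t - x) `^ (1 - al) +
    (1 - al) * \int[mu]_(u in `[x, t]) ((G u - G x) / (u - x) `^ (2 - al)).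

(** Split at [u = 1]: the part before 1 is the singular integral of the fractional derivative, and
    the tail, where [G u = G 1], integrates to the boundary term divided by [1 - al]. *)
Lemma Rintegral_marchaud_kernel_section al a x G : 0 < al < 1 -> a < x < 1 -> 
  (forall u, 1 <= u -> G u = G 1) ->
  mu.-integrable setT (fun u => (marchaud_kernel al a G (x, u))%:E) ->
  (1 - al) * \int[mu]_u (marchaud_kernel al a G (x, u)) =
    (x - a) `^ (- al) * right_marchaud al 1 G x.
Proof.
move=> /andP[al0 al1] /andP[ax x1] G1 ik.
have xa : 0 < x - a by rewrite subr_gt0.
pose kk u := (G u - G x) / (u - x) `^ (2 - al).
pose c := (x - a) `^ (- al); have c0 : c != 0 by rewrite gt_eqF ?powR_gt0.
have kE : (fun u => marchaud_kernel al a G (x, u)) = (fun u => if x < u then c * kk u else 0).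
  apply/funext => u; rewrite /marchaud_kernel /= ax x1 /=; case: ifP => // xu.
  rewrite -mulrA; congr (_ * _); rewrite /kk mulrC -powRN; congr (_ * _ `^ _).
  by ring.
have ick : mu.-integrable `]x, +oo[ (EFin \o (fun u => c * kk u)).
  apply: (@integrable_if _ (fun u => x < u)) => //.
    by move=> u; rewrite /= in_itv/= andbT.
  by rewrite -kE.
have ikk : mu.-integrable `]x, +oo[ (EFin \o kk).
  apply: eq_integrable (integrableRZl c^-1 _ ick) => //.
  by move=> u _ /=; rewrite mulKf.
rewrite kE (@Rintegral_if `]x, +oo[%classic); last first.
  by move=> u; rewrite /= in_itv/= andbT.
rewrite RintegralZl// /right_marchaud -/c.
have := @Rintegral_itvB _ kk (BRight x) +oo%O 1 ikk _ _.
rewrite bnd_simp ltW// => /(_ isT isT) h.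
have -> : \int[mu]_(u in `]x, +oo[) kk u =
   \int[mu]_(u in `]x, 1]) kk u + \int[mu]_(u in `]1, +oo[) kk u.
  by rewrite -h addrC subrK.
rewrite Rintegral_itv_obnd_cbnd; last first.
  by apply: integrableS ikk => // u /=; rewrite !in_itv/= andbT => /andP[].
have -> : \int[mu]_(u in `]1, +oo[) kk u = (G 1 - G x) / (1 - x) `^ (1 - al) / (1 - al).
  have ip : (\int[mu]_(u in `[1%R, +oo[) ((u - x) `^ (al - 2))%:E =
      ((1 - x) `^ (al - 1) / (1 - al))%:E)%E.
    rewrite integral_powR_suby//; last by lra.
    by congr (_ `^ _ / _)%:E; ring.
  have mp : measurable_fun (`[1%R, +oo[ : set R) (fun u => (u - x) `^ (al - 2)).
    exact: measurable_powR_subl.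
  have iip : mu.-integrable `[1%R, +oo[ (EFin \o (fun u => (u - x) `^ (al - 2))).
    apply/integrableP; split; first exact/measurable_EFinP.
    under eq_integral do rewrite /= ger0_norm ?powR_ge0//.
    by rewrite ip ltry.
  transitivity (\int[mu]_(u in `]1, +oo[) ((G 1 - G x) * (u - x) `^ (al - 2))).
    apply: eq_Rintegral => u; rewrite inE/= in_itv/= andbT => u1.
    by rewrite /kk G1 ?ltW// -powRN; congr (_ * _ `^ _); ring.
  have iip' : mu.-integrable `]1%R, +oo[ (EFin \o (fun u => (u - x) `^ (al - 2))).
    by apply: integrableS iip => // u /=; rewrite !in_itv/= !andbT => /ltW.
  rewrite RintegralZl// Rintegral_itv_obnd_cbnd// /Rintegral ip /=.
  by rewrite -powRN opprB mulrA.
rewrite -/kk; field.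
by rewrite gt_eqF ?powR_gt0 ?subr_gt0// gt_eqF// subr_gt0.
Qed.

Lemma Rintegral_frullani_kernel1 al a x G : a < x ->
  mu.-integrable setT (fun u => (marchaud_kernel al a G (x, u))%:E) ->
  \int[mu]_r (frullani_kernel al a G (x, r)) = \int[mu]_u (marchaud_kernel al a G (x, u)).
Proof.
move=> ax ik; have c0 : x - a != 0 by rewrite gt_eqF ?subr_gt0.
have ik' := integrable_affine x c0 measurableT ik.
rewrite (Rintegral_affine x c0 _ ik)// -RintegralZl//; last by rewrite preimage_setT.
rewrite preimage_setT; apply: eq_Rintegral => r _.
by rewrite frullani_kernelE// ger0_norm// subr_ge0 ltW.
Qed.

(** Because [x + (x - a) r = a + (1 + r)(x - a)], shifting by [a] gives Frullani's integral with
    dilation factor [1 + r] for a function that is constant from [1 - a] on. *)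
Lemma Rintegral_frullani_kernel2 al a r G : a < 1 -> 0 < r -> continuous G ->
  (forall u, 1 <= u -> G u = G 1) ->
  mu.-integrable setT (fun x => (frullani_kernel al a G (x, r))%:E) ->
  \int[mu]_x (frullani_kernel al a G (x, r)) =
    r `^ (al - 2) * ln (1 + r) * (G 1 - G a).
Proof.
move=> a1 r0 cG G1 ik.
pose h x := (G (x + (x - a) * r) - G x) / (x - a).
pose c := r `^ (al - 2); have c0 : c != 0 by rewrite gt_eqF ?powR_gt0.
(* the quotient vanishes at both endpoints: [x / 0 = 0] and [G] is constant after 1 *)
have kE : (fun x => frullani_kernel al a G (x, r)) =
    (fun x => if (a <= x) && (x <= 1) then c * h x else 0).
  apply/funext => x; rewrite /frullani_kernel /= r0 andbT.
  have [->|xa] := eqVneq x a.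
    by rewrite ltxx /= /h subrr invr0 !mulr0; case: ifP.
  have [->|x1] := eqVneq x 1.
    rewrite ltxx andbF /= lexx andbT; case: ifP => // _.
    rewrite /h (G1 (1 + _)); first by rewrite subrr mul0r mulr0.
    by rewrite lerDl mulr_ge0 ?subr_ge0 ?ltW.
  by rewrite [a <= x]le_eqVlt eq_sym (negbTE xa) [x <= 1]le_eqVlt (negbTE x1).
have ich : mu.-integrable `[a, 1] (EFin \o (fun x => c * h x)).
  apply: (@integrable_if _ (fun x => (a <= x) && (x <= 1))) => //.
  by rewrite -kE.
have ih : mu.-integrable `[a, 1] (EFin \o h).
  apply: eq_integrable (integrableRZl c^-1 _ ich) => //.
  by move=> u _ /=; rewrite mulKf.
rewrite kE (@Rintegral_if `[a, 1]%classic)// RintegralZl// -mulrA; congr (_ * _).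
have n0 : (1 : R) != 0 by [].
have := integrable_affine a n0 (measurable_itv _) ih.
rewrite (Rintegral_affine a n0 (measurable_itv _) ih) normr1 mul1r.
set D := _ @^-1` _; have -> : D = `[0, 1 - a]%classic.
  by apply/seteqP; split=> x; rewrite /D/= !in_itv/= => /andP[? ?]; apply/andP; split; lra.
have -> : (fun x => h (1 * x + a)) =
    (fun y => (G ((1 + r) * y + a) - G (y + a)) / y).
  by apply/funext => y; rewrite /h mul1r addrK; congr ((G _ - _) / _); ring.
move=> iH; rewrite (@frullani _ (fun y => G (y + a)) (1 - a))//.
- by rewrite subrK add0r mulrC.
- by rewrite subr_gt0.
- by rewrite ltrDl.
- by move=> y; apply: continuous_comp; [apply: cvgD; [exact: cvg_id|exact: cvg_cst]|exact: cG].
- by move=> y ay; rewrite subrK G1//; lra.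
Qed.

End kernel_sections.

(** * Integrals over the half-line and the Frullani constant *)

Section frullani_constant.
Context (R : realType).
Local Notation mu := (@lebesgue_measure R).
Local Notation MR := (measurableTypeR R).
Implicit Types (al a x r : R) (G : R -> R).

Lemma ge0_integrable_oy (f : R -> R) (c p q : R) : -1 < p -> q < -1 ->
  measurable_fun (`]0, +oo[ : set R) f -> (forall x, 0 < x -> 0 <= f x) ->
  (forall x, 0 < x <= 1 -> f x <= c * x `^ p) ->
  (forall x, 1 <= x -> f x <= c * x `^ q) ->
  mu.-integrable `]0, +oo[ (EFin \o f).
Proof.
move=> p1 q1 mf f0 fp fq; apply/integrableP; split; first exact/measurable_EFinP.
have c0 : 0 <= c.
  by have := le_trans (f0 1 ltr01) (fq 1 (lexx _)); rewrite powR1 mulr1.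
have D01 : `]0, +oo[%classic = `]0, 1] `|` `]1, +oo[ :> set R.
  apply/seteqP; split=> x /=; rewrite !in_itv/= !andbT.
    by move=> ->; case: leP => _; [left|right].
  by case=> [/andP[]|]//; exact: lt_trans.
have mfU : measurable_fun (`]0, 1] `|` `]1, +oo[ : set R) (fun x => (f x)%:E).
  by rewrite -D01; apply/measurable_EFinP.
under eq_integral => x.
  rewrite inE/= in_itv/= andbT => x0.
  rewrite /= ger0_norm ?f0//; over.
rewrite D01 ge0_integral_setU//=; last 2 first.
- by move=> x [] /=; rewrite in_itv/= ?andbT => x0; rewrite lee_fin f0//; lra.
- apply/disj_setPS => x [/=]; rewrite !in_itv/= => /andP[_ x1] /andP[].
  by rewrite ltNge x1.
apply: lte_add_pinfty.
- apply: (@le_lt_trans _ _ (\int[mu]_(x in `]0%R, 1%R]) (c%:E * (x `^ p)%:E))%E).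
    apply: ge0_le_integral => //.
    + by move=> x /=; rewrite in_itv/= => /andP[x0 _]; rewrite lee_fin f0.
    + apply/measurable_EFinP; apply: measurable_funS mf => //.
      by rewrite D01; apply: subsetUl.
    + by apply: emeasurable_funM => //; apply/measurable_EFinP; exact: measurable_funTS.
  rewrite ge0_integralZl_EFin//; last 2 first.
  + by move=> x _; rewrite lee_fin powR_ge0.
  + by apply/measurable_EFinP; exact: measurable_funTS.
  by rewrite integral_powR0// -EFinM ltry.
- apply: (@le_lt_trans _ _ (\int[mu]_(x in `[1%R, +oo[) (c%:E * (x `^ q)%:E))%E).
    apply: (@le_trans _ _ (\int[mu]_(x in `]1%R, +oo[) (c%:E * (x `^ q)%:E))%E).
      apply: ge0_le_integral => //.
      + move=> x /=; rewrite in_itv/= andbT => x1.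
        by rewrite lee_fin f0// (lt_trans ltr01).
      + apply/measurable_EFinP; apply: measurable_funS mf => //.
        by rewrite D01; apply: subsetUr.
      + by apply: emeasurable_funM => //; apply/measurable_EFinP; exact: measurable_funTS.
      + by move=> x /=; rewrite in_itv/= andbT => x1; rewrite -EFinM lee_fin fq// ltW.
    apply: ge0_subset_integral => //.
    + by apply: emeasurable_funM => //; apply/measurable_EFinP; exact: measurable_funTS.
    + by move=> x _; rewrite -EFinM lee_fin mulr_ge0 ?powR_ge0.
    + by move=> x /=; rewrite !in_itv/= !andbT => /ltW.
  rewrite ge0_integralZl_EFin//; last 2 first.
  + by move=> x _; rewrite lee_fin powR_ge0.
  + by apply/measurable_EFinP; exact: measurable_funTS.
  by rewrite integral_powRy// -EFinM ltry.
Qed.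

(** A zero integral would make [f] vanish almost everywhere, in particular on []0, 1[] up to a null
    set, although this interval has measure 1. *)
Lemma Rintegral_oy_gt0 (f : R -> R) : mu.-integrable `]0, +oo[ (EFin \o f) ->
  (forall x, 0 < x -> 0 < f x) -> 0 < \int[mu]_(x in `]0, +oo[) f x.
Proof.
move=> fi f0; rewrite lt_neqAle Rintegral_ge0 ?andbT; last first.
  by move=> x /=; rewrite in_itv/= andbT => /f0/ltW.
apply/eqP => /esym int0.
have mf := measurable_int _ fi.
have : (\int[mu]_(x in `]0%R, +oo[) `|(EFin \o f) x| = 0)%E.
  transitivity (\int[mu]_(x in `]0, +oo[) f x)%:E; last by rewrite int0.
  rewrite /Rintegral fineK; last exact: integrable_fin_num.
  apply: eq_integral => x; rewrite inE/= in_itv/= andbT => /f0/ltW x0.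
  by rewrite /= ger0_norm.
move=> /(ae_eq_integral_abs mu (measurable_itv _) mf).1 [N [mN N0 DN]].
have : (mu (`]0%R, 1%R[ : set R) <= mu N)%E.
  apply: le_measure; rewrite ?inE// => x /=; rewrite in_itv/= => /andP[x0 _].
  apply: DN => /= /(_ _) h; have := f0 x x0.
  have : (f x)%:E = 0%E by apply: h; rewrite /= in_itv/= x0.
  by case=> ->; rewrite ltxx.
by rewrite N0 lebesgue_measure_itv/= lte_fin ltr01 oppr0 adde0 leNgt lte_fin ltr01.
Qed.

Definition frullani_cst al : R :=
  \int[mu]_(r in `]0, +oo[) (r `^ (al - 2) * ln (1 + r)).

(** Near 0 use [ln (1 + r) <= r]. At infinity, [1 + r <= (1 + sqrt r)^2] gives
    [ln (1 + r) <= 2 sqrt r], and the exponent [al - 3/2] is below -1 because [al < 1/2]. *)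
Lemma integrable_frullani_cst al : 0 < al < 2^-1 ->
  mu.-integrable `]0, +oo[ (EFin \o (fun r => r `^ (al - 2) * ln (1 + r))).
Proof.
move=> /andP[al0 al1].
apply: (@ge0_integrable_oy _ 2 (al - 1) (al - 2 + 2^-1)).
- by lra.
- by lra.
- apply: measurable_funM; first exact: measurable_funTS.
  apply: measurableT_comp; first exact: measurable_ln.
  exact: measurable_funD.
- by move=> x x0; rewrite mulr_ge0 ?powR_ge0// ln_ge0// lerDl ltW.
- move=> x /andP[x0 x1].
  have xx : x `^ (al - 2) * x = x `^ (al - 1).
    rewrite -[X in _ * X](@powRr1 _ x) ?ltW// -powRD ?(gt_eqF x0) ?implybT//.
    by congr powR; ring.
  apply: (@le_trans _ _ (x `^ (al - 1))).
    rewrite -xx ler_wpM2l ?powR_ge0// le_ln1Dx//; lra.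
  by rewrite ler_peMl ?powR_ge0//; lra.
- move=> x x1; have x0 : 0 < x by lra.
  have -> : x `^ (al - 2 + 2^-1) = x `^ (al - 2) * Num.sqrt x.
    by rewrite [LHS]powRD ?(gt_eqF x0) ?implybT// powR12_sqrt ?ltW.
  rewrite mulrCA ler_wpM2l ?powR_ge0//.
  have s0 : 0 < Num.sqrt x by rewrite sqrtr_gt0.
  have : ln (1 + x) <= ln ((1 + Num.sqrt x) ^+ 2).
    rewrite ler_ln ?posrE; [|lra|by rewrite exprn_gt0; lra].
    by have := sqr_sqrtr (ltW x0); nra.
  rewrite lnXn; last by lra.
  move=> h; apply: (le_trans h).
  rewrite -[leLHS]mulr_natl ler_wpM2l// le_ln1Dx//; lra.
Qed.

Lemma frullani_cst_gt0 al : 0 < al < 2^-1 -> 0 < frullani_cst al.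
Proof.
move=> h; apply: Rintegral_oy_gt0 (integrable_frullani_cst h) _ => x x0.
by rewrite mulr_gt0 ?powR_gt0// ln_gt0// ltrDl.
Qed.

End frullani_constant.

(** * The inversion formula *)

Section inversion.
Context (R : realType).
Local Notation mu := (@lebesgue_measure R).
Local Notation MR := (measurableTypeR R).
Implicit Types (al ga a x r M : R) (G : R -> R).

(** [Rintegral] takes the value 0 on a divergent nonnegative integral, so positivity requires
    integrability, proved by comparison with powers. *)
Lemma Gamma_gt0 (s : R) : 0 < s < 1 -> 0 < Gamma s.
Proof.
move=> /andP[s0 s1].
apply: Rintegral_oy_gt0; last by move=> x x0; rewrite mulr_gt0 ?powR_gt0 ?expR_gt0.
apply: (@ge0_integrable_oy _ _ 4 (s - 1) (-2)).
- by lra.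
- by lra.
- apply: measurable_funM; first exact: measurable_funTS.
  by apply: measurableT_comp => //; exact: measurable_funTS.
- by move=> x _; rewrite mulr_ge0 ?powR_ge0 ?expR_ge0.
- move=> x /andP[x0 x1]; rewrite mulrC ler_wpM2r ?powR_ge0//.
  by apply: (@le_trans _ _ 1); [rewrite -expR0 ler_expR oppr_le0 ltW|lra].
- move=> x x1; have x0 : 0 < x by lra.
  have h1 : x `^ (s - 1) <= 1.
    by rewrite -[leRHS](powRr0 x); apply: ler_powR => //; lra.
  (* The constant 4 comes from [exp x = exp (x / 2)^2 >= (x / 2)^2]. *)
  have h2 : expR (- x) <= 4 * x `^ (-2).
    have x0' := ltW x0; rewrite expRN (powR_invn 2 x0') -[leRHS]invrK lef_pV2 ?posrE ?expR_gt0//; last first.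
      by rewrite invr_gt0 mulr_gt0// invr_gt0 exprn_gt0.
    have -> : expR x = expR (x / 2) ^+ 2 by rewrite -expRM_natr; congr expR; field.
    have := expR_ge1Dx (x / 2) => h.
    rewrite invfM invrK; have h3 : (1 + x / 2) ^+ 2 <= expR (x / 2) ^+ 2.
      by rewrite ler_pXn2r ?nnegrE ?expR_ge0//; lra.
    apply: le_trans h3; nra.
  by rewrite -[leRHS]mul1r; apply: ler_pM => //; rewrite ?powR_ge0 ?expR_ge0.
Qed.

Lemma measurable_right_marchaud al G : continuous G ->
  measurable_fun [set: R] (fun x => if x <= 1 then right_marchaud al 1 G x else 0).
Proof.
move=> cG.
have mG : measurable_fun [set: R] G by exact: continuous_measurable_fun.
have mG1 : measurable_fun [set: MR * MR] (fun z => G z.1).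
  exact: measurableT_comp.
have mG2 : measurable_fun [set: MR * MR] (fun z => G z.2).
  exact: measurableT_comp.
pose k (z : MR * MR) : R := if (z.1 <= z.2) && (z.2 <= 1) then
  (G z.2 - G z.1) * (z.2 - z.1) `^ - (2 - al) else 0.
have mk : measurable_fun setT (EFin \o k).
  by apply/measurable_EFinP; rewrite /k; solve_measurable.
apply: measurable_fun_ifT => //; first exact: measurable_fun_ler.
apply: measurable_funD.
  rewrite (_ : (fun _ => _) = (fun x => (G 1 - G x) * (1 - x) `^ - (1 - al))).
    apply: measurable_funM; last exact: measurable_powR_subr.
    exact: measurable_funB.
  by apply/funext => x; rewrite powRN.
apply: measurable_funM => //.
rewrite (_ : (fun _ => _) = fine \o (fun x => \int[mu]_u (k (x, u))%:E)%E).
  apply: measurableT_comp; first exact: fine_measurable.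
  exact: (measurable_integral_snd mu mk).
apply/funext => x /=; rewrite /Rintegral; congr fine.
rewrite /k/= (integral_if (`[x, 1%R]%classic : set MR)).
  by apply: eq_integral => u _; rewrite powRN.
by move=> u /=; rewrite in_itv.
Qed.

(* Integrating [frullani_kernel] first in [r] gives the left-hand side, first in
   [x] the right-hand side, each [r] contributing [ln (1 + r)]. *)
Lemma marchaud_inversion al ga a M G : 0 < al < 2^-1 -> ga < 1 -> 0 <= a < 1 ->
  continuous G -> (forall x, `|G x| <= M) -> (forall x, 1 <= x -> G x = G 1) ->
  (\int[mu \x mu]_z (slobodeckij (2 * al - 4 + ga) G z)%:E < +oo)%E ->
  mu.-integrable `]a, 1[ (EFin \o (fun x => (x - a) `^ (- al) * right_marchaud al 1 G x)) /\
  \int[mu]_(x in `]a, 1[) ((x - a) `^ (- al) * right_marchaud al 1 G x) =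
    (1 - al) * frullani_cst al * (G 1 - G a).
Proof.
move=> /andP[al0 al1] ga1 /andP[a0 a1] cG GM G1 GS.
set phi := fun x => (x - a) `^ (- al) * right_marchaud al 1 G x.
have ik := integrable_marchaud_kernel al0 al1 ga1 a0 a1 cG GM GS.
have iK := integrable_frullani_kernel cG ik.
pose psi x := ((1 - al)%:E * fubini_F mu (EFin \o frullani_kernel al a G) x)%E.
have ipsi : mu.-integrable setT psi.
  by apply: integrableZl => //; exact: integrable_fubini_F.
have mD : measurable (`]a, 1[%classic : set MR) by exact: measurable_itv.
have mphi : measurable_fun (`]a, 1[ : set R) (EFin \o phi).
  apply/measurable_EFinP; apply: measurable_funM; first exact: measurable_powR_subl.
  apply: eq_measurable_fun (measurable_funTS (measurable_right_marchaud al cG)).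
  by move=> x; rewrite inE/= in_itv/= => /andP[_ x1]; rewrite ltW.
(* Fubini makes the sections of the two kernels integrable only for almost every [x], so the
   identification is almost everywhere. *)
have psiphi : ae_eq mu (`]a, 1[%classic : set MR) psi (EFin \o phi).
  have ae1 := ae_integrable1 ik; have ae2 := ae_integrable1 iK.
  near=> x => /=; rewrite in_itv/= => /andP[ax x1].
  have i1 : mu.-integrable setT (fun u => (marchaud_kernel al a G (x, u))%:E) by near: x.
  have i2 : mu.-integrable setT (fun u => (frullani_kernel al a G (x, u))%:E) by near: x.
  rewrite /psi /phi -(@Rintegral_marchaud_kernel_section _ al a x G)//; last 2 first.
  - by rewrite al0/=; lra.
  - by rewrite ax.
  rewrite -(Rintegral_frullani_kernel1 ax i1) EFinM /Rintegral fineK//.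
  exact: integrable_fin_num.
have ipsiD : mu.-integrable `]a, 1[ psi by exact: integrableS ipsi.
have iphi : mu.-integrable `]a, 1[ (EFin \o phi).
  exact: ae_eq_integrable psiphi ipsiD.
split=> //.
rewrite /Rintegral -(ae_eq_integral _ _ mD _ _ psiphi)//; last exact: measurable_int ipsiD.
(* [psi] vanishes off []a, 1[], which makes Fubini on the whole plane applicable. *)
have -> : (\int[mu]_(x in `]a, 1%R[) psi x = \int[mu]_x psi x)%E.
  rewrite integral_mkcond; apply: eq_integral => x _; rewrite patchE.
  case: ifPn => //; rewrite notin_setE/= in_itv/= => /negP/negbTE xa.
  rewrite /psi /fubini_F integral0_eq ?mule0// => r _ /=.
  by rewrite /frullani_kernel /= andbA xa.
rewrite /psi integralZl//; last exact: integrable_fubini_F.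
rewrite (integral12_prod_meas1 iK) -(integral21_prod_meas1 iK) -mulrA.
have ic : mu.-integrable `]0, +oo[ (EFin \o (fun r => r `^ (al - 2) * ln (1 + r))).
  by apply: integrable_frullani_cst; rewrite al0.
have -> : (\int[mu]_y fubini_G mu (EFin \o frullani_kernel al a G) y)%E =
    (frullani_cst al * (G 1 - G a))%:E.
  pose f r : R := if 0 < r then r `^ (al - 2) * ln (1 + r) * (G 1 - G a) else 0.
  have ae2 := ae_integrable2 iK.
  have mf : measurable_fun setT (EFin \o f).
    apply/measurable_EFinP; apply: measurable_fun_ifT => //.
      exact: measurable_fun_ltr.
    apply: measurable_funM => //; apply: measurable_funM => //.
    apply: measurableT_comp; first exact: measurable_ln.
    exact: measurable_funD.
  transitivity (\int[mu]_y (EFin \o f) y)%E.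
    apply: ae_eq_integral => //.
      exact: (measurable_fubini_G iK).
    near=> r => _; rewrite /fubini_G /f /=.
    have i3 : mu.-integrable setT (fun x => (frullani_kernel al a G (x, r))%:E) by near: r.
    case: ifPn => [r0|r0]; last first.
      rewrite integral0_eq// => x _ /=.
      by rewrite /frullani_kernel /= (negbTE r0) !andbF.
    rewrite -(Rintegral_frullani_kernel2 a1 r0 cG G1 i3) /Rintegral fineK//.
    exact: integrable_fin_num.
  rewrite (integral_if (`]0, +oo[%classic : set MR)); last first.
    by move=> r; rewrite /= in_itv/= andbT.
  rewrite /frullani_cst -RintegralZr// /Rintegral fineK//.
  apply: integrable_fin_num => //.
  have := integrableRZl (G 1 - G a) _ ic.
  rewrite (_ : (fun x => (G 1 - G a) * _) = (fun x => x `^ (al - 2) * ln (1 + x) * (G 1 - G a))).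
    by apply.
  by apply/funext => x; rewrite mulrC.
by rewrite -EFinM.
Unshelve. all: by end_near. Qed.

End inversion.

(** * The pathwise integral of a step function *)

Section step_functions.
Context (R : realType).
Local Notation mu := (@lebesgue_measure R).
Local Notation MR := (measurableTypeR R).
Implicit Types (al a x t : R) (f g : R -> R) (s : seq (R * R)).

(** Half-lines serve as building blocks because each carries a single singularity and contributes a
    single increment [g 1 - g a]; an interval is a difference of two. *)
Definition after a x : R := if a < x then 1 else 0.

Definition step s x : R := \sum_(p <- s) p.1 * after p.2 x.

(** The first factor in the integrand of [gls_integral]: up to a constant, the left-sided
    Weyl-Marchaud derivative of order [al]. *)
Definition left_marchaud al f x : R :=
  f x / x `^ al + al * \int[mu]_(u in `[0, x]) ((f x - f u) / (x - u) `^ (1 + al)).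

Lemma after_le a u x : u <= x -> after a u <= after a x.
Proof.
by move=> ux; rewrite /after; case: ltP => au; [rewrite (lt_le_trans au ux)|case: ifP].
Qed.

Lemma measurable_step s : measurable_fun [set: R] (step s).
Proof.
rewrite /step; apply: measurable_sum => p.
apply: measurable_funM => //.
by apply: measurable_fun_ifT => //; exact: measurable_fun_ltr.
Qed.

Lemma indicator_quotientE al a x u : u <= x ->
  (after a x - after a u) / (x - u) `^ (1 + al) =
  (if (a < x) && (u <= a) then (x - u) `^ (- (1 + al)) else 0) :> R.
Proof.
move=> ux; rewrite /after (leNgt u a); have [ax|xa] := ltP a x.
  by case: ltP => _ /=; rewrite ?subr0 ?subrr ?mul0r// mul1r powRN.
by rewrite (ltNge a u) (le_trans ux xa)/= subrr mul0r.
Qed.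

Lemma integral_indicator_quotient al a x : 0 < al -> 0 < a -> 
  (\int[mu]_(u in `[0%R, x])
    (`|after a x - after a u| / (x - u) `^ (1 + al))%:E =
   (if a < x then ((x - a) `^ (- al) - x `^ (- al)) / al else 0)%:E)%E.
Proof.
move=> al0 a0; have al0' : al != 0 by rewrite gt_eqF.
transitivity (\int[mu]_(u in `[0%R, x])
  (if (a < x) && (u <= a) then (x - u) `^ (- (1 + al)) else 0)%:E)%E.
  apply: eq_integral => u; rewrite inE/= in_itv/= => /andP[_ ux].
  rewrite -indicator_quotientE//; congr (_ / _)%:E; rewrite ger0_norm// subr_ge0.
  exact: after_le.
case: ifPn => [ax|_]; last by rewrite integral0.
transitivity (\int[mu]_(u in `[0%R, a]) ((x - u) `^ (- (1 + al)))%:E)%E.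
  rewrite [RHS]integral_mkcond [LHS]integral_mkcond; apply: eq_integral => u _.
  rewrite !patchE; have [/set_mem/=|/negP nin] := boolP (u \in `[0, x]%classic).
    rewrite in_itv/= => /andP[u0 ux].
    case: ifPn => ua; first by rewrite mem_set// /= in_itv/= u0.
    by rewrite memNset//= in_itv/= u0/= (negbTE ua).
  rewrite memNset//= in_itv/= => /andP[u0 ua]; apply: nin.
  by rewrite inE/= in_itv/= u0/= (le_trans ua (ltW ax)).
rewrite integral_powR_sub0 ?(ltW a0)//; last by lra.
rewrite (_ : - (1 + al) + 1 = - al); last by ring.
by congr EFin; field; rewrite al0'.
Qed.

Lemma integrable_indicator_quotient al a x : 0 < al -> 0 < a ->
  mu.-integrable `[0, x] (EFin \o (fun u => (after a x - after a u) / (x - u) `^ (1 + al))).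
Proof.
move=> al0 a0; apply/integrableP; split.
  apply/measurable_EFinP.
  apply: (eq_measurable_fun
     (fun u : R => if (a < x) && (u <= a) then (x - u) `^ (- (1 + al)) else 0)).
    by move=> u; rewrite inE/= in_itv/= => /andP[_ ux]; rewrite indicator_quotientE.
  apply: measurable_funTS; apply: measurable_fun_ifT => //.
    by apply: measurable_and => //; exact: measurable_fun_ler.
  exact: measurable_powR_subr.
under eq_integral do rewrite /= normrM normfV (ger0_norm (powR_ge0 _ _)).
by rewrite integral_indicator_quotient// ltry.
Qed.

(** For one half-line the difference quotient is nonzero only for [u <= a < x], with integral
    [((x - a)^(-al) - x^(-al)) / al]; after multiplication by [al] the term [x^(-al)] cancels
    against [f x / x^al]. The induction carries integrability along to have linearity of
    [Rintegral]. *)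
Lemma left_marchaud_step_ind al s x : 0 < al ->
  (forall p, p \in s -> 0 < p.2) ->
  mu.-integrable `[0, x] (EFin \o (fun u => (step s x - step s u) / (x - u) `^ (1 + al))) /\
  left_marchaud al (step s) x =
    \sum_(p <- s) p.1 * (if p.2 < x then (x - p.2) `^ (- al) else 0).
Proof.
move=> al0; have al0' : al != 0 by rewrite gt_eqF.
elim: s => [|p s IH] s0.
  split; last first.
    rewrite /left_marchaud /step !big_nil mul0r add0r.
    under eq_Rintegral do rewrite big_nil subr0 mul0r.
    by rewrite Rintegral_cst// mul0r mulr0.
  rewrite (_ : _ \o _ = cst 0%E); first exact: integrable0.
  by apply/funext => u; rewrite /= /step !big_nil subr0 mul0r.
have p0 : 0 < p.2 by apply: s0; rewrite mem_head.
have [|iS es] := IH.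
  by move=> q qs; apply: s0; rewrite in_cons qs orbT.
have ip := integrableRZl p.1 _ (@integrable_indicator_quotient al p.2 x al0 p0).
have E : (fun u => (step (p :: s) x - step (p :: s) u) / (x - u) `^ (1 + al)) =
  (fun u => p.1 * ((after p.2 x - after p.2 u) / (x - u) `^ (1 + al)) +
     (step s x - step s u) / (x - u) `^ (1 + al)).
  by apply/funext => u; rewrite /step !big_cons; ring.
split.
  by rewrite E; exact: integrableD (ip (measurable_itv _)) iS.
rewrite big_cons -es /left_marchaud E.
rewrite (RintegralD _ (ip (measurable_itv _)) iS); last exact: measurable_itv.
rewrite (RintegralZl _ _ (integrable_indicator_quotient x al0 p0)); last exact: measurable_itv.
have -> : \int[mu]_(u in `[0, x]) ((after p.2 x - after p.2 u) / (x - u) `^ (1 + al)) =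
   (if p.2 < x then ((x - p.2) `^ (- al) - x `^ (- al)) / al else 0).
  rewrite /Rintegral -[RHS]/(fine (_)%:E) -integral_indicator_quotient//; congr fine.
  apply: eq_integral => u; rewrite inE/= in_itv/= => /andP[_ ux].
  by rewrite ger0_norm// subr_ge0 after_le.
rewrite {1}/step big_cons -/(step s x) /after -!powRN.
by case: ifP => _; field.
Qed.

End step_functions.

Section step_integral.
Context (R : realType).
Local Notation mu := (@lebesgue_measure R).
Local Notation MR := (measurableTypeR R).
Implicit Types (al a x t : R) (f g : R -> R) (s : seq (R * R)).

(** Composition with [clamp01] extends a path continuous on [[0, 1]] to a bounded continuous
    function on the line that is constant after 1, as [marchaud_inversion] demands. *)
Definition clamp01 (x : R) : R := Num.max 0 (Num.min x 1).

Lemma clamp01_itv x : clamp01 x \in `[0, 1].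
Proof. by rewrite /clamp01 in_itv/= le_max lexx /= ge_max ler01 ge_min lexx orbT. Qed.

Lemma clamp01_id x : 0 <= x <= 1 -> clamp01 x = x.
Proof. by move=> /andP[x0 x1]; rewrite /clamp01 min_l// max_r. Qed.

Lemma clamp01_ge1 x : 1 <= x -> clamp01 x = 1.
Proof. by move=> x1; rewrite /clamp01 min_r// max_r. Qed.

Lemma continuous_clamp01 : continuous clamp01.
Proof.
move=> x; apply/cvgrPdist_lt => e e0; near=> y.
apply: (@le_lt_trans _ _ `|x - y|); last by near: y; exact: cvgr_dist_lt.
rewrite /clamp01; case: (leP x 1) => ?; case: (leP y 1) => ?; case: (leP 0 x) => ?;
  case: (leP 0 y) => ?; rewrite ?[Num.max 0 1]max_r ?ler01//;
  rewrite ler_norml; apply/andP; split; rewrite ?opprB; have := ler_norm (x - y);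
  have := ler_norm (- (x - y)); rewrite normrN; lra.
Unshelve. all: by end_near.
Qed.

Lemma continuous_comp_clamp01 g : {within `[0, 1], continuous g} ->
  continuous (g \o clamp01).
Proof.
move=> /subspace_continuousP cg x.
apply: (@cvg_comp _ _ _ clamp01 g (nbhs x) (within `[0, 1]%classic (nbhs (clamp01 x)))).
  move=> U; rewrite /within/= => nU.
  have nx : \forall y \near x, clamp01 y \in `[0, 1] -> U (clamp01 y).
    exact: (@continuous_clamp01 x _ nU).
  by apply: filterS nx => y; apply; exact: clamp01_itv.
by apply: cg; have := clamp01_itv x.
Qed.

Lemma bounded_comp_clamp01 g : {within `[0, 1], continuous g} ->
  exists M, forall x, `|g (clamp01 x)| <= M.
Proof.
move=> cg; have cng : {within `[0, 1], continuous (fun x => `|g x|)}.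
  by move=> x; apply: continuous_comp (cg x) _; exact: norm_continuous.
have [c _ cM] := EVT_max ler01 cng.
by exists `|g c| => x; apply: cM; exact: clamp01_itv.
Qed.

Lemma slobodeckij_clamp01 q g z : slobodeckij q (g \o clamp01) z = slobodeckij q g z.
Proof.
rewrite /slobodeckij; case: ifP => // /and3P[z0 zz z1].
by rewrite /= !clamp01_id//; lra.
Qed.

Lemma right_marchaud_clamp01 al g x : 0 <= x <= 1 ->
  right_marchaud al 1 (g \o clamp01) x = right_marchaud al 1 g x.
Proof.
move=> /andP[x0 x1]; rewrite /right_marchaud /= !clamp01_id ?lexx ?ler01 ?x0//.
congr (_ + _ * _); apply: eq_Rintegral => u; rewrite inE/= in_itv/= => /andP[xu u1].
by rewrite clamp01_id// (le_trans x0 xu).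
Qed.

Lemma integrable_ifP (D : set MR) (b : R -> bool) (f : R -> R) : measurable D ->
  (forall x, b x <-> D x) -> mu.-integrable D (EFin \o f) ->
  mu.-integrable setT (EFin \o (fun x => if b x then f x else 0)).
Proof.
move=> mD bD /(integrable_mkcond _ mD); congr (integrable _ _ _).
apply/funext => x; rewrite patchE /=; case: ifPn => bx.
  by rewrite (bD x).2//; exact/set_mem.
by case: ifPn => // /bD/mem_set; rewrite (negbTE bx).
Qed.

(* The value is 1, but positivity suffices because the integrand of the theorem
   may be rescaled. *)
Definition gls_cst al : R :=
  (Gamma (1 - al) * Gamma al)^-1 * ((1 - al) * frullani_cst al).

Lemma gls_cst_gt0 al : 0 < al < 2^-1 -> 0 < gls_cst al.
Proof.
move=> al01; have /andP[al0 al1] := al01.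
have g1 : 0 < Gamma (1 - al) by apply: Gamma_gt0; lra.
have g2 : 0 < Gamma al by apply: Gamma_gt0; lra.
have c0 := frullani_cst_gt0 al01.
rewrite /gls_cst; move: (Gamma _) (Gamma _) (frullani_cst _) g1 g2 c0 => x y z x0 y0 z0.
by rewrite mulr_gt0 ?invr_gt0 ?mulr_gt0//; lra.
Qed.

(** The left factor is a linear combination of the functions [(x - a)^(-al)] on [x > a], and
    [marchaud_inversion] evaluates each of them against the right factor. *)
Lemma gls_integral_step al ga s g : 0 < al < 2^-1 -> ga < 1 ->
  (forall p, p \in s -> 0 < p.2 < 1) ->
  {within `[0, 1], continuous g} ->
  (\int[mu \x mu]_z (slobodeckij (2 * al - 4 + ga) g z)%:E < +oo)%E ->
  gls_integral al 1 (step s) g = gls_cst al * \sum_(p <- s) p.1 * (g 1 - g p.2).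
Proof.
move=> al01 ga1 s01 cg gS; have /andP[al0 al1] := al01.
pose G := g \o clamp01.
have cG : continuous G by exact: continuous_comp_clamp01.
have [M GM] := bounded_comp_clamp01 cg.
have G1 x : 1 <= x -> G x = G 1 by move=> x1; rewrite /G /= !clamp01_ge1.
have GS : (\int[mu \x mu]_z (slobodeckij (2 * al - 4 + ga) G z)%:E < +oo)%E.
  by under eq_integral do rewrite slobodeckij_clamp01.
rewrite /gls_integral /gls_cst -mulrA; congr (_ * _).
pose phi a x := if a < x then (x - a) `^ (- al) * right_marchaud al 1 G x else 0.
have phiP a : 0 < a < 1 -> mu.-integrable `[0, 1] (EFin \o phi a) /\
    \int[mu]_(x in `[0, 1]) phi a x = (1 - al) * frullani_cst al * (g 1 - g a).
  move=> /andP[a0 a1].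
  have [|i e] := @marchaud_inversion _ al ga a M G al01 ga1 _ cG GM G1 GS.
    by rewrite ltW.
  pose psi (x : R) : R := if (a < x) && (x < 1) then
    (x - a) `^ (- al) * right_marchaud al 1 G x else 0.
  (* The two differ in form only at [x = 1], where [right_marchaud] is 0: its numerator vanishes and
     its integral runs over a point. *)
  have phiE : {in `[0, 1]%classic, psi =1 phi a}.
    move=> x; rewrite inE/= in_itv/= => /andP[_ x1]; rewrite /phi /psi.
    have [->|x1'] := eqVneq x 1; last by rewrite (lt_neqAle x 1) x1' x1 /= andbT.
    rewrite a1 ltxx/= /right_marchaud subrr mul0r set_itv1 Rintegral_set1.
    by rewrite mulr0 addr0 mulr0.
  split.
    have iT : mu.-integrable setT (EFin \o psi).
      exact: (@integrable_ifP `]a, 1[%classic).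
    have : mu.-integrable `[0, 1] (EFin \o psi) by exact: integrableS iT.
    apply: eq_integrable => // x xD /=.
    by rewrite -phiE.
  transitivity (\int[mu]_(x in `[0, 1]) psi x).
    by apply: eq_Rintegral => x xD; rewrite phiE.
  rewrite -(@Rintegral_if _ `[0, 1]%classic (fun x => (0 <= x) && (x <= 1)))//.
  rewrite (_ : (fun x => _) = psi); last first.
    apply/funext => x; rewrite /psi; case: ifPn => // /negP n01; case: ifPn => // /andP[ax x1].
    by exfalso; apply: n01; rewrite (ltW x1) (le_trans (ltW a0) (ltW ax)).
  rewrite (@Rintegral_if _ `]a, 1[%classic)// e /G /= !clamp01_id ?lexx ?ler01//.
  by rewrite !ltW.
have lin (s' : seq (R * R)) : (forall p, p \in s' -> 0 < p.2 < 1) ->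
    mu.-integrable `[0, 1] (EFin \o (fun x => \sum_(p <- s') p.1 * phi p.2 x)) /\
    \int[mu]_(x in `[0, 1]) (\sum_(p <- s') p.1 * phi p.2 x) =
     (1 - al) * frullani_cst al * \sum_(p <- s') p.1 * (g 1 - g p.2).
  elim: s' => [|p s' IH] s'01.
    split; last first.
      under eq_Rintegral do rewrite big_nil.
      by rewrite Rintegral_cst// mul0r big_nil mulr0.
    rewrite (_ : _ \o _ = cst 0%E); first exact: integrable0.
    by apply/funext => u; rewrite /= big_nil.
  have [|ip ep] := phiP p.2; first by apply: s'01; rewrite mem_head.
  have [|iS es] := IH; first by move=> q qs; apply: s'01; rewrite in_cons qs orbT.
  have ip' := integrableRZl p.1 _ ip.
  have E : (fun x => \sum_(p <- p :: s') p.1 * phi p.2 x) =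
    (fun x => p.1 * phi p.2 x + \sum_(p <- s') p.1 * phi p.2 x).
    by apply/funext => x; rewrite big_cons.
  split; first by rewrite E; exact: integrableD (ip' (measurable_itv _)) iS.
  rewrite E (RintegralD _ (ip' (measurable_itv _)) iS); last exact: measurable_itv.
  rewrite (RintegralZl _ _ ip); last exact: measurable_itv.
  by rewrite es ep big_cons; ring.
rewrite -(lin s s01).2; apply: eq_Rintegral => x; rewrite inE/= in_itv/= => x01.
rewrite -/(left_marchaud al (step s) x) -/(right_marchaud al 1 g x).
rewrite (left_marchaud_step_ind _ al0 _).2; last by move=> p /s01/andP[].
rewrite mulr_suml; apply: eq_bigr => p _; rewrite -mulrA; congr (_ * _).
by rewrite /phi -right_marchaud_clamp01//; case: ifP => // _; rewrite mul0r.
Qed.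

End step_integral.

(** * Fractional norm of a step function *)

Section step_norm.
Context (R : realType).
Local Notation mu := (@lebesgue_measure R).
Local Notation MR := (measurableTypeR R).
Implicit Types (al a x t : R) (f g : R -> R) (s : seq (R * R)).

Definition frac_variation al f x : \bar R :=
  (\int[mu]_(z in `[0%R, x]) (`|f x - f z| / (x - z) `^ (1 + al))%:E)%E.

(** By the triangle inequality it suffices to bound one jump at [a], which costs
    [x^(-al) + ((x - a)^(-al) - x^(-al)) / al]; since [x^(-al) <= (x - a)^(-al)], the factor
    [1 + 1 / al] suffices. *)
Lemma frac_variation_step_le al s x : 0 < al -> (forall p, p \in s -> 0 < p.2) ->
  ((`|step s x| / x `^ al)%:E + frac_variation al (step s) x <=
   (\sum_(p <- s) `|p.1| * (if p.2 < x then (1 + al^-1) * (x - p.2) `^ (- al) else 0))%:E)%E.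
Proof.
move=> al0; rewrite /frac_variation; elim: s => [|p s IH] s0.
  rewrite big_nil /step big_nil normr0 mul0r add0e.
  under eq_integral do rewrite big_nil subrr normr0 mul0r.
  by rewrite integral0.
have p0 : 0 < p.2 by apply: s0; rewrite mem_head.
have {}IH := IH (fun q qs => s0 q (mem_behead (s := p :: s) qs)).
have mV : measurable_fun (`[0, x]%classic : set MR) (fun z => ((x - z) `^ (1 + al))^-1).
  rewrite (_ : (fun z => _) = (fun z => (x - z) `^ (- (1 + al)))).
    exact: measurable_powR_subr.
  by apply/funext => z; rewrite powRN.
have mA a : measurable_fun (`[0, x]%classic : set MR) (after a).
  apply: measurable_funTS; apply: measurable_fun_ifT => //; exact: measurable_fun_ltr.
have mS s' : measurable_fun (`[0, x]%classic : set MR) (step s').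
  by apply: measurable_funTS; exact: measurable_step.
have mQ (h : R -> R) : measurable_fun (`[0, x]%classic : set MR) h ->
    measurable_fun (`[0, x]%classic : set MR) (fun z => (`|h x - h z| / (x - z) `^ (1 + al))%:E).
  move=> mh; apply/measurable_EFinP; apply: measurable_funM => //.
  by apply: measurableT_comp => //; exact: measurable_funB.
have stepE y : step (p :: s) y = p.1 * after p.2 y + step s y.
  by rewrite /step big_cons.
rewrite big_cons EFinD.
set V := (\int[mu]_(z in `[0%R, x]) _)%E.
have Vle : (V <= (`|p.1|)%:E * \int[mu]_(z in `[0%R, x]) (`|after p.2 x - after p.2 z| / (x - z) `^ (1 + al))%:E
    + \int[mu]_(z in `[0%R, x]) (`|step s x - step s z| / (x - z) `^ (1 + al))%:E)%E.
  rewrite -ge0_integralZl_EFin//; last 2 first.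
  - by move=> z _; rewrite lee_fin mulr_ge0 ?invr_ge0 ?powR_ge0.
  - exact: mQ.
  rewrite -ge0_integralD//; last 4 first.
  - by move=> z _; rewrite -EFinM lee_fin mulr_ge0// mulr_ge0 ?invr_ge0 ?powR_ge0.
  - by apply: emeasurable_funM => //; exact: mQ.
  - by move=> z _; rewrite lee_fin mulr_ge0 ?invr_ge0 ?powR_ge0.
  - exact: mQ.
  apply: ge0_le_integral => //.
  - by move=> z _; rewrite lee_fin mulr_ge0 ?invr_ge0 ?powR_ge0.
  - exact: mQ.
  - by apply: emeasurable_funD; [apply: emeasurable_funM => //; exact: mQ|exact: mQ].
  - move=> z _; rewrite -EFinM -EFinD lee_fin mulrA -mulrDl.
    rewrite ler_wpM2r ?invr_ge0 ?powR_ge0// !stepE.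
    rewrite (_ : _ - _ = p.1 * (after p.2 x - after p.2 z) + (step s x - step s z)); last by ring.
    by rewrite (le_trans (ler_normD _ _))// normrM.
apply: (@le_trans _ _ ((`|p.1| * (after p.2 x / x `^ al))%:E + (`|step s x| / x `^ al)%:E +
   (`|p.1|%:E * \int[mu]_(z in `[0%R, x]) (`|after p.2 x - after p.2 z| / (x - z) `^ (1 + al))%:E
    + \int[mu]_(z in `[0%R, x]) (`|step s x - step s z| / (x - z) `^ (1 + al))%:E))%E).
  apply: leeD => //; rewrite -EFinD lee_fin mulrA -mulrDl ler_wpM2r ?invr_ge0 ?powR_ge0//.
  rewrite stepE (le_trans (ler_normD _ _))// normrM [`|after _ _|]ger0_norm//.
  by rewrite /after; case: ifP.
rewrite addeACA; apply: leeD => //.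
rewrite integral_indicator_quotient// -EFinM -EFinD lee_fin -mulrDr ler_wpM2l//.
rewrite /after; case: ifPn => [px|_]; last by rewrite mul0r add0r.
have x0 : 0 < x by exact: lt_trans px.
have h1 : x `^ (- al) <= (x - p.2) `^ (- al).
  rewrite powRN [leRHS]powRN lef_pV2 ?posrE ?powR_gt0 ?subr_gt0//.
  by apply: ge0_ler_powR; rewrite ?nnegrE ?subr_ge0 ?gerBl ?ltW.
rewrite mul1r -powRN [leRHS]mulrDl mul1r.
have h2 := powR_ge0 x (- al).
have i0 : 0 < al^-1 by rewrite invr_gt0.
move: (x `^ (- al)) (_ `^ (- al)) (al^-1) h1 h2 i0 => A B C h1 h2 i0.
nra.
Qed.

(** The majorant has only singularities [(x - a)^(-al)], which are integrable for [al < 1]. *)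
Lemma frac_norm_finite_step al s : 0 < al < 1 -> (forall p, p \in s -> 0 < p.2 < 1) ->
  frac_norm_finite al 1 (step s).
Proof.
move=> /andP[al0 al1] s01; split; first by apply: measurable_funTS; exact: measurable_step.
pose b a x := if a < x then (1 + al^-1) * (x - a) `^ (- al) else 0.
have ib (s' : seq (R * R)) : (forall p, p \in s' -> 0 < p.2 < 1) ->
    mu.-integrable `[0, 1] (EFin \o (fun x => \sum_(p <- s') `|p.1| * b p.2 x)).
  elim: s' => [|p s' IH] s'01.
    rewrite (_ : _ \o _ = cst 0%E); first exact: integrable0.
    by apply/funext => u; rewrite /= big_nil.
  have /andP[p0 p1] : 0 < p.2 < 1 by apply: s'01; rewrite mem_head.
  have {}IH := IH (fun q qs => s'01 q (mem_behead (s := p :: s') qs)).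
  have ibp : mu.-integrable `[0, 1] (EFin \o b p.2).
    have iD : mu.-integrable `]p.2, 1] (EFin \o (fun x => (1 + al^-1) * (x - p.2) `^ (- al))).
      apply: integrableRZl => //; apply/integrableP; split.
        by apply/measurable_EFinP; exact: measurable_powR_subl.
      under eq_integral do rewrite /= ger0_norm ?powR_ge0//.
      by rewrite integral_powR_subl ?ltry//; lra.
    have iT : mu.-integrable setT (EFin \o (fun x => if (p.2 < x) && (x <= 1) then
        (1 + al^-1) * (x - p.2) `^ (- al) else 0)).
      by apply: (@integrable_ifP _ `]p.2, 1]%classic).
    have : mu.-integrable `[0, 1] (EFin \o (fun x => if (p.2 < x) && (x <= 1) then
        (1 + al^-1) * (x - p.2) `^ (- al) else 0)) by exact: integrableS iT.
    apply: eq_integrable => // x; rewrite inE/= in_itv/= => /andP[_ x1].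
    by rewrite x1 andbT.
  have E : (fun x => \sum_(p <- p :: s') `|p.1| * b p.2 x) =
    (fun x => `|p.1| * b p.2 x + \sum_(p <- s') `|p.1| * b p.2 x).
    by apply/funext => x; rewrite big_cons.
  have i1 := integrableRZl `|p.1| _ ibp.
  by rewrite E; exact: integrableD (i1 (measurable_itv _)) IH.
have h := integrable_lty _ (ib s s01).
apply: (le_lt_trans _ (h (measurable_itv _))).
rewrite /frac_norm; apply: ge0_le_integral => //.
- move=> x _; apply: adde_ge0; first by rewrite lee_fin mulr_ge0 ?invr_ge0 ?powR_ge0.
  by apply: integral_ge0 => z _; rewrite lee_fin mulr_ge0 ?invr_ge0 ?powR_ge0.
- apply: emeasurable_funD.
    apply/measurable_EFinP; apply: measurable_funM.
      by apply: measurableT_comp => //; apply: measurable_funTS; exact: measurable_step.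
    rewrite (_ : (fun z => _) = (fun z => z `^ (- al))).
      by apply: measurable_funTS; exact: measurable_powR.
    by apply/funext => z; rewrite powRN.
  pose k (z : MR * MR) : R := if (0 <= z.2) && (z.2 <= z.1) then
    `|step s z.1 - step s z.2| * (z.1 - z.2) `^ (- (1 + al)) else 0.
  have mk : measurable_fun setT (EFin \o k).
    have m1 : measurable_fun [set: MR * MR] (fun z => step s z.1).
      by apply: measurableT_comp => //; exact: measurable_step.
    have m2 : measurable_fun [set: MR * MR] (fun z => step s z.2).
      by apply: measurableT_comp => //; exact: measurable_step.
    have m3 : measurable_fun [set: MR * MR] (fun z => `|step s z.1 - step s z.2|).
      by apply: measurableT_comp => //; exact: measurable_funB.
    by apply/measurable_EFinP; rewrite /k; solve_measurable.
  rewrite (_ : (fun x => _) = (fun x => \int[mu]_u (k (x, u))%:E)%E).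
    by apply: measurable_funTS; exact: (measurable_integral_snd mu mk).
  apply/funext => x; rewrite /k/= (integral_if (`[0%R, x]%classic : set MR)).
    by apply: eq_integral => u _; rewrite powRN.
  by move=> u /=; rewrite in_itv.
- exact: (measurable_int _ (ib s s01)).
- by move=> x _; apply: frac_variation_step_le => // p /s01/andP[].
Qed.

End step_norm.

(** * Increments of fractional Brownian motion *)

Lemma integrableRB d (T : measurableType d) (R : realType)
    (m : {measure set T -> \bar R}) (D : set T) (f g : T -> R) :
  measurable D -> m.-integrable D (EFin \o f) -> m.-integrable D (EFin \o g) ->
  m.-integrable D (EFin \o (fun x => f x - g x)).
Proof.
move=> mD fi gi; have := integrableB mD fi gi; apply: eq_integrable => // x _.
Qed.

Section fbm_moments.
Context d (T : measurableType d) (R : realType) (P : probability T R)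
  (F : R -> set (set T)) (H : R) (B : R -> T -> R).
Hypothesis FF : complete_left_continuous_filtration P F.
Hypothesis H0 : 0 < H.
Hypothesis BF : fractional_brownian_motion P F H B.
Implicit Types (s t p q : R).

Lemma measurable_fbm t : 0 <= t <= 1 -> measurable_fun [set: T] (B t).
Proof.
move=> t01 _ A mA; rewrite setTI.
exact: (filtration_measurable FF t01 (fbm_adapted BF t01 mA)).
Qed.

(** A finite expectation proves integrability for nonnegative variables, hence for squares; the
    product is then dominated by a sum of squares. *)
Lemma integrable_fbm_mul s t : 0 <= s <= 1 -> 0 <= t <= 1 ->
  P.-integrable setT (EFin \o (fun w => B s w * B t w)).
Proof.
have sq u : 0 <= u <= 1 -> P.-integrable setT (EFin \o (fun w => B u w * B u w)).
  move=> u01; apply/integrableP; split.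
    by apply/measurable_EFinP; apply: measurable_funM; exact: measurable_fbm.
  under eq_integral do rewrite /= ger0_norm -?expr2 ?sqr_ge0// expr2.
  have := fbm_covariance BF u01 u01; rewrite unlock => ->.
  by rewrite ltry.
move=> s01 t01.
apply: (@le_integrable _ _ _ _ _ _ _ (EFin \o (fun w => B s w * B s w + B t w * B t w))) => //.
- by apply/measurable_EFinP; apply: measurable_funM; exact: measurable_fbm.
- move=> w _; rewrite /= lee_fin normrM [leRHS]ger0_norm; last first.
    by rewrite -!expr2 addr_ge0 ?sqr_ge0.
  have e (x : R) : x * x = `|x| ^+ 2 by rewrite real_normK ?num_real// expr2.
  rewrite !e.
  have := sqr_ge0 (`|B s w| - `|B t w|).
  have := mulr_ge0 (normr_ge0 (B s w)) (normr_ge0 (B t w)).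
  nra.
- exact: integrableD (sq s s01) (sq t t01).
Qed.

Lemma Rintegral_fbm_mul s t : 0 <= s <= 1 -> 0 <= t <= 1 ->
  \int[P]_w (B s w * B t w) =
  2^-1 * (s `^ (2 * H) + t `^ (2 * H) - `|s - t| `^ (2 * H)).
Proof.
move=> s01 t01; have := fbm_covariance BF t01 s01.
rewrite unlock /Rintegral => ->/=.
by rewrite distrC [t `^ _ + _]addrC.
Qed.

Lemma fbm_increments t p q : 0 <= t <= 1 -> 0 <= p <= 1 -> 0 <= q <= 1 ->
  P.-integrable setT (EFin \o (fun w => (B p w - B t w) * (B q w - B t w))) /\
  \int[P]_w ((B p w - B t w) * (B q w - B t w)) =
  2^-1 * (`|p - t| `^ (2 * H) + `|q - t| `^ (2 * H) - `|p - q| `^ (2 * H)).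
Proof.
move=> t01 p01 q01.
have i1 := integrable_fbm_mul p01 q01.
have i2 := integrable_fbm_mul p01 t01.
have i3 := integrable_fbm_mul q01 t01.
have i4 := integrable_fbm_mul t01 t01.
have E : (fun w => (B p w - B t w) * (B q w - B t w)) =
  (fun w => (B p w * B q w - B p w * B t w) - (B q w * B t w - B t w * B t w)).
  by apply/funext => w; ring.
have i12 : P.-integrable setT (EFin \o (fun w => B p w * B q w - B p w * B t w)).
  exact: integrableRB.
have i34 : P.-integrable setT (EFin \o (fun w => B q w * B t w - B t w * B t w)).
  exact: integrableRB.
rewrite E; split; first exact: integrableRB.
rewrite (RintegralB measurableT i12 i34) (RintegralB measurableT i1 i2).
rewrite (RintegralB measurableT i3 i4) !Rintegral_fbm_mul//.
rewrite subrr normr0 powR0; last by rewrite mulf_neq0// gt_eqF.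
by rewrite [`|q - t|]distrC; field.
Qed.

Lemma fbm_increment_mean t p : 0 <= t <= 1 -> 0 <= p <= 1 ->
  P.-integrable setT (EFin \o (fun w => B p w - B t w)) /\
  \int[P]_w (B p w - B t w) = 0.
Proof.
move=> t01 p01.
have i u : 0 <= u <= 1 -> P.-integrable setT (EFin \o B u).
  move=> u01; apply: (@le_integrable _ _ _ _ _ _ _ (EFin \o (fun w => 1 + B u w * B u w))) => //.
  - by apply/measurable_EFinP; exact: measurable_fbm.
  - move=> w _; rewrite /= lee_fin [leRHS]ger0_norm; last first.
      by rewrite -expr2 addr_ge0 ?sqr_ge0.
    rewrite -expr2 -(real_normK (num_real _)).
    have := sqr_ge0 (`|B u w| - 1); have := normr_ge0 (B u w); nra.
  - have i1 : P.-integrable setT (EFin \o (fun=> 1 : R)).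
      exact: finite_measure_integrable_cst.
    exact: integrableD i1 (integrable_fbm_mul u01 u01).
split; first exact: integrableRB measurableT (i _ p01) (i _ t01).
rewrite (RintegralB measurableT (i _ p01) (i _ t01)).
have z u : 0 <= u <= 1 -> \int[P]_w B u w = 0.
  by move=> u01; have := fbm_centered BF u01; rewrite unlock /Rintegral => ->.
by rewrite !z// subrr.
Qed.

End fbm_moments.

(** * Almost sure finiteness of the quadratic double integral *)

Section joint_measurability.
Context d (T : measurableType d) (R : realType).
Local Notation MR := (measurableTypeR R).
Implicit Types (X : R -> T -> R).

(** By continuity of the paths, the process is the pointwise limit of those frozen at the left
    endpoint of each cell of width [1 / (n+1)]. *)
Lemma measurable_continuous_process X :
  (forall t, 0 <= t <= 1 -> measurable_fun setT (X t)) ->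
  (forall w, {within `[0, 1], continuous (X ^~ w)}) ->
  measurable_fun [set: MR * T]
    (fun z => if (0 <= z.1) && (z.1 < 1) then X z.1 z.2 else 0).
Proof.
move=> mX cX.
pose h (n : nat) (z : MR * T) : R := \sum_(k < n.+1)
  if (k%:R / n.+1%:R <= z.1) && (z.1 < k.+1%:R / n.+1%:R) then
    X (k%:R / n.+1%:R) z.2 else 0.
apply: (@measurable_fun_cvg _ _ _ _ h).
  move=> n; apply: measurable_sum => k; apply: measurable_fun_ifT => //.
    by solve_measurable.
  apply: measurableT_comp; last exact: measurable_snd.
  apply: mX; rewrite divr_ge0//= ler_pdivrMr// mul1r ler_nat.
  exact: (leq_trans (ltnW (ltn_ord k))).
move=> [x w] _ /=.
have n0 n : 0 < n.+1%:R :> R by [].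
have [/andP[x0 x1]|x01] := boolP ((0 <= x) && (x < 1)); last first.
  rewrite (_ : (fun n => _) = cst 0); first exact: cvg_cst.
  apply/funext => n; rewrite /h big1// => k _; case: ifPn => // /andP[h1 h2].
  exfalso; move/negP: x01; apply; rewrite (le_trans _ h1) ?divr_ge0//=.
  by rewrite (lt_le_trans h2)// ler_pdivrMr// mul1r ler_nat.
pose r n : R := (Num.truncn (x * n.+1%:R))%:R / n.+1%:R.
have rx n : r n <= x.
  by rewrite /r ler_pdivrMr// truncn_le// mulr_ge0// ltW.
have xr n : x < (Num.truncn (x * n.+1%:R)).+1%:R / n.+1%:R.
  by rewrite ltr_pdivlMr// truncnS_gt.
have hE n : h n (x, w) = X (r n) w.
  have kn : (Num.truncn (x * n.+1%:R) < n.+1)%N.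
    rewrite -(ltr_nat R); apply: le_lt_trans (_ : x * n.+1%:R < _).
      by rewrite truncn_le// mulr_ge0// ltW.
    by rewrite gtr_pMl.
  rewrite /h (bigD1 (Ordinal kn))//= big1 ?addr0.
    by rewrite [_ <= x]rx xr.
  move=> k /negP kk; case: ifPn => // /andP[h1 h2]; exfalso; apply: kk.
  apply/eqP/val_inj => /=; apply/esym/eqP.
  rewrite truncn_eq ?mulr_ge0//.
  by rewrite -ler_pdivrMr// h1 -ltr_pdivlMr.
rewrite (_ : (fun n => _) = (fun n => X (r n) w)); last by apply/funext.
have r01 n : r n \in `[0, 1].
  rewrite in_itv/= (le_trans (rx n) (ltW x1)) andbT.
  by rewrite divr_ge0.
have rcvg : r n @[n --> \oo] --> x.
  apply/cvgrPdist_lt => e e0.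
  have : n.+1%:R^-1 @[n --> \oo] --> (0 : R) by exact: cvg_harmonic.
  move=> /cvgrPdist_lt/(_ e e0); apply: filterS => n /=.
  rewrite sub0r normrN ger0_norm ?invr_ge0// => ne.
  rewrite ger0_norm ?subr_ge0//; apply: le_lt_trans ne.
  have := xr n; rewrite -addn1 natrD mulrDl mul1r -/(r n) => h1.
  by rewrite lerBlDl ltW.
have /subspace_continuousP := cX w.
move=> /(_ x) cx; apply: (@cvg_comp _ _ _ r (X ^~ w) \oo (within `[0, 1]%classic (nbhs x))).
  move=> U; rewrite /within/= => nU.
  have nx : \forall n \near \oo, r n \in `[0, 1] -> U (r n) by exact: (rcvg _ nU).
  by apply: filterS nx => n; apply.
by apply: cx; rewrite /= in_itv/= x0 ltW.
Qed.

End joint_measurability.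

Section slobodeckij_finite.
Context d (T : measurableType d) (R : realType) (P : probability T R)
  (F : R -> set (set T)) (H al : R) (B : R -> T -> R).
Local Notation mu := (@lebesgue_measure R).
Local Notation MR := (measurableTypeR R).

(** The exponent [al - 2 - H] corresponds to [ga = 2 - H - al]. It balances the two majorants:
    [- ga] and the exponent [2 H + (al - 2 - H)] of the expectation both equal [H + al - 2], which
    exceeds -1 exactly when [al > 1 - H]. *)
Lemma fbm_slobodeckij_finite : complete_left_continuous_filtration P F ->
  fractional_brownian_motion P F H B -> 0 < H < 1 -> 1 - H < al ->
  {ae P, forall w, (\int[mu \x mu]_z (slobodeckij (al - 2 - H) (B ^~ w) z)%:E < +oo)%E}.
Proof.
move=> FF BF /andP[H0 H1] al1.
(* The cut-off makes the process jointly measurable, as nothing is known of [B] outside [[0, 1]]. *)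
pose b (z : MR * T) := if (0 <= z.1) && (z.1 < 1) then B z.1 z.2 else 0.
have mb : measurable_fun [set: MR * T] b.
  apply: measurable_continuous_process; first by move=> t; exact: (measurable_fbm FF BF).
  exact: (fbm_continuous BF).
pose S (y : (MR * MR) * T) := slobodeckij (al - 2 - H) (B ^~ y.2) y.1.
have SE : S = fun y => if [&& 0 < y.1.1, y.1.1 < y.1.2 & y.1.2 < 1] then
    (b (y.1.2, y.2) - b (y.1.1, y.2)) ^+ 2 * (y.1.2 - y.1.1) `^ (al - 2 - H) else 0.
  apply/funext => -[[x u] w]; rewrite /S /slobodeckij /b /=; case: ifPn => // /and3P[x0 xu u1].
  by rewrite (ltW x0) (lt_trans xu u1) u1 (ltW (lt_trans x0 xu)).
have mS : measurable_fun [set: (MR * MR) * T] S.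
  have m11 : measurable_fun [set: (MR * MR) * T] (fun y => y.1.1).
    by apply: measurableT_comp; [exact: measurable_fst|exact: measurable_fst].
  have m12 : measurable_fun [set: (MR * MR) * T] (fun y => y.1.2).
    by apply: measurableT_comp; [exact: measurable_snd|exact: measurable_fst].
  have mb1 : measurable_fun [set: (MR * MR) * T] (fun y => b (y.1.1, y.2)).
    by apply: (measurableT_comp mb); apply: measurable_fun_pair.
  have mb2 : measurable_fun [set: (MR * MR) * T] (fun y => b (y.1.2, y.2)).
    by apply: (measurableT_comp mb); apply: measurable_fun_pair.
  by rewrite SE; solve_measurable.
have S0 y : 0 <= S y.
  by rewrite /S /slobodeckij; case: ifP => // _; rewrite mulr_ge0 ?sqr_ge0 ?powR_ge0.
(* Regrouping the variables as [((x, w), u)] allows two successive exchanges, of [w] with [x] and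
   then of [w] with [u] at fixed [x]. *)
pose S1 (y : (MR * T) * MR) := S ((y.1.1, y.2), y.1.2).
have mS1 : measurable_fun setT (EFin \o S1).
  apply/measurable_EFinP; apply: (measurableT_comp mS).
  apply: measurable_fun_pair; first apply: measurable_fun_pair.
  - by apply: measurableT_comp; [exact: measurable_fst|exact: measurable_fst].
  - exact: measurable_snd.
  - by apply: measurableT_comp; [exact: measurable_snd|exact: measurable_fst].
have S10 y : (0 <= (EFin \o S1) y)%E by rewrite lee_fin; exact: S0.
pose E1 (y : MR * T) := (\int[mu]_u (S1 (y, u))%:E)%E.
have mE1 : measurable_fun setT E1.
  exact: (@measurable_fun_fubini_tonelli_F _ _ _ _ _ mu (EFin \o S1)).
have E10 y : (0 <= E1 y)%E by apply: integral_ge0 => u _; rewrite lee_fin; exact: S0.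
have EE1 w : (\int[mu \x mu]_z (slobodeckij (al - 2 - H) (B ^~ w) z)%:E = \int[mu]_x E1 (x, w))%E.
  have mSw : measurable_fun [set: MR * MR] (EFin \o (fun z => S (z, w))).
    by apply/measurable_EFinP; exact: (measurable_fun_pair1 w mS).
  have S0w z : (0 <= (EFin \o (fun z => S (z, w))) z)%E by rewrite lee_fin; exact: S0.
  exact: (@fubini_tonelli1 _ _ _ _ _ mu mu _ mSw S0w).
have mE : measurable_fun setT (fun w => \int[mu]_x E1 (x, w))%E.
  exact: (@measurable_fun_fubini_tonelli_G _ _ _ _ _ mu E1).
have Efin : (\int[P]_w \int[mu]_x E1 (x, w) < +oo)%E.
  have <- := @fubini_tonelli _ _ _ _ _ mu P E1 mE1 E10.
  pose p := H + al - 2; have p1 : -1 < p by rewrite /p; lra.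
  apply: (@le_lt_trans _ _ (\int[mu]_x (if (0 < x) && (x < 1) then (p + 1)^-1 else 0)%:E)%E).
    apply: ge0_le_integral => //.
    - by move=> x _; apply: integral_ge0.
    - exact: (@measurable_fun_fubini_tonelli_F _ _ _ _ _ P E1).
    - apply/measurable_EFinP; apply: measurable_fun_ifT => //.
      by apply: measurable_and; exact: measurable_fun_ltr.
    - move=> x _.
      have mSx : measurable_fun [set: T * MR] (EFin \o (fun y => S1 ((x, y.1), y.2))).
        apply: (measurableT_comp mS1); apply: measurable_fun_pair; last exact: measurable_snd.
        by apply: measurable_fun_pair; [exact: measurable_cst|exact: measurable_fst].
      have S0x y : (0 <= (EFin \o (fun y => S1 ((x, y.1), y.2))) y)%E by rewrite lee_fin; exact: S0.
      rewrite /E1 [leLHS](@fubini_tonelli _ _ _ _ _ P mu _ mSx S0x) /=.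
      have [/andP[x0 x1]|x01] := boolP ((0 < x) && (x < 1)); last first.
        rewrite integral0_eq// => u _; rewrite integral0_eq// => w _.
        rewrite /S1 /S /slobodeckij /=; case: ifPn => // /and3P[h1 h2 h3].
        by move: x01; rewrite h1 (lt_trans h2 h3).
      have inner u : (\int[P]_w (S1 ((x, w), u))%:E)%E =
          (if (x < u) && (u < 1) then (u - x) `^ p else 0)%:E.
        rewrite /S1 /S /slobodeckij /= x0 /=; case: ifPn => [/andP[xu u1]|_]; last first.
          by rewrite integral0_eq.
        have x01' : 0 <= x <= 1 by rewrite !ltW.
        have u01 : 0 <= u <= 1 by rewrite !ltW// (lt_trans x0).
        have [ii ee] := fbm_increments FF H0 BF x01' u01 u01.
        under eq_integral do rewrite mulrC EFinM expr2.
        rewrite ge0_integralZl_EFin ?powR_ge0//; last 2 first.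
        + by move=> w _; rewrite lee_fin -expr2 sqr_ge0.
        + exact: measurable_int ii.
        rewrite -[X in (_ * X)%E](@fineK _ _); last exact: integrable_fin_num.
        rewrite -EFinM; congr EFin.
        rewrite -[fine _]/(\int[P]_w ((B u w - B x w) * (B u w - B x w))) ee.
        rewrite subrr normr0 powR0 ?mulf_neq0 ?gt_eqF// subr0 gtr0_norm ?subr_gt0//.
        have -> : p = (al - 2 - H) + 2 * H by rewrite /p; ring.
        have ux : 0 < u - x by rewrite subr_gt0.
        rewrite [RHS]powRD ?(gt_eqF ux) ?implybT//.
        by field.
      under eq_integral do rewrite inner.
      rewrite (integral_if (`]x, 1%R[%classic : set MR)); last by move=> u; rewrite /= in_itv.
      apply: (@le_trans _ _ (\int[mu]_(u in `]x, 1%R]) ((u - x) `^ p)%:E)%E).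
        apply: ge0_subset_integral => //.
        + by apply/measurable_EFinP; exact: measurable_powR_subl.
        + by move=> u _; rewrite lee_fin powR_ge0.
        + by move=> u /=; rewrite !in_itv/= => /andP[-> /ltW ->].
      rewrite integral_powR_subl// lee_fin ler_pdivrMr ?mulVf ?gt_eqF//; try lra.
      apply: (@le_trans _ _ (1 `^ (p + 1))); last by rewrite powR1.
      by apply: ge0_ler_powR; rewrite ?nnegrE; lra.
  rewrite (integral_if (`]0%R, 1%R[%classic : set MR)); last by move=> x; rewrite /= in_itv.
  have m01 : (mu (`]0%R, 1%R[%classic : set MR) = 1)%E.
    have := @lebesgue_measure_itv R `]0, 1[.
    by rewrite /= lte_fin ltr01 oppr0 adde0.
  have -> : (\int[mu]_(x in `]0%R, 1%R[) ((p + 1)^-1)%:E = ((p + 1)^-1)%:E * 1)%E.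
    by rewrite -m01; exact: integral_cst.
  by rewrite mule1 ltry.
have iE : P.-integrable setT (fun w => \int[mu]_x E1 (x, w))%E.
  apply/integrableP; split => //.
  by under eq_integral do rewrite gee0_abs ?integral_ge0//.
have := integrable_ae measurableT iE; apply: filterS => w /(_ I).
by rewrite EE1 => /fin_numPlt/andP[].
Qed.

End slobodeckij_finite.

(** * Gaussian estimates *)

Section normal.
Context (R : realType).
Local Notation mu := (@lebesgue_measure R).
Local Notation MR := (measurableTypeR R).
Implicit Types (m s : R).

(** Change of variables with the Radon-Nikodym derivative, which agrees almost everywhere with the
    density because both have the same integrals over measurable sets. *)
Lemma integral_normal_prob m s (f : R -> \bar R) : s != 0 ->
  measurable_fun setT f -> (forall x, 0 <= f x)%E ->
  (\int[normal_prob m s]_x f x = \int[mu]_x (f x * (normal_pdf m s x)%:E))%E.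
Proof.
move=> s0 mf f0.
have dom := normal_prob_dominates m s.
have mp : measurable_fun [set: R] (fun x => (normal_pdf m s x)%:E).
  by apply/measurable_EFinP; exact: measurable_normal_pdf.
rewrite -(Radon_Nikodym_SigmaFinite.change_of_variables dom f0)//.
apply: ae_eq_integral => //.
- apply: emeasurable_funM => //.
  exact: (measurable_int _ (Radon_Nikodym_SigmaFinite.f_integrable dom)).
- exact: emeasurable_funM.
apply: ae_eqe_mul2l; apply: integral_ae_eq => //.
  exact: (Radon_Nikodym_SigmaFinite.f_integrable dom).
move=> E _ mE; rewrite -(Radon_Nikodym_SigmaFinite.f_integral dom)//.
Qed.

(* Domination by the normal density with twice the variance; the constant 8 is
   not sharp. *)
Lemma normal_second_moment_le m s : s != 0 ->
  (\int[normal_prob m s]_x (((x - m) ^+ 2)%:E) <= (8 * s ^+ 2)%:E)%E.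
Proof.
move=> s0.
have mq : measurable_fun [set: R] (fun x : R => (x - m) ^+ 2).
  by apply: measurable_funX; exact: measurable_funB.
rewrite integral_normal_prob//; last 2 first.
- exact/measurable_EFinP.
- by move=> x; rewrite lee_fin sqr_ge0.
pose s' := Num.sqrt 2 * s.
have s'0 : s' != 0 by rewrite mulf_neq0// gt_eqF// sqrtr_gt0.
have s'2 : s' ^+ 2 = 2 * s ^+ 2 by rewrite exprMn sqr_sqrtr.
have s2 : 0 < s ^+ 2 by rewrite exprn_even_gt0.
apply: (@le_trans _ _ (\int[mu]_x ((8 * s ^+ 2)%:E * (normal_pdf m s' x)%:E))%E).
  apply: ge0_le_integral => //.
  - by move=> x _; rewrite -EFinM lee_fin mulr_ge0 ?sqr_ge0 ?normal_pdf_ge0.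
  - by apply/measurable_EFinP; apply: measurable_funM => //; exact: measurable_normal_pdf.
  - by apply/measurable_EFinP; apply: measurable_funM => //; exact: measurable_normal_pdf.
  - move=> x _; rewrite -!EFinM lee_fin !normal_pdfE// /normal_fun s'2.
    have peak : normal_peak s <= 2 * normal_peak s'.
      rewrite /normal_peak s'2.
      have -> : 2 * s ^+ 2 * pi *+ 2 = 2 * (s ^+ 2 * pi *+ 2) by ring.
      rewrite sqrtrM// invfM mulrA ler_peMl ?invr_ge0 ?sqrtr_ge0//.
      rewrite ler_pdivlMr ?sqrtr_gt0// mul1r.
      have h : Num.sqrt 2 ^+ 2 = 2 :> R by rewrite sqr_sqrtr.
      by have := sqrtr_ge0 (2 : R); nra.
    pose z := (x - m) ^+ 2 / (4 * s ^+ 2).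
    have z0 : 0 <= z by rewrite divr_ge0 ?sqr_ge0// mulr_ge0// ltW.
    have -> : (x - m) ^+ 2 = 4 * s ^+ 2 * z by rewrite /z; field.
    have -> : - (4 * s ^+ 2 * z) / (s ^+ 2 *+ 2) = - (2 * z) by field.
    have -> : - (4 * s ^+ 2 * z) / (2 * s ^+ 2 *+ 2) = - z by field.
    have h : z * expR (- (2 * z)) <= expR (- z).
      have -> : - (2 * z) = - z - z by ring.
      rewrite expRD mulrA -[leRHS]mul1r ler_wpM2r ?expR_ge0// expRN.
      rewrite ler_pdivrMr ?expR_gt0// mul1r.
      by have := expR_ge1Dx z; lra.
    have p0 := normal_peak_ge0 s'; have p1 := normal_peak_ge0 s.
    apply: (@le_trans _ _ (4 * s ^+ 2 * normal_peak s * expR (- z))).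
      rewrite (_ : 4 * s ^+ 2 * z * _ = 4 * s ^+ 2 * normal_peak s * (z * expR (- (2 * z)))); last by ring.
      by apply: ler_wpM2l => //; apply: mulr_ge0 => //; apply: mulr_ge0 => //; exact: ltW.
    rewrite (_ : 8 * s ^+ 2 * (normal_peak s' * expR (- z)) = 4 * s ^+ 2 * (2 * normal_peak s') * expR (- z)); last by ring.
    apply: ler_wpM2r; first exact: expR_ge0.
    by apply: ler_wpM2l => //; apply: mulr_ge0 => //; exact: ltW.
rewrite ge0_integralZl_EFin//; last 3 first.
- by move=> x _; rewrite lee_fin normal_pdf_ge0.
- by apply/measurable_EFinP; exact: measurable_normal_pdf.
- by rewrite mulr_ge0// ltW.
by rewrite integral_normal_pdf// mule1.
Qed.

(* The unit second moment forces [s] to be bounded below, so the density is at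
   most 2. *)
Lemma gaussian_interval_le d (T : measurableType d) (P : probability T R)
    (X : T -> R) (a b : R) : gaussian_variable P X ->
  P.-integrable setT (EFin \o X) -> \int[P]_w X w = 0 ->
  P.-integrable setT (EFin \o (fun w => X w ^+ 2)) -> \int[P]_w X w ^+ 2 = 1 ->
  a <= b -> (P [set w | (a <= X w <= b)%R] <= (2 * (b - a))%:E)%E.
Proof.
move=> [mX [m [s [s0 law]]]] iX X0 iX2 X1 ab.
pose N : {measure set MR -> \bar R} := pushforward P (X : T -> MR).
have mq : measurable_fun [set: R] (fun x : R => (x - m) ^+ 2).
  by apply: measurable_funX; exact: measurable_funB.
(* The parameter [m] is not identified with the mean: as [X] has mean 0, the second moment about any
   [m] is at least the one about 0, which is 1. *)
have ge1 (Q : {measure set MR -> \bar R}) : (forall A : set MR, measurable A -> P (X @^-1` A) = Q A) ->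
    (1 <= \int[Q]_x ((x - m) ^+ 2)%:E)%E.
  move=> QE; have -> : (\int[Q]_x ((x - m) ^+ 2)%:E = \int[N mX]_x ((x - m) ^+ 2)%:E)%E.
    by apply: eq_measure_integral => A mA _; rewrite -QE.
  rewrite ge0_integral_pushforward//; last 2 first.
  - exact/measurable_EFinP.
  - by move=> x _; rewrite lee_fin sqr_ge0.
  rewrite preimage_setT.
  have iX' := integrableRZl (2 * m) measurableT iX.
  have i1 := integrableRB measurableT iX2 iX'.
  have ic : P.-integrable setT (EFin \o (fun=> m ^+ 2)).
    exact: finite_measure_integrable_cst.
  have i2 : P.-integrable setT (EFin \o (fun w => (X w - m) ^+ 2)).
    have := integrableD measurableT i1 ic; apply: eq_integrable => // w _ /=.
    by rewrite -EFinD; congr EFin; ring.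
  have : \int[P]_w (X w ^+ 2 - 2 * m * X w) <= \int[P]_w ((X w - m) ^+ 2).
    apply: le_Rintegral => // w _; rewrite -subr_ge0.
    by rewrite (_ : _ - _ = m ^+ 2) ?sqr_ge0//; ring.
  rewrite (RintegralB measurableT iX2 iX') (RintegralZl _ measurableT iX) X0 X1.
  rewrite mulr0 subr0 -lee_fin => /le_trans; apply.
  by rewrite /Rintegral fineK//; exact: integrable_fin_num.
have [s00|s00] := eqVneq s 0.
  have lawd (A : set MR) : measurable A -> P (X @^-1` A) = \d_(m : MR) A.
    by move=> mA; rewrite law// s00 eqxx.
  exfalso; have := ge1 _ lawd.
  rewrite integral_dirac//=; last exact/measurable_EFinP.
  by rewrite diracT mul1e subrr expr0n lee_fin ler10.
have lawn (A : set MR) : measurable A -> P (X @^-1` A) = normal_prob m s A.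
  by move=> mA; rewrite law// (negbTE s00).
have := le_trans (ge1 _ lawn) (normal_second_moment_le m s00).
rewrite lee_fin => s8.
have mE : measurable (`[a, b] : set MR) by exact: measurable_itv.
rewrite (_ : [set w | _] = X @^-1` `[a, b]); last first.
  by apply/seteqP; split=> w /=; rewrite in_itv.
rewrite law// (negbTE s00) /normal_prob.
apply: (@le_trans _ _ (\int[mu]_(x in `[a, b]) 2%:E)%E).
  apply: ge0_le_integral => //.
  - by move=> x _; rewrite lee_fin normal_pdf_ge0.
  - by apply/measurable_EFinP; apply: measurable_funTS; exact: measurable_normal_pdf.
  - move=> x _; rewrite lee_fin; apply: (le_trans (normal_pdf_ub _ _ s00)).
    (* From [8 s^2 >= 1] and [pi >= 2] one gets [2 pi s^2 >= 1/2], more than the 1/4 needed for a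
       peak of at most 2. *)
    rewrite /normal_peak -[leRHS]invrK lef_pV2 ?posrE ?invr_gt0//.
      rewrite -[leLHS]ger0_norm// -sqrtr_sqr ler_sqrt.
        have := pi_ge2 R; nra.
      by rewrite mulrn_wge0// mulr_ge0 ?sqr_ge0 ?pi_ge0.
    by rewrite sqrtr_gt0 mulrn_wgt0// mulr_gt0 ?pi_gt0// exprn_even_gt0.
have -> : (\int[mu]_(x in `[a, b]) 2%:E = 2%:E * mu (`[a, b]%classic : set MR))%E.
  exact: integral_cst.
rewrite lebesgue_measure_itv/= lte_fin; case: ifP => _.
  by rewrite -EFinB -EFinM lee_fin.
by rewrite mule0 lee_fin mulr_ge0// subr_ge0.
Qed.

End normal.

(** * Immediate exits above the starting level *)

Section stays_below.
Context (R : realType).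
Implicit Types (g : R -> R) (a b e : R).

Definition stays_below g a b e := forall s, a <= s < b -> g s - g a <= e.

Lemma within_continuous_near g x e : {within `[0, 1], continuous g} ->
  0 <= x <= 1 -> 0 < e ->
  exists2 r, 0 < r & forall y, 0 <= y <= 1 -> `|x - y| < r -> `|g x - g y| < e.
Proof.
move=> /subspace_continuousP cg x01 e0.
have /cg/cvgrPdist_lt/(_ e e0) : `[0, 1]%classic x by rewrite /= in_itv.
rewrite near_withinE => -[r /= r0 h]; exists r => // y y01 xy.
by apply: h => //; rewrite /= in_itv.
Qed.

(** By continuity a violation at [s] persists at rationals slightly to the right of [s], and these
    remain in the interval because it is open at [b]. *)
Lemma stays_below_rat g a b e : {within `[0, 1], continuous g} -> 0 <= a -> b <= 1 ->
  stays_below g a b e <->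
  forall q : rat, a <= ratr q < b -> g (ratr q) - g a <= e.
Proof.
move=> cg a0 b1; split=> [h q|h s /andP[as_ sb]]; first exact: h.
rewrite leNgt; apply/negP => gs.
have s01 : 0 <= s <= 1 by rewrite (le_trans a0)//= (le_trans (ltW sb)).
have [|r r0 hr] := within_continuous_near (e := g s - g a - e) cg s01.
  by rewrite subr_gt0.
have smin : s < Num.min b (s + r) by rewrite lt_min sb ltrDl.
have [q] := rat_in_itvoo smin.
rewrite in_itv/= lt_min => /andP[sq /andP[qb qr]].
have := h q; rewrite qb (le_trans as_ (ltW sq)) => /(_ isT) gq.
have q01 : 0 <= (ratr q : R) <= 1.
  by rewrite (le_trans a0 (le_trans as_ (ltW sq)))/= (le_trans (ltW qb)).
have := hr _ q01; rewrite distrC gtr0_norm ?subr_gt0// ltrBlDl => /(_ qr).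
by have := ler_norm (g s - g (ratr q)); lra.
Qed.

(** A countable intersection over rational times. Measurability is asked only at times in [[a, b[],
    so the lemma also serves for the sigma-algebras of the filtration. *)
Lemma measurable_stays_below d (T : measurableType d) (X : R -> T -> R) a b e :
  0 <= a -> b <= 1 -> (forall s, a <= s < b -> measurable_fun setT (X s)) ->
  (forall w, {within `[0, 1], continuous (X ^~ w)}) ->
  measurable [set w | stays_below (X ^~ w) a b e].
Proof.
move=> a0 b1 mX cX; have [ab|ba] := ltP a b; last first.
  rewrite (_ : [set w | _] = setT)//; apply/seteqP; split=> // w _ s /andP[h1 h2].
  by move: ba; rewrite leNgt (le_lt_trans h1 h2).
rewrite (_ : [set w | _] = \bigcap_(q : rat)
   [set w | a <= ratr q < b -> X (ratr q) w - X a w <= e]); last first.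
  apply/seteqP; split=> w.
    by move=> /(stays_below_rat _ (cX w) a0 b1) h q _; exact: h.
  by move=> h; apply/(stays_below_rat _ (cX w) a0 b1) => q; exact: h.
rewrite -[X in measurable X]setCK setC_bigcap; apply: measurableC.
apply: bigcupT_measurable_rat => q; apply: measurableC.
have [qab|nq] := boolP (a <= ratr q < b); last first.
  by rewrite (_ : [set w | _] = setT)//; apply/seteqP; split.
rewrite (_ : [set w | _] = (fun w => X (ratr q) w - X a w) @^-1` `]-oo, e]); last first.
  by apply/seteqP; split=> w /=; rewrite in_itv/=; [apply|move=> h _].
rewrite -[X in measurable X]setTI; apply: measurable_funB => //; apply: mX => //.
by rewrite lexx.
Qed.

End stays_below.

(** * Decorrelation of increments at different scales *)

Section correlation.
Context (R : realType).

(** By scaling, the correlation is [r^H / 2 + (1 - (1 - r)^(2 H)) / (2 r^H)]. As [2 H <= 2], one has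
    [(1 - r)^(2 H) >= (1 - r)^2 >= 1 - 2 r], so the second term is at most [r^(1 - H)]. *)
Lemma fbm_correlation_le (H h r th : R) : 2^-1 < H -> H < 1 -> 0 < h ->
  0 < r -> r <= th -> th < 1 ->
  2^-1 * (h `^ (2 * H) + (r * h) `^ (2 * H) - `|h - r * h| `^ (2 * H)) /
    (h `^ H * (r * h) `^ H) <= th `^ H + th `^ (1 - H).
Proof.
move=> H0 H1 h0 r0 rth th1.
have r1 : r < 1 by exact: le_lt_trans th1.
have hh : h `^ (2 * H) = h `^ H * h `^ H.
  by rewrite -powRD ?(gt_eqF h0) ?implybT//; congr powR; ring.
have rr : r `^ (2 * H) = r `^ H * r `^ H.
  by rewrite -powRD ?(gt_eqF r0) ?implybT//; congr powR; ring.
have -> : `|h - r * h| = (1 - r) * h.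
  by rewrite ger0_norm; [ring|rewrite subr_ge0 ger_pMl ?ltW].
have [h0' r0'] := (ltW h0, ltW r0); have r1' : 0 <= 1 - r by lra.
rewrite !powRM// hh rr.
have hH : 0 < h `^ H by exact: powR_gt0.
have rH : 0 < r `^ H by exact: powR_gt0.
have r1H : 1 - 2 * r <= (1 - r) `^ (2 * H).
  apply: (@le_trans _ _ ((1 - r) `^ 2)).
    by rewrite (@powR_mulrn _ _ 2); nra.
  by apply: ger_powR; rewrite ?subr_gt0 ?r1 ?gerBl ?ltW//; lra.
have -> : 2^-1 * (h `^ H * h `^ H + r `^ H * r `^ H * (h `^ H * h `^ H) -
     (1 - r) `^ (2 * H) * (h `^ H * h `^ H)) / (h `^ H * (r `^ H * h `^ H)) =
   2^-1 * r `^ H + 2^-1 * (1 - (1 - r) `^ (2 * H)) / r `^ H.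
  by field; rewrite !gt_eqF.
have rr1 : r = r `^ (1 - H) * r `^ H.
  by rewrite -powRD ?(gt_eqF r0) ?implybT// subrK powRr1// ltW.
apply: (@le_trans _ _ (r `^ H + r `^ (1 - H))).
  apply: lerD; first by rewrite ger_pMl ?invf_le1 ?ler1n.
  rewrite ler_pdivrMr// -rr1; lra.
by apply: lerD; apply: ge0_ler_powR; rewrite ?nnegrE; lra.
Qed.

Lemma small_powR (H e : R) : 0 < H < 1 -> 0 < e ->
  exists2 th, 0 < th < 1 & th `^ H + th `^ (1 - H) <= e.
Proof.
move=> /andP[H0 H1] e0; have H10 : 0 < 1 - H by rewrite subr_gt0.
have /cvgrPdist_le/(_ (e / 2)) := powR_cvg0 H0; rewrite divr_gt0// => /(_ isT) c1.
have /cvgrPdist_le/(_ (e / 2)) := powR_cvg0 H10; rewrite divr_gt0// => /(_ isT) c2.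
near (0 : R)^'+ => th; exists th.
  by apply/andP; split; near: th; [exact: nbhs_right_gt|exact: nbhs_right_lt].
rewrite (splitr e); apply: lerD.
  rewrite -[leLHS]ger0_norm ?powR_ge0// -normrN -sub0r; by near: th.
rewrite -[leLHS]ger0_norm ?powR_ge0// -normrN -sub0r; by near: th.
Unshelve. all: by end_near. Qed.

End correlation.

Lemma Rintegral_sum d (T : measurableType d) (R : realType)
    (m : {measure set T -> \bar R}) (D : set T) (I : Type) (r : seq I) (f : I -> T -> R) :
  measurable D -> (forall i, m.-integrable D (EFin \o f i)) ->
  m.-integrable D (EFin \o (fun x => \sum_(i <- r) f i x)) /\
  \int[m]_(x in D) (\sum_(i <- r) f i x) = \sum_(i <- r) \int[m]_(x in D) f i x.
Proof.
move=> mD fi; elim: r => [|i r [ir er]].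
  rewrite (_ : (fun x => _) = cst 0); last by apply/funext => x; rewrite big_nil.
  split; first exact: (integrable0 m).
  by rewrite Rintegral_cst// mul0r big_nil.
have E : (fun x => \sum_(j <- i :: r) f j x) = (fun x => f i x + \sum_(j <- r) f j x).
  by apply/funext => x; rewrite big_cons.
rewrite E big_cons -er; split.
  by have := integrableD mD (fi i) ir; apply: eq_integrable.
exact: RintegralD mD (fi i) ir.
Qed.

Section hitting.
Context d (T : measurableType d) (R : realType) (P : probability T R)
  (F : R -> set (set T)) (H : R) (B : R -> T -> R).
Hypothesis FF : complete_left_continuous_filtration P F.
Hypothesis H_gt : 2^-1 < H.
Hypothesis H_lt : H < 1.
Hypothesis BF : fractional_brownian_motion P F H B.
Implicit Types (s t p q a b : R).

Lemma gaussian_increment t p c : 0 <= t <= 1 -> 0 <= p <= 1 ->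
  gaussian_variable P (fun w => (B p w - B t w) * c).
Proof.
move=> t01 p01.
pose tt (i : 'I_2) := if i == ord0 then p else t.
pose aa (i : 'I_2) := if i == ord0 then c else - c.
have := @fbm_gaussian _ _ _ _ _ _ _ BF 2 tt aa.
rewrite (_ : (fun w => \sum_(i < 2) _) = (fun w => (B p w - B t w) * c)); last first.
  by apply/funext => w; rewrite !big_ord_recl big_ord0 /tt /aa /=; ring.
by apply; move=> i; rewrite /tt; case: ifP.
Qed.

Lemma normalized_increment t h : 0 <= t -> t + h <= 1 -> 0 < h ->
  let X w := (B (t + h) w - B t w) * (h `^ H)^-1 in
  [/\ gaussian_variable P X, P.-integrable setT (EFin \o X), \int[P]_w X w = 0,
      P.-integrable setT (EFin \o (fun w => X w ^+ 2)) & \int[P]_w X w ^+ 2 = 1].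
Proof.
move: H_gt H_lt => H0 H1 t0 th1 h0 X.
have t01 : 0 <= t <= 1 by apply/andP; split; lra.
have p01 : 0 <= t + h <= 1 by apply/andP; split; lra.
have HH : 0 < H by lra.
have [i1 e1] := fbm_increment_mean FF BF t01 p01.
have [i2 e2] := fbm_increments FF HH BF t01 p01 p01.
have hH : h `^ H != 0 by rewrite gt_eqF// powR_gt0.
have XE : X = fun w => (h `^ H)^-1 * (B (t + h) w - B t w).
  by apply/funext => w; rewrite /X mulrC.
have X2E : (fun w => X w ^+ 2) = fun w =>
    (h `^ H)^-1 ^+ 2 * ((B (t + h) w - B t w) * (B (t + h) w - B t w)).
  by apply/funext => w; rewrite /X; ring.
split.
- exact: gaussian_increment.
- by rewrite XE; exact: integrableRZl.
- by rewrite XE RintegralZl// e1 mulr0.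
- by rewrite X2E; exact: integrableRZl.
- rewrite X2E RintegralZl// e2 subrr normr0 powR0; last by rewrite mulf_neq0// gt_eqF.
  have -> : t + h - t = h by ring.
  rewrite gtr0_norm//.
  have -> : h `^ (2 * H) = h `^ H * h `^ H.
    by rewrite -powRD ?(gt_eqF h0) ?implybT//; congr powR; ring.
  by field.
Qed.

(* Normalized increments over the lengths [L * th ^ j] are almost uncorrelated for
   small [th], so their average over [m] of them has second moment at most
   [2 / m]. On the event in question they are all nonpositive, and by the density
   bound typically below [- dl], which bounds that average away from 0. *)
Lemma stays_below_null t b : 0 <= t -> t < b -> b <= 1 ->
  P [set w | stays_below (B ^~ w) t b 0] = 0%E.
Proof.
move: H_gt H_lt => H0 H1 t0 tb b1.
set A := [set w | _].
have mA : measurable A.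
  apply: measurable_stays_below => //; last exact: fbm_continuous BF.
  move=> s /andP[ts sb]; apply: (measurable_fbm FF BF).
  by rewrite (le_trans t0 ts) (le_trans (ltW sb)).
have Afin : P A \is a fin_num by exact: fin_num_measure.
pose p := fine (P A).
apply/eqP/negPn/negP => PA0.
have p0 : 0 < p by rewrite fine_gt0// lt0e PA0 measure_ge0 /= ltey_eq Afin.
have PA : P A = p%:E by rewrite fineK.
(* The density bound gives [P (|X j| <= dl) <= 4 dl = p / 2], so [X j] avoids [[- dl, dl]] on at
   least half of [A]. *)
pose dl := p / 8; have dl0 : 0 < dl by rewrite divr_gt0.
(* On [A] the average of the [- X j] contributes at least [dl * p / 2]. With this [ep] and [m] the
   upper bound [ep / 2 + 1 / (m * ep)] falls strictly below it. *)
pose ep := dl * p / 2; have ep0 : 0 < ep by rewrite divr_gt0// mulr_gt0.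
pose m := (Num.truncn (2 / (dl * p / 4) / ep)).+1.
have m0 : 0 < m%:R :> R by [].
have mbig : 1 / (m%:R * ep) < dl * p / 4.
  have k0 : 0 < dl * p / 4 by rewrite divr_gt0// mulr_gt0.
  have h : 2 / (dl * p / 4) / ep < m%:R by exact: truncnS_gt.
  rewrite ltr_pdivrMr ?mulr_gt0//.
  move: h; rewrite ltr_pdivrMr// ltr_pdivrMr//; nra.
have H01 : 0 < H < 1 by rewrite H1 andbT; lra.
have mV0 : 0 < (m%:R)^-1 :> R by rewrite invr_gt0.
(* Correlations of at most [1 / m] keep the sum of all [m^2] products at most [2 m] in mean, whence
   the second moment [2 / m] of the average. *)
have [th /andP[th0 th1] thm] := small_powR H01 mV0.
pose L := b - t; have L0 : 0 < L by rewrite subr_gt0.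
(* The power [j.+1] gives [h j < L], so that [t + h j] lies strictly before [b]. *)
pose h (j : nat) : R := L * th ^+ j.+1.
have h0 j : 0 < h j by rewrite mulr_gt0// exprn_gt0.
have hL j : h j < L by rewrite gtr_pMr// exprn_ilt1// ltW.
pose X (j : nat) w := (B (t + h j) w - B t w) * ((h j) `^ H)^-1.
have tb1 j : t + h j <= 1 by have := hL j; rewrite /L => ?; lra.
have XP j := normalized_increment t0 (tb1 j) (h0 j).
have t01 : 0 <= t <= 1 by rewrite t0/=; lra.
have tj01 j : 0 <= t + h j <= 1 by rewrite tb1 andbT addr_ge0// ltW.
have XXi i j : P.-integrable setT (EFin \o (fun w => X i w * X j w)).
  have HH : 0 < H by lra.
  have [ii _] := fbm_increments FF HH BF t01 (tj01 i) (tj01 j).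
  have := integrableRZl (((h i) `^ H)^-1 * ((h j) `^ H)^-1) measurableT ii.
  by apply: eq_integrable => // w _ /=; congr EFin; rewrite /X; ring.
have XXE i j : \int[P]_w (X i w * X j w) =
    2^-1 * (h i `^ (2 * H) + h j `^ (2 * H) - `|h i - h j| `^ (2 * H)) / (h i `^ H * h j `^ H).
  have HH : 0 < H by lra.
  have [ii ee] := fbm_increments FF HH BF t01 (tj01 i) (tj01 j).
  transitivity (\int[P]_w ((h i `^ H * h j `^ H)^-1 *
      ((B (t + h i) w - B t w) * (B (t + h j) w - B t w)))).
    by apply: eq_Rintegral => w _; rewrite /X invfM; ring.
  rewrite RintegralZl// ee mulrC; congr (_ * _ / _).
  have -> : t + h i - t = h i by ring.
  have -> : t + h j - t = h j by ring.
  have -> : t + h i - (t + h j) = h i - h j by ring.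
  by rewrite (gtr0_norm (h0 i)) (gtr0_norm (h0 j)).
have XXlt i j : (i < j)%N -> \int[P]_w (X i w * X j w) <= m%:R^-1.
  move=> ij; rewrite XXE; apply: le_trans thm.
  have -> : h j = th ^+ (j - i) * h i.
    by rewrite /h mulrCA -exprD addnS subnK// ltnW.
  apply: fbm_correlation_le => //; first exact: exprn_gt0.
  rewrite -[leRHS]expr1; apply: ler_wiXn2l; rewrite ?subn_gt0 ?ltW//.
have XXle i j : \int[P]_w (X i w * X j w) <= (i == j)%:R + m%:R^-1.
  have [<-|ij] := eqVneq i j.
    have [_ _ _ _] := XP i; rewrite -/(X i) => e.
    have -> : \int[P]_w (X i w * X i w) = 1 by rewrite -e; apply: eq_Rintegral => w _; rewrite expr2.
    by rewrite lerDl ltW.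
  rewrite add0r; move: ij; rewrite neq_ltn => /orP[/XXlt//|/XXlt].
  by under eq_Rintegral do rewrite mulrC.
pose Z w := m%:R^-1 * \sum_(j < m) X j w.
have Z2E : (fun w => Z w ^+ 2) = (fun w => m%:R^-1 ^+ 2 * \sum_(i < m) \sum_(j < m) (X i w * X j w)).
  apply/funext => w; rewrite /Z exprMn; congr (_ * _).
  by rewrite expr2 mulr_suml; apply: eq_bigr => i _; rewrite mulr_sumr.
have iin i := Rintegral_sum (index_enum 'I_m) measurableT (fun j : 'I_m => XXi i j).
have [iout eout] := Rintegral_sum (index_enum 'I_m) measurableT (fun i : 'I_m => (iin i).1).
have iZ2 : P.-integrable setT (EFin \o (fun w => Z w ^+ 2)).
  by rewrite Z2E; exact: integrableRZl.
have EZ2 : \int[P]_w (Z w ^+ 2) <= 2 / m%:R.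
  rewrite Z2E RintegralZl// eout.
  under eq_bigr do rewrite (iin _).2.
  apply: (@le_trans _ _ (m%:R^-1 ^+ 2 * \sum_(i < m) \sum_(j < m) ((i == j)%:R + m%:R^-1))).
    rewrite ler_wpM2l ?sqr_ge0//; apply: ler_sum => i _; apply: ler_sum => j _.
    exact: XXle.
  have -> : \sum_(i < m) \sum_(j < m) ((i == j)%:R + m%:R^-1) = 2 * m%:R :> R.
    transitivity (\sum_(i < m) (2 : R)); last by rewrite sumr_const card_ord mulr_natr.
    apply: eq_bigr => i _; rewrite big_split/= sumr_const card_ord -[_ *+ m]mulr_natr mulVf ?gt_eqF//.
    rewrite (bigD1 i)//= eqxx big1 ?addr0// => j ji.
    by rewrite eq_sym (negbTE ji).
  by rewrite (_ : _ * _ = 2 / m%:R)//; field; rewrite gt_eqF.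
pose N j := [set w | `|X j w| <= dl].
have mX j : measurable_fun setT (X j) by have [[]] := XP j.
have mN j : measurable (N j).
  rewrite (_ : N j = (fun w => `|X j w|) @^-1` `]-oo, dl]); last first.
    by apply/seteqP; split=> w; rewrite /N/= in_itv.
  by rewrite -[X in measurable X]setTI; apply: measurableT_comp.
have PN j : fine (P (A `\` N j)) >= p / 2.
  have fD : P (A `\` N j) \is a fin_num by apply: fin_num_measure; exact: measurableD.
  have e : P A = (P (A `\` N j) + P (A `&` N j))%E by exact: measureDI.
  have [g1 g2 g3 g4 g5] := XP j.
  have dlN : - dl <= dl by lra.
  have := gaussian_interval_le g1 g2 g3 g4 g5 dlN.
  rewrite (_ : [set w | _] = N j); last first.
    by apply/seteqP; split=> w; rewrite /N/= ler_norml.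
  rewrite (_ : 2 * (dl - - dl) = 4 * dl); last by ring.
  move=> h1; have h2 : (P (A `&` N j) <= (4 * dl)%:E)%E.
    by apply: le_trans h1; apply: le_measure; rewrite ?inE//; exact: measurableI.
  have : (p%:E <= P (A `\` N j) + (4 * dl)%:E)%E by rewrite -PA e; exact: leeD2l.
  by rewrite -(fineK fD) -EFinD lee_fin /dl; lra.
pose ind j w : R := \1_(A `\` N j) w.
have iind j : P.-integrable setT (EFin \o ind j).
  by apply: integrable_indic => //; exact: measurableD.
have eind j : \int[P]_w ind j w = fine (P (A `\` N j)).
  by rewrite /Rintegral /ind integral_indic ?setIT//; exact: measurableD.
have [isum esum] := Rintegral_sum (index_enum 'I_m) measurableT (fun j : 'I_m => iind j).
have il := integrableRZl (dl * m%:R^-1) measurableT isum.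
have ic : P.-integrable setT (EFin \o (fun=> ep / 2)) by exact: finite_measure_integrable_cst.
have iz := integrableRZl ((2 * ep)^-1) measurableT iZ2.
have ir : P.-integrable setT (EFin \o (fun w => ep / 2 + (2 * ep)^-1 * Z w ^+ 2)).
  by have := integrableD measurableT ic iz; apply: eq_integrable.
have c2 : 0 <= (2 * ep)^-1 by rewrite invr_ge0; lra.
have main : \int[P]_w (dl * m%:R^-1 * \sum_(j < m) ind j w) <=
    \int[P]_w (ep / 2 + (2 * ep)^-1 * Z w ^+ 2).
  apply: le_Rintegral => // w _.
  (* This inequality replaces Cauchy-Schwarz. Its right side is nonnegative, so it also covers the
     complement of [A], where the left side of [main] is 0. *)
  have amgm : - Z w <= ep / 2 + (2 * ep)^-1 * Z w ^+ 2.
    rewrite -subr_ge0 (_ : _ - _ = (2 * ep)^-1 * (Z w + ep) ^+ 2).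
      by rewrite mulr_ge0 ?sqr_ge0.
    by field; rewrite gt_eqF.
  have [Aw|nAw] := pselect (A w); last first.
    rewrite big1 ?mulr0; last first.
      by move=> j _; rewrite /ind indicE memNset//= => -[].
    by apply: addr_ge0; [lra|rewrite mulr_ge0 ?sqr_ge0].
  apply: le_trans amgm.
  rewrite /Z -mulrN -sumrN [leLHS]mulrAC [leLHS]mulrC.
  apply: ler_wpM2l; first exact: ltW.
  rewrite mulr_sumr; apply: ler_sum => j _.
  have Xneg : X j w <= 0.
    rewrite /X mulr_le0_ge0 ?invr_ge0 ?powR_ge0//; apply: Aw.
    by have := hL j; have := h0 j; rewrite /L => ? ?; apply/andP; split; lra.
  rewrite /ind indicE; case: (boolP (_ \in _)) => [|_]; last by rewrite mulr0 oppr_ge0.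
  rewrite inE => -[_ /negP]; rewrite -ltNge ler0_norm// mulr1 => /ltW h'.
  exact: h'.
move: main; rewrite RintegralZl// esum (RintegralD measurableT ic iz) (RintegralZl _ measurableT iZ2).
have Ec : \int[P]_w (ep / 2) = ep / 2.
  rewrite Rintegral_cst//; transitivity (ep / 2 * 1); last by rewrite mulr1.
  congr (_ * _); exact: (congr1 fine (probability_setT P)).
rewrite Ec.
under eq_bigr do rewrite eind.
have sumge : m%:R * (p / 2) <= \sum_(i < m) fine (P (A `\` N i)).
  rewrite mulrC mulr_natr -[m in _ *+ m]card_ord -sumr_const.
  by apply: ler_sum => i _; exact: PN.
apply/negP; rewrite -ltNge.
apply: (@lt_le_trans _ _ (dl * p / 2)); last first.
  rewrite (_ : dl * p / 2 = dl * m%:R^-1 * (m%:R * (p / 2))); last by field; rewrite gt_eqF.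
  by rewrite ler_wpM2l// mulr_ge0// ?invr_ge0 ltW.
have : (2 * ep)^-1 * \int[P]_x Z x ^+ 2 <= 1 / (m%:R * ep).
  rewrite (_ : 1 / (m%:R * ep) = (2 * ep)^-1 * (2 / m%:R)).
    by rewrite ler_wpM2l.
  by field; rewrite !gt_eqF.
by have : ep = dl * p / 2 by []; move: mbig; lra.
Qed.

End hitting.

(** * Almost sure end of the game *)

Section exit.
Context d (T : measurableType d) (R : realType) (P : probability T R)
  (F : R -> set (set T)) (H : R) (B : R -> T -> R).
Hypothesis FF : complete_left_continuous_filtration P F.
Hypothesis H_gt : 2^-1 < H.
Hypothesis H_lt : H < 1.
Hypothesis BF : fractional_brownian_motion P F H B.

Lemma measurable_fbm_stays_below a b e : 0 <= a -> b <= 1 ->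
  measurable [set w | stays_below (B ^~ w) a b e].
Proof.
move=> a0 b1; apply: measurable_stays_below => //; last exact: fbm_continuous BF.
move=> s /andP[ts sb]; apply: (measurable_fbm FF BF).
by rewrite (le_trans a0 ts) (le_trans (ltW sb)).
Qed.

(** The events with levels [1 / (n+1)] decrease to the null event of level 0; continuity from above
    concludes. *)
Lemma stays_below_small a b r : 0 <= a -> a < b -> b <= 1 -> 0 < r ->
  exists2 e, 0 < e & (P [set w | stays_below (B ^~ w) a b e] <= r%:E)%E.
Proof.
move=> a0 ab b1 r0; pose A n := [set w | stays_below (B ^~ w) a b n.+1%:R^-1].
have mA n : measurable (A n) by exact: measurable_fbm_stays_below.
have AE : \bigcap_n A n = [set w | stays_below (B ^~ w) a b 0].
  apply/seteqP; split=> w h.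
    move=> s sab; apply/ler_addgt0Pr => e e0; rewrite add0r.
    have [n ne] : exists n, n.+1%:R^-1 < e.
      exists (Num.truncn e^-1); rewrite -[ltRHS]invrK ltf_pV2 ?posrE ?invr_gt0//.
      exact: truncnS_gt.
    by apply: le_trans (ltW ne); exact: h.
  by move=> n _ s sab; apply: le_trans (h s sab) _; rewrite invr_ge0.
have /fine_cvgP[_] : P \o A @ \oo --> 0%E.
  rewrite -(stays_below_null FF H_gt H_lt BF a0 ab b1) -AE.
  apply: nonincreasing_cvg_mu => //.
  - by apply: (le_lt_trans (probability_le1 _ (mA 0%N))); rewrite ltry.
  - by rewrite AE; exact: measurable_fbm_stays_below.
  - move=> m n mn; apply/subsetPset => w h s sab; apply: le_trans (h s sab) _.
    by rewrite lef_pV2 ?posrE// ler_nat.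
move=> /cvgrPdist_le/(_ r r0)[n _ /(_ n (leqnn _))].
rewrite sub0r normrN ger0_norm ?fine_ge0// => h.
exists n.+1%:R^-1; first by rewrite invr_gt0.
have fA : P (A n) \is a fin_num by exact: fin_num_measure.
by rewrite -/(A n) -(fineK fA) lee_fin.
Qed.

(** Independence of the rounds is not at issue: the event that all fail is contained in each failure
    event, so its probability is at most every [1 / (n+1)]. *)
Lemma ae_exit (t : nat -> R) : (forall n, 0 <= t n) -> (forall n, t n < t n.+1) ->
    (forall n, t n <= 1) ->
  exists e : nat -> R, (forall n, 0 < e n) /\
    {ae P, forall w, exists n, ~ stays_below (B ^~ w) (t n) (t n.+1) (e n)}.
Proof.
move=> t0 tt t1.
have /choice[e he] : forall n, exists e, 0 < e /\
    (P [set w | stays_below (B ^~ w) (t n) (t n.+1) e] <= (n.+1%:R^-1)%:E)%E.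
  move=> n; have [|e e0 h] := stays_below_small (t0 n) (tt n) (t1 n.+1) (r := n.+1%:R^-1).
    by rewrite invr_gt0.
  by exists e.
exists e; split; first by move=> n; have [] := he n.
pose A n := [set w | stays_below (B ^~ w) (t n) (t n.+1) (e n)].
have mA n : measurable (A n) by exact: measurable_fbm_stays_below.
have mI : measurable (\bigcap_n A n) by exact: bigcapT_measurable.
exists (\bigcap_n A n); split => //.
  apply/eqP; rewrite eq_le measure_ge0 andbT.
  apply/lee_addgt0Pr => r r0; rewrite add0e.
  have [n nr] : exists n, n.+1%:R^-1 < r.
    exists (Num.truncn r^-1); rewrite -[ltRHS]invrK ltf_pV2 ?posrE ?invr_gt0//.
    exact: truncnS_gt.
  apply: (@le_trans _ _ (n.+1%:R^-1)%:E); last by rewrite lee_fin ltW.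
  apply: le_trans (he n).2; apply: le_measure; rewrite ?inE//; first exact: mA.
  by move=> w /(_ n I).
by move=> w /= h n _; apply: contrapT => nh; apply: h; exists n.
Qed.

End exit.

(** [s] is the infimum of the times at which the rise strictly exceeds [e], or [b] if there are
    none. Continuity makes the rise at this infimum exactly [e], and [e > 0] keeps it away from [a].
    The equivalence says that the position is held exactly on []a, s]]. *)
Lemma first_passage (R : realType) (g : R -> R) (a b e : R) :
  {within `[0, 1], continuous g} -> 0 <= a -> a < b -> b <= 1 -> 0 < e ->
  exists s, [/\ a <= s <= b,
    forall t, a < t <= b -> stays_below g a t e <-> t <= s,
    stays_below g a b e -> s = b &
    ~ stays_below g a b e -> a < s < b /\ g s - g a = e].
Proof.
move=> cg a0 ab b1 e0; have [hb|nb] := pselect (stays_below g a b e).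
  exists b; split=> //; first by rewrite lexx ltW.
  move=> t /andP[_ tb]; split=> // _ s /andP[as_ st].
  by apply: hb; rewrite as_ (lt_le_trans st).
pose S := [set s | a <= s < b /\ e < g s - g a].
have S0 : S !=set0.
  apply: contrapT => S0; apply: nb => s sab; rewrite leNgt; apply/negP => es.
  by apply: S0; exists s.
have lS : lbound S a by move=> s [/andP[]].
have hS : has_lbound S by exists a.
have aS : a <= inf S by exact: lb_le_inf.
have Sb : inf S < b.
  have [s Ss] := S0; apply: le_lt_trans (ge_inf hS Ss) _.
  by have [/andP[]] := Ss.
have i01 : 0 <= inf S <= 1 by rewrite (le_trans a0 aS) (ltW (lt_le_trans Sb b1)).
have below s : a <= s < inf S -> g s - g a <= e.
  move=> /andP[as_ si]; rewrite leNgt; apply/negP => es.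
  have : inf S <= s by apply: (ge_inf hS); split=> //; rewrite as_ (lt_trans si).
  by rewrite leNgt si.
have ge : e <= g (inf S) - g a.
  rewrite leNgt; apply/negP => lt.
  have [|r r0 hr] := within_continuous_near (e := e - (g (inf S) - g a)) cg i01.
    by rewrite subr_gt0.
  have [|s [/andP[as_ sb] es] si] := inf_lt (x := inf S + r) S0; first by rewrite ltrDl.
  have is_ : inf S <= s by apply: (ge_inf hS); split=> //; rewrite as_.
  have s01 : 0 <= s <= 1 by rewrite (le_trans a0 as_) (ltW (lt_le_trans sb b1)).
  have := hr _ s01; rewrite distrC ger0_norm ?subr_ge0// ltrBlDl => /(_ si).
  by rewrite distrC; have := ler_norm (g s - g (inf S)); lra.
have ai : a < inf S.
  rewrite lt_neqAle aS andbT; apply/negP => /eqP ai.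
  by move: ge; rewrite -ai subrr leNgt e0.
have le : g (inf S) - g a <= e.
  rewrite leNgt; apply/negP => lt.
  have [|r r0 hr] := within_continuous_near (e := g (inf S) - g a - e) cg i01.
    by rewrite subr_gt0.
  have mx : Num.max a (inf S - r) < inf S by rewrite gt_max ai/= gtrBl.
  have [/= m1 m2] := midf_lt mx; set s := (_ + _) / 2 in m1 m2.
  move: m1; rewrite gt_max => /andP[as_ rs].
  have s01 : 0 <= s <= 1.
    by rewrite (le_trans a0 (ltW as_)) (ltW (lt_le_trans (lt_trans m2 Sb) b1)).
  have := hr _ s01; rewrite gtr0_norm ?subr_gt0// ltrBlDl -ltrBlDr => /(_ rs).
  by have := below s; rewrite (ltW as_) m2 => /(_ isT); have := ler_norm (g (inf S) - g s); lra.
exists (inf S); split=> //.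
- by rewrite aS ltW.
- move=> t /andP[at_ tb]; split=> [ht|ti s /andP[as_ st]].
    rewrite leNgt; apply/negP => it.
    have [s [/andP[as_ sb] es] st] := inf_lt S0 it.
    by have := ht s; rewrite as_ st => /(_ isT); rewrite leNgt es.
  by apply: below; rewrite as_ (lt_le_trans st).
- by move=> _; split; [rewrite ai|apply/eqP; rewrite eq_le le].
Qed.

(** * The betting strategy *)

Section hedge.
Context (R : realType) (t e : nat -> R).
Implicit Types (g : R -> R) (x : R).

(* What remains to be won after [n] rounds for a total gain of 1; it drops to 0
   at the first round in which the level [e n] is passed. *)
Fixpoint wealth g n : R :=
  if n is m.+1 then
    if `[< stays_below g (t m) (t n) (e m) >] then
      wealth g m * (1 - (g (t n) - g (t m)) / e m)
    else 0
  else 1.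

Definition active g n x : bool :=
  (t n < x <= t n.+1) && `[< stays_below g (t n) x (e n) >].

(* If no interval contains [x], the index is the default 0 and [active] is
   false. *)
Definition hedge g x : R :=
  let n := xget 0%N [set n | t n < x <= t n.+1] in
  if active g n x then wealth g n / e n else 0.

Hypothesis t_gt0 : forall n, 0 < t n.
Hypothesis t_lt1 : forall n, t n < 1.
Hypothesis t_lt : forall n, t n < t n.+1.
Hypothesis e_gt0 : forall n, 0 < e n.

Let t_le m n : (m <= n)%N -> t m <= t n.
Proof. by move: m n; apply/nondecreasing_seqP => n; exact: ltW. Qed.

Lemma time_index_unique m n x : t m < x <= t m.+1 -> t n < x <= t n.+1 -> m = n.
Proof.
move=> /andP[mx xm] /andP[nx xn]; apply/eqP; rewrite eqn_leq; apply/andP; split.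
  rewrite leqNgt; apply/negP => /t_le nm.
  by move: (le_lt_trans nm mx); rewrite ltNge xn.
rewrite leqNgt; apply/negP => /t_le nm.
by move: (le_lt_trans nm nx); rewrite ltNge xm.
Qed.

(** The intervals []t n, t n.+1]] are disjoint, so at most one summand is nonzero, and an index
    beyond [N] carries no wealth. *)
Lemma hedgeE g x N : (forall n, (N <= n)%N -> wealth g n = 0) ->
  hedge g x = \sum_(n < N) wealth g n / e n * (active g n x)%:R.
Proof.
move=> w0; rewrite /hedge; case: xgetP => [n _ nx|nx]; last first.
  have nx' n : (t n < x <= t n.+1) = false by apply/negP; exact: nx.
  by rewrite [in LHS]/active nx'/= big1// => i _; rewrite /active nx'/= mulr0.
have a0 m : m != n -> active g m x = false.
  move=> mn; apply/negbTE/negP => /andP[mx _].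
  by move/eqP : mn; apply; exact: time_index_unique mx nx.
have [nN|Nn] := ltnP n N.
  rewrite (bigD1 (Ordinal nN))//= big1 ?addr0 => [|i iN]; last by rewrite a0 ?mulr0.
  by case: ifP => _; rewrite ?mulr1 ?mulr0.
rewrite w0// mul0r if_same big1// => i _.
by rewrite a0 ?mulr0// neq_ltn (leq_trans (ltn_ord i) Nn).
Qed.

Lemma wealth_exit g n : ~ stays_below g (t n) (t n.+1) (e n) ->
  forall m, (n < m)%N -> wealth g m = 0.
Proof.
move=> hn; elim=> // m IH; rewrite ltnS leq_eqVlt => /orP[/eqP <-|/IH h] /=.
  by case: asboolP.
by rewrite h mul0r if_same.
Qed.

(** Round [n] is a jump up at [t n] and a jump down at the passage time [u n]. Its gain
    [c n * (g (u n) - g (t n))] equals the loss of [wealth], and these losses telescope to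
    [1 - 0]. *)
Lemma hedge_step g : {within `[0, 1], continuous g} ->
  (exists n, ~ stays_below g (t n) (t n.+1) (e n)) ->
  exists s : seq (R * R), [/\ forall p, p \in s -> 0 < p.2 < 1,
    hedge g = step s & \sum_(p <- s) p.1 * (g 1 - g p.2) = 1].
Proof.
move=> cg [N hN].
have /choice[u hu] : forall n, exists u, [/\ t n <= u <= t n.+1,
    forall x, t n < x <= t n.+1 -> stays_below g (t n) x (e n) <-> x <= u,
    stays_below g (t n) (t n.+1) (e n) -> u = t n.+1 &
    ~ stays_below g (t n) (t n.+1) (e n) -> t n < u < t n.+1 /\ g u - g (t n) = e n].
  by move=> n; apply: first_passage => //; exact: ltW.
pose c n := wealth g n / e n.
(* Rounds up to and including [N] are listed, since [wealth] vanishes only from index [N.+1] on. *)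
exists ([seq (c n, t n) | n <- index_iota 0 N.+1] ++
        [seq (- c n, u n) | n <- index_iota 0 N.+1]); split.
- move=> p; rewrite mem_cat => /orP[] /mapP[n _ ->] /=; first by rewrite t_gt0 t_lt1.
  have [/andP[h1 h2] _ _ _] := hu n.
  by rewrite (lt_le_trans (t_gt0 n) h1) (le_lt_trans h2 (t_lt1 _)).
- apply/funext => x; rewrite (hedgeE x (wealth_exit hN)).
  rewrite /step big_cat !big_map/= !big_mkord -big_split/=; apply: eq_bigr => n _.
  rewrite -/(c n) mulNr -mulrBr; congr (_ * _).
  have [/andP[h1 h2] h3 _ _] := hu n.
  rewrite /active /after; have [tx|xt] := ltP (t n) x; last first.
    by rewrite (ltNge (u n)) (le_trans xt h1) subrr.
  have [xt|tx'] := leP x (t n.+1); last by rewrite (le_lt_trans h2 tx') subrr.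
  have h := h3 x; rewrite tx xt in h; have {}h := h isT.
  case: asboolP => /= [/h xu|nx]; first by rewrite ltNge xu subr0.
  by rewrite ltNge (introF idP (fun k => nx (h.2 k))) subrr.
- rewrite big_cat !big_map/= -big_split/=.
  transitivity (\sum_(0 <= n < N.+1) (wealth g n - wealth g n.+1)); last first.
    rewrite (@telescope_sumr_eq _ 0 N.+1 (fun n => - wealth g n))//; last first.
      by move=> k _; rewrite opprK addrC.
    by rewrite opprK (wealth_exit hN)// oppr0 add0r.
  apply: eq_bigr => n _; rewrite (_ : _ + _ = c n * (g (u n) - g (t n))); last by ring.
  have [_ _ h4 h5] := hu n; have en0 : e n != 0 by rewrite gt_eqF.
  rewrite /=; case: asboolP => [/h4 ->|/h5[_ ->]]; rewrite /c; first by field.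
  by rewrite subr0; field.
Qed.

Lemma measurable_if_asbool d (T : measurableType d) (A : set T) (f : T -> R) :
  measurable A -> measurable_fun setT f ->
  measurable_fun setT (fun w => if `[< A w >] then f w else 0).
Proof.
move=> mA mf; rewrite (_ : (fun w => _) = (fun w => \1_A w * f w)).
  by apply: measurable_funM => //; exact: measurable_indic.
apply/funext => w; rewrite indicE /in_mem/= /in_set; case: asboolP => _.
- by rewrite mul1r.
- by rewrite mul0r.
Qed.

Section measurability.
Context d (T : measurableType d) (X : R -> T -> R).
Hypothesis X_continuous : forall w, {within `[0, 1], continuous (X ^~ w)}.

Lemma measurable_wealth n :
  (forall s, 0 <= s <= t n -> measurable_fun setT (X s)) ->
  measurable_fun setT (fun w => wealth (X ^~ w) n).
Proof.
elim: n => [//|n IH mX] /=; have tn := ltW (t_lt n).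
apply: (measurable_if_asbool (A := [set w | stays_below (X ^~ w) (t n) (t n.+1) (e n)])).
  apply: measurable_stays_below => //; [exact: ltW|exact: ltW|].
  by move=> s /andP[ts st]; apply: mX; rewrite (le_trans _ ts) ltW.
apply: measurable_funM.
  by apply: IH => s /andP[s0 st]; apply: mX; rewrite s0 (le_trans st).
apply: measurable_funB => //; apply: measurable_funM => //.
by apply: measurable_funB; apply: mX; rewrite ?lexx ?tn ltW.
Qed.

(** Only times up to [x] are asked to be measurable, on an arbitrary measurable space; for [T] with
    the sigma-algebra of time [x] this is adaptedness. *)
Lemma measurable_hedge x : x <= 1 ->
  (forall s, 0 <= s <= x -> measurable_fun setT (X s)) ->
  measurable_fun setT (fun w => hedge (X ^~ w) x).
Proof.
(* The index depends on [x] alone, so the round is the same for all paths. *)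
move=> x1 mX; rewrite /hedge; set n := xget _ _; rewrite /active.
have [/andP[tx xt]|] := boolP (t n < x <= t n.+1) => //=.
apply: (measurable_if_asbool (A := [set w | stays_below (X ^~ w) (t n) x (e n)])).
  apply: measurable_stays_below => //; first exact: ltW.
  by move=> s /andP[ts st]; apply: mX; rewrite (le_trans _ ts) ltW.
apply: measurable_funM => //; apply: measurable_wealth => s /andP[s0 st].
by apply: mX; rewrite s0 (le_trans st)// ltW.
Qed.

End measurability.
End hedge.

(** * Quantile transform *)

Section quantile.
Context (R : realType).

Lemma pinfty_value_gt (f : R -> R) (l p : R) : f @ +oo --> l -> p < l -> exists x, p < f x.
Proof.
move=> /cvgrPdist_lt h pl; have /h : 0 < l - p by rewrite subr_gt0.
move=> -[M [_ hM]]; exists (M + 1); have := hM (M + 1); rewrite ltrDl => /(_ ltr01).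
by have := ler_norm (l - f (M + 1)); lra.
Qed.

Lemma ninfty_value_lt (f : R -> R) (l p : R) : f @ -oo --> l -> l < p -> exists x, f x < p.
Proof.
move=> /cvgrPdist_lt h pl; have /h : 0 < p - l by rewrite subr_gt0.
move=> -[M [_ hM]]; exists (M - 1); have := hM (M - 1); rewrite gtrBl => /(_ ltr01).
by rewrite distrC; have := ler_norm (f (M - 1) - l); lra.
Qed.

(** By continuity the distribution function takes the value [p] at the supremum of the set where it
    is at most [p], so the event is that [X] is at most this supremum. *)
Lemma cdf_composition_uniform d (T : measurableType d) (P : probability T R)
    (X : {RV P >-> R}) p : continuous (fun x => fine (cdf X x)) -> 0 <= p < 1 ->
  P [set w | fine (cdf X (X w)) <= p] = p%:E.
Proof.
move=> cont /andP[p0 p1]; set f := fun x => fine (cdf X x).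
have fE x : P [set w | X w <= x] = (f x)%:E.
  by rewrite fineK// ge0_fin_numE ?cdf_ge0// (le_lt_trans (cdf_le1 X x))// ltry.
have fnd : {homo f : x y / x <= y}.
  by move=> x y xy; rewrite -lee_fin -!fE; exact: (cdf_nondecreasing X xy).
have fy : f @ +oo --> (1 : R).
  by have /fine_cvgP[] := cvg_cdfy1 X.
have fNy : f @ -oo --> (0 : R).
  by have /fine_cvgP[] := cvg_cdfNy0 X.
have [x1 hx1] := pinfty_value_gt fy p1.
(* If the distribution function stays above [p], its limit at minus infinity forces [p = 0], and the
   event is empty. *)
have [[x0 hx0]|S0] := pselect (exists x, f x <= p); last first.
  have pN x : p < f x by rewrite ltNge; apply/negP => h; apply: S0; exists x.
  have -> : p = 0.
    apply/eqP; rewrite eq_le p0 andbT leNgt; apply/negP => /(ninfty_value_lt fNy)[x xp].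
    by have := lt_trans xp (pN x); rewrite ltxx.
  rewrite (_ : [set w | _] = set0) ?measure0//; apply/seteqP; split => // w /=.
  by rewrite leNgt (le_lt_trans p0 (pN _)).
pose S := [set x | f x <= p].
have hS : has_sup S.
  split; first by exists x0.
  exists x1 => x /= fx; rewrite leNgt; apply/negP => /ltW/fnd x1x.
  by have := le_lt_trans (le_trans x1x fx) hx1; rewrite ltxx.
have near x e : 0 < e -> exists2 r, 0 < r & forall y, `|x - y| < r -> `|f x - f y| < e.
  move=> e0; have /cvgrPdist_lt/(_ e e0)[r /= r0 h] := cont x.
  by exists r.
have fs : f (sup S) = p.
  apply/eqP; rewrite eq_le; apply/andP; split; rewrite leNgt; apply/negP => h.
    have [|r r0 hr] := near (sup S) (f (sup S) - p); first by rewrite subr_gt0.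
    have [y Sy ys] := sup_adherent r0 hS.
    have := hr y; rewrite ger0_norm ?subr_ge0; last exact: sup_upper_bound.
    rewrite ltrBlDl -ltrBlDr => /(_ ys); move: Sy; rewrite /S/=.
    by have := ler_norm (f (sup S) - f y); lra.
  have [|r r0 hr] := near (sup S) (p - f (sup S)); first by rewrite subr_gt0.
  have := hr (sup S + r / 2); rewrite opprD addNKr normrN gtr0_norm ?divr_gt0//.
  rewrite ltr_pdivrMr// ltr_pMr// (ltr1n R 2) distrC => /(_ isT) h2.
  have : S (sup S + r / 2).
    by rewrite /S/=; have := ler_norm (f (sup S + r / 2) - f (sup S)); lra.
  by move=> /(sup_upper_bound hS); rewrite leNgt ltrDl divr_gt0.
rewrite -fs -fE; congr (P _); apply/seteqP; split => w /=.
  rewrite fs => h; exact: sup_upper_bound.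
by move=> /fnd.
Qed.

(** Generalized inverse of [G]. Outside []0, 1[], where the infimum need not be meaningful, 0 is a
    default value. *)
Definition quantile (G : R -> R) p : R :=
  if 0 < p < 1 then inf [set y | p <= G y] else 0.

Context (G : cumulativeBounded (0 : R) (1 : R)).

(** Right-continuity of [G] makes the infimum belong to the set, which turns the generalized inverse
    into a Galois adjoint. *)
Lemma quantile_le p x : 0 < p < 1 -> (quantile G p <= x) = (p <= G x).
Proof.
move=> p01; rewrite /quantile p01; move: p01 => /andP[p0 p1].
have Gnd := cumulative_is_nondecreasing G.
set S := [set y | _].
have [y0 hy0] := ninfty_value_lt (cumulativeNy G) p0.
have [y1 hy1] := pinfty_value_gt (cumulativey G) p1.
have S0 : S !=set0 by exists y1; exact: ltW.
have lS : has_lbound S.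
  exists y0 => y /= py; rewrite leNgt; apply/negP => /ltW/Gnd h.
  by have := le_lt_trans (le_trans py h) hy0; rewrite ltxx.
apply/idP/idP => [h|h]; last exact: ge_inf.
rewrite leNgt; apply/negP => Gp.
have [|r hr] := nondecreasing_right_continuousP x (e := (p - G x) / 2) G.
  by rewrite divr_gt0// subr_gt0.
have [|y Sy yr] := inf_lt (x := x + r%:num) S0; first by rewrite (le_lt_trans h)// ltrDl.
have Gy : G y <= G (x + r%:num) := Gnd _ _ (ltW yr).
have Gr : G (x + r%:num) <= G x + (p - G x) / 2 := hr.
have pG : p <= G y := Sy; lra.
Qed.

Lemma measurable_quantile : measurable_fun setT (quantile G).
Proof.
have m01 : measurable (`]0, 1[ : set R) by exact: measurable_itv.
apply: (measurability (@RGenOInfty.G R)) => [|/= _ [_] [r] -> <-].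
  exact: RGenOInfty.measurableE.
rewrite setTI (_ : _ @^-1` _ = (`]0, 1[ `&` `]G r, +oo[) `|`
    (if r < 0 then ~` `]0, 1[ else set0)); last first.
  apply/seteqP; split => p /=; rewrite !in_itv/= !andbT.
    have [p01|np] := boolP (0 < p < 1).
      by rewrite ltNge (quantile_le _ p01) -ltNge => h; left.
    rewrite {1}/quantile (negbTE np) => ->; right => /=.
    by rewrite in_itv/=; exact/negP.
  move=> [[p01]|]; first by rewrite ltNge [in X in _ -> X]ltNge (quantile_le _ p01).
  case: ifP => // r0 /=; rewrite in_itv/= => /negP np.
  by rewrite /quantile (negbTE np).
apply: measurableU; first by apply: measurableI => //; exact: measurable_itv.
by case: ifP => // _; exact: measurableC.
Qed.

(** Up to the null event that [U] leaves []0, 1[], the event is [U w <= G x] by adjunction. *)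
Lemma quantile_transform d (T : measurableType d) (P : probability T R)
    (U : T -> R) x : measurable_fun setT U ->
  (forall p, 0 <= p < 1 -> P [set w | U w <= p] = p%:E) ->
  P [set w | quantile G (U w) <= x] = (G x)%:E.
Proof.
move=> mU unif.
have mle p : measurable [set w | U w <= p].
  rewrite (_ : [set w | _] = U @^-1` `]-oo, p]); last first.
    by apply/seteqP; split => w /=; rewrite in_itv.
  by rewrite -[X in measurable X]setTI; exact: (mU measurableT _ (measurable_itv _)).
have mge : measurable [set w | 1 <= U w].
  rewrite (_ : [set w | _] = U @^-1` `[1, +oo[); last first.
    by apply/seteqP; split => w /=; rewrite in_itv/= andbT.
  by rewrite -[X in measurable X]setTI; exact: (mU measurableT _ (measurable_itv _)).
have mE : measurable [set w | quantile G (U w) <= x].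
  rewrite (_ : [set w | _] = (quantile G \o U) @^-1` `]-oo, x]); last first.
    by apply/seteqP; split => w /=; rewrite in_itv.
  have mq : measurable_fun setT (quantile G \o U).
    by apply: measurableT_comp => //; exact: measurable_quantile.
  by rewrite -[X in measurable X]setTI; apply: mq => //; exact: measurable_itv.
have G0 : 0 <= G x by rewrite -lee_fin -cdf_lebesgue_stieltjes_id; exact: cdf_ge0.
have G1 : G x <= 1 by rewrite -lee_fin -cdf_lebesgue_stieltjes_id; exact: cdf_le1.
have N0 : P [set w | U w <= 0] = 0%E by rewrite unif// lexx/=.
have N1 : P [set w | 1 <= U w] = 0%E.
  apply/eqP; rewrite eq_le measure_ge0 andbT; apply/lee_addgt0Pr => r r0; rewrite add0e.
  have [r1|r1] := leP 1 r.
    by apply: le_trans (probability_le1 P mge) _; rewrite lee_fin.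
  have := unif (1 - r); rewrite subr_ge0 (ltW r1) gtrBl r0 => /(_ isT) h.
  have := probability_setC P (mle (1 - r)); rewrite h -EFinB (_ : 1 - (1 - r) = r); last by ring.
  move=> <-.
  apply: le_measure; rewrite ?inE//; first exact: measurableC.
  move=> w /= w1; apply/negP; rewrite -ltNge; apply: lt_le_trans w1; lra.
pose N := [set w | U w <= 0] `|` [set w | 1 <= U w].
have mN : measurable N by exact: measurableU.
have PN : P N = 0%E.
  apply/eqP; rewrite eq_le measure_ge0 andbT.
  apply: (@le_trans _ _ (P [set w | (U w <= 0)%R] + P [set w | (1 <= U w)%R])%E).
    exact: measureU2.
  by rewrite N0 N1 adde0.
have ae_eq (A C : set T) : measurable A -> measurable C ->
    (forall w, 0 < U w < 1 -> A w <-> C w) -> P A = P C.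
  have le (A' C' : set T) : measurable A' -> measurable C' ->
      (forall w, 0 < U w < 1 -> A' w -> C' w) -> (P A' <= P C')%E.
    move=> mA mC AC; apply: (@le_trans _ _ (P (C' `|` N))).
      apply: le_measure; rewrite ?inE//; first exact: measurableU.
      move=> w Aw; have [w0|w0] := leP (U w) 0; first by right; left.
      have [w1|w1] := leP 1 (U w); first by right; right.
      by left; apply: AC => //; rewrite w0.
    apply: (@le_trans _ _ (P C' + P N)%E); first exact: measureU2.
    by rewrite PN adde0.
  move=> mA mC AC; apply/eqP; rewrite eq_le; apply/andP; split; apply: le => // w w01.
  - by move/(AC w w01).
  - by move/(AC w w01).
transitivity (P [set w | U w <= G x]).
  by apply: ae_eq => // w w01 /=; rewrite quantile_le.
(* Uniformity is assumed only for [p < 1]; for [G x = 1] the event has full probability since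
   [U < 1] almost surely. *)
have [Gx|Gx] := ltP (G x) 1; first by apply: unif; rewrite G0.
have -> : G x = 1 by apply/eqP; rewrite eq_le G1.
rewrite -(probability_setT P); apply: ae_eq => // w /andP[_ /ltW ?]; split => //.
Qed.

End quantile.

(** * The process *)

(** The strategy gains 1, so its integral is [gls_cst al]; dividing by this constant and multiplying
    by [c] only rescales the jumps. *)
Lemma gls_integral_hedge (R : realType) (al ga c : R) (t e : nat -> R) (g : R -> R) :
  0 < al < 2^-1 -> ga < 1 ->
  (forall n, 0 < t n) -> (forall n, t n < 1) -> (forall n, t n < t n.+1) ->
  (forall n, 0 < e n) -> {within `[0, 1], continuous g} ->
  (\int[(@lebesgue_measure R) \x (@lebesgue_measure R)]_z
     (slobodeckij (2 * al - 4 + ga) g z)%:E < +oo)%E ->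
  (exists n, ~ stays_below g (t n) (t n.+1) (e n)) ->
  frac_norm_finite al 1 (fun x => c / gls_cst al * hedge t e g x) /\
  gls_integral al 1 (fun x => c / gls_cst al * hedge t e g x) g = c.
Proof.
move=> al12 ga1 t0 t1 tt e0 cg gfin ex.
have [s [s01 hs sum1]] := hedge_step t0 t1 tt e0 cg ex.
pose k := c / gls_cst al; pose s' := [seq (k * p.1, p.2) | p <- s].
have s'01 p : p \in s' -> 0 < p.2 < 1 by move=> /mapP[q /s01 q01 ->].
have -> : (fun x => c / gls_cst al * hedge t e g x) = step s'.
  apply/funext => x; rewrite hs /step big_map mulr_sumr.
  by apply: eq_bigr => p _; rewrite mulrA.
split.
  by apply: frac_norm_finite_step => //; move: al12 => /andP[? ?]; apply/andP; split; lra.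
rewrite (gls_integral_step al12 ga1 s'01 cg gfin) big_map.
rewrite (eq_bigr (fun p => k * (p.1 * (g 1 - g p.2)))); last by move=> p _; rewrite /= mulrA.
by rewrite -mulr_sumr sum1 mulr1 mulrC divfK// gt_eqF// gls_cst_gt0.
Qed.

Section past_and_law.
Context d (T : measurableType d) (R : realType) (P : probability T R)
  (F : R -> set (set T)) (H : R) (B : R -> T -> R).
Hypothesis FF : complete_left_continuous_filtration P F.
Hypothesis H_gt : 2^-1 < H.
Hypothesis H_lt : H < 1.
Hypothesis BF : fractional_brownian_motion P F H B.

Lemma measurable_fbm_past s t : 0 <= s -> s <= t -> t <= 1 ->
  measurable_fun [set: g_sigma_algebraType (F t)] (B s).
Proof.
move=> s0 st t1 _ A mA; rewrite setTI; apply: sub_sigma_algebra.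
apply: (filtration_nondecreasing FF s0 st t1).
by apply: (fbm_adapted BF) => //; rewrite s0 (le_trans st).
Qed.

(** [F t] is already a sigma-algebra, hence equal to the one it generates, and measurability lemmas
    apply on [g_sigma_algebraType (F t)]. *)
Lemma adapted_measurable (X : R -> T -> R) :
  (forall t, 0 <= t <= 1 -> measurable_fun [set: g_sigma_algebraType (F t)] (X t)) ->
  adapted F X.
Proof.
move=> mX t t01 A mA; rewrite -(sigma_algebra_id (filtration_sigma_algebra FF t01)).
by have := mX t t01 measurableT A mA; rewrite setTI.
Qed.

(** The interval estimate [gaussian_interval_le] makes the distribution function Lipschitz with
    constant 2. *)
Lemma cdf_gaussian_continuous (X : {RV P >-> R}) : gaussian_variable P X ->
  P.-integrable setT (EFin \o X) -> \int[P]_w X w = 0 ->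
  P.-integrable setT (EFin \o (fun w => X w ^+ 2)) -> \int[P]_w X w ^+ 2 = 1 ->
  continuous (fun x => fine (cdf X x)).
Proof.
move=> h1 h2 h3 h4 h5; set f := fun x => fine (cdf X x).
have mX : measurable_fun setT X by exact: measurable_funPT.
have fE x : (f x)%:E = P [set w | X w <= x].
  by rewrite fineK// ge0_fin_numE ?cdf_ge0// (le_lt_trans (cdf_le1 X x))// ltry.
have mle x : measurable [set w | X w <= x].
  rewrite (_ : [set w | _] = X @^-1` `]-oo, x]); last first.
    by apply/seteqP; split => w /=; rewrite in_itv.
  by rewrite -[X in measurable X]setTI; apply: mX => //; exact: measurable_itv.
have mbt x y : measurable [set w | x <= X w <= y].
  rewrite (_ : [set w | _] = X @^-1` `[x, y]); last first.
    by apply/seteqP; split => w /=; rewrite in_itv.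
  by rewrite -[X in measurable X]setTI; apply: mX => //; exact: measurable_itv.
have fnd : {homo f : x y / x <= y}.
  by move=> x y xy; rewrite -lee_fin !fE; exact: (cdf_nondecreasing X xy).
have lip x y : x <= y -> f y - f x <= 2 * (y - x).
  move=> xy; rewrite lerBlDr -lee_fin EFinD !fE addeC.
  apply: (@le_trans _ _ (P [set w | (X w <= x)%R] + P [set w | (x <= X w <= y)%R])%E).
    apply: (@le_trans _ _ (P ([set w | X w <= x] `|` [set w | x <= X w <= y]))).
      apply: le_measure; rewrite ?inE//; first exact: measurableU.
      move=> w /= Xy; have [wx|xw] := leP (X w) x; [by left|right].
      by rewrite /= (ltW xw).
    exact: measureU2.
  exact/leeD2l/gaussian_interval_le.
move=> x; apply/cvgrPdist_lt => e e0.
exists (e / 2); first exact: divr_gt0.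
move=> y /=; rewrite ltr_pdivlMr// => xy.
have lipn u v : u <= v -> `|f u - f v| <= `|u - v| * 2.
  move=> uv; rewrite distrC ger0_norm ?subr_ge0 ?fnd//.
  by rewrite distrC ger0_norm ?subr_ge0// mulrC lip.
apply: le_lt_trans xy; have [|/ltW] := leP x y; first exact: lipn.
by move=> /lipn; rewrite distrC [X in _ <= X * _ -> _]distrC.
Qed.

Lemma measurable_RV (X : T -> R) : measurable_fun setT X ->
  exists Y : {RV P >-> R}, (Y : T -> R) = X.
Proof.
move=> mX; pose Y : {mfun T >-> R} := HB.pack X (isMeasurableFun.Build _ _ _ _ X mX).
by exists Y.
Qed.

End past_and_law.

Theorem theorem3p1 (R : realType) (d : measure_display) (T : measurableType d)
    (P : probability T R) (Pcomplete : measure_is_complete P)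
    (F : R -> set (set T))
    (F_filtration : complete_left_continuous_filtration P F)
    (H : R) (H_gt : 2^-1 < H) (H_lt : H < 1)
    (B : R -> T -> R) (B_fbm : fractional_brownian_motion P F H B)
    (alpha : R) (alpha_gt : 1 - H < alpha) (alpha_lt : alpha < 2^-1)
    (G : cumulativeBounded (0 : R) (1 : R)) :
  exists zeta : R -> T -> R,
    [/\ adapted F zeta,
        {ae P, forall w, frac_norm_finite alpha 1 (zeta ^~ w)} &
        exists X : {RV P >-> R},
          {ae P, forall w, X w = gls_integral alpha 1 (zeta ^~ w) (B ^~ w)} /\
          forall x : R, cdf X x = (G x)%:E].
Proof.
pose t (n : nat) : R := 1 - 2^-1 ^+ n.+1.
have hp n : 0 < 2^-1 ^+ n.+1 :> R by rewrite exprn_gt0.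
have t_lt1 n : t n < 1 by rewrite gtrBl.
have t_half n : 2^-1 <= t n.
  have : 2^-1 ^+ n.+1 <= 2^-1 :> R by rewrite exprS ger_pMr ?exprn_ile1// invf_le1 ?ler1n.
  by rewrite /t; lra.
have t_gt0 n : 0 < t n by apply: lt_le_trans (t_half n).
have t_lt n : t n < t n.+1.
  by rewrite /t ltrD2l ltrN2 [ltLHS]exprS gtr_pMl// invf_lt1 ?ltr1n.
have [e [e_gt0 exit]] := ae_exit F_filtration H_gt H_lt B_fbm
  (fun n => ltW (t_gt0 n)) t_lt (fun n => ltW (t_lt1 n)).
pose V0 w := (B 2^-1 w - B 0 w) * (2^-1 `^ H)^-1.
have h001 : 0 + 2^-1 <= 1 :> R by lra.
have := normalized_increment F_filtration H_gt H_lt B_fbm (lexx 0) h001 (t := 0).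
rewrite add0r invr_gt0 => /(_ (ltr0n _ 2)); rewrite -/V0 => -[V1 V2 V3 V4 V5].
have [V VE] := measurable_RV P V1.1; rewrite -VE in V1 V2 V3 V4 V5.
pose U w := fine (cdf V (V w)).
have mcdf : measurable_fun setT (fun x => fine (cdf V x)).
  by apply: continuous_measurable_fun; exact: cdf_gaussian_continuous.
have unif p : 0 <= p < 1 -> P [set w | U w <= p] = p%:E.
  by apply: cdf_composition_uniform; exact: cdf_gaussian_continuous.
pose h x := quantile G (fine (cdf V x)).
have mh : measurable_fun setT h.
  by apply: (measurableT_comp (measurable_quantile G)).
have mV : measurable_fun setT V by exact: V1.1.
have [X XE] := measurable_RV P (measurableT_comp mh mV).
exists (fun x w => X w / gls_cst alpha * hedge t e (B ^~ w) x).
have alpha12 : 0 < alpha < 2^-1 by apply/andP; split; lra.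
have good : {ae P, forall w,
    frac_norm_finite alpha 1 (fun x => X w / gls_cst alpha * hedge t e (B ^~ w) x) /\
    gls_integral alpha 1 (fun x => X w / gls_cst alpha * hedge t e (B ^~ w) x) (B ^~ w) = X w}.
  have H01 : 0 < H < 1 by apply/andP; split; lra.
  have := fbm_slobodeckij_finite F_filtration B_fbm H01 alpha_gt.
  apply: filterS2 exit => w ex fin.
  (* This [ga] is below 1 because [alpha > 1 - H], and it turns [2 alpha - 4 + ga] into the exponent
     of [fbm_slobodeckij_finite]. *)
  apply: (@gls_integral_hedge _ _ (2 - H - alpha)) => //; first by lra.
    exact: (@fbm_continuous _ _ _ _ _ _ _ B_fbm w).
  by rewrite (_ : 2 * alpha - 4 + (2 - H - alpha) = alpha - 2 - H)//; ring.
split.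
- apply: (adapted_measurable F_filtration) => x /andP[x0 x1].
  have [xh|hx] := leP x 2^-1.
    (* Whichever index is chosen, [x <= 1/2 <= t n]: no round has begun, and [X w], not yet known at
       time [x], is multiplied by 0. *)
    rewrite (_ : (fun w => _) = cst 0)//; apply/funext => w.
    rewrite /hedge /active; set n := xget _ _.
    by rewrite (ltNge (t n)) (le_trans xh (t_half n)) mulr0.
  have mB s : 0 <= s <= x -> measurable_fun [set: g_sigma_algebraType (F x)] (B s).
    by move=> /andP[s0 sx]; exact: (measurable_fbm_past F_filtration B_fbm).
  apply: measurable_funM; last first.
    by apply: measurable_hedge => //; exact: fbm_continuous B_fbm.
  apply: measurable_funM => //; rewrite XE.
  apply: (measurableT_comp mh); rewrite VE /V0.
  by apply: measurable_funM => //; apply: measurable_funB; apply: mB; apply/andP; split; lra.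
- by apply: filterS good => w [].
- exists X; split; first by apply: filterS good => w [_ ->].
  move=> x; rewrite -(quantile_transform G x _ unif); last exact: measurableT_comp mcdf mV.
  rewrite /cdf /distribution /pushforward XE; congr (P _).
Qed.
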